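(* Let $1\le q<p$ and let $\tilde{\mathcal K}$ be the family of all subsets of $\{q+1,\dots,p\}$, including the empty set. Consider the following 4 cases. Case 1. $\tilde K$ minimizes $AIC(K)$ with respect to $K\in\tilde{\mathcal K}$. Define $d=\sqrt{\left(\exp\left(\frac{2f(n)}{n}\right)-1\right)(n-p)}$. Case 2. $\tilde K$ minimizes $C_K$ with respect to $K\in\tilde{\mathcal K}$. Define $d=\sqrt2$. Case 3. $\tilde K$ minimizes $B_K$ with respect to $K\in\tilde{\mathcal K}$. Define $d=1$. Case 4. $\tilde K$ is the set of $j\in\{q+1,\dots,p\}$ for which the $t$-test of $H_{0j}:\beta_j=0$ against $H_{Aj}:\beta_j\ne0$ leads to acceptance of $H_{0j}$. Let $d>0$ be the critical value of the $t$-test for $j=p$, i.e. $H_{0p}$ is accepted if and only if $|T|<d$. In each of these 4 cases, the minimum coverage probability of the naive $1-\alpha$ confidence interval $I(\tilde K)$ (the infimum of $P(\theta\in I(\tilde K))$ over all $\beta\in\mathbb R^p$, $\sigma>0$) is bounded above by the minimum (infimum) over $\gamma\ge0$ of $$(1-\alpha)+\int_0^\infty\int_{-d}^{d}\big(k(wx,w,\gamma,\rho)-k^\dagger(wx,w,\gamma,\rho)\big)\,\phi(wx-\gamma)\,w\,f_W(w)\,dx\,dw,$$ where $\phi$ denotes the $N(0,1)$ probability density function and $f_W$ denotes the probability density function of $W$.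
   Context: Model: $Y=X\beta+\varepsilon$, where $X$ is a known $n\times p$ matrix with linearly independent columns, $n>p$, $\beta\in\mathbb R^p$ is unknown, $\varepsilon\sim N(0,\sigma^2I_n)$ and $\sigma^2>0$ is unknown. The quantity of interest is $\theta=a^T\beta$ with $a\in\mathbb R^p$, $a\ne0$, known. Fix $\alpha\in(0,1)$. Let $\hat\beta$ be the least squares estimator of $\beta$, $\hat\Theta=a^T\hat\beta$, and $RSS=(Y-X\hat\beta)^T(Y-X\hat\beta)$. For $K\subset\{q+1,\dots,p\}$, $|K|$ is the number of elements of $K$; $\hat\beta_K$ is the least squares estimator of $\beta$ subject to $\beta_i=0$ for all $i\in K$ (so $\hat\beta_\emptyset=\hat\beta$); $RSS_K=(Y-X\hat\beta_K)^T(Y-X\hat\beta_K)$; $S_K^2=RSS_K/(n-p+|K|)$; $v(K)=\mathrm{Var}(a^T\hat\beta_K)/\sigma^2$. Let $t(m)$ be defined by $P(-t(m)\le \tau\le t(m))=1-\alpha$ for $\tau$ having Student's $t$ distribution with $m$ degrees of freedom. Define $$I(K)=\big[a^T\hat\beta_K-d_K,\ a^T\hat\beta_K+d_K\big],\qquad d_K=t(n-p+|K|)\,S_K\sqrt{v(K)};$$ for a data-dependent set $\tilde K$, $I(\tilde K)$ is $I(K)$ evaluated at $K=\tilde K$ (the ''naive'' interval). Criteria: $AIC(K)=n\ln(RSS_K)+2(p-|K|)f(n)$, where $f(n)=1$ (AIC) or $f(n)=\frac12\ln n$ (BIC); $C_K=\dfrac{RSS_K}{RSS/(n-p)}-n+2(p-|K|)$;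 $B_K=\dfrac{RSS_K}{n-p+|K|}$. Ties among minimizers occur with probability zero and are immaterial. The $t$-test of $H_{0j}:\beta_j=0$ accepts $H_{0j}$ when $|T_j|<c_j$, where $c_j>0$ is a fixed critical value and $T_j=\hat\beta_j\big/\big(\sqrt{RSS/(n-p)}\sqrt{[(X^TX)^{-1}]_{jj}}\big)$; write $T=T_p$. Let $V=(v_{ij})$ be the $2\times2$ covariance matrix of $(\hat\Theta,\hat\beta_p)$ divided by $\sigma^2$; $\rho=\mathrm{Corr}(\hat\Theta,\hat\beta_p)=v_{12}/\sqrt{v_{11}v_{22}}$ (the indices $q+1,\dots,p$ are labelled so that $|\mathrm{Corr}(\hat\Theta,\hat\beta_j)|$ is maximized over $j\in\{q+1,\dots,p\}$ at $j=p$); and $W=\sqrt{RSS/((n-p)\sigma^2)}$, which is distributed as $\sqrt{Q/(n-p)}$ with $Q\sim\chi^2_{n-p}$. The variable $\gamma$ stands for the possible values of $\beta_p/(\sigma\sqrt{v_{22}})$. Define $$\ell_1(w)=-t(n-p)w,\qquad u_1(w)=t(n-p)w,$$ $$\ell_2(h,w,\rho)=\rho h-t(n-p+1)\sqrt{\tfrac{(n-p)w^2+h^2}{n-p+1}}\sqrt{1-\rho^2},\qquad u_2(h,w,\rho)=\rho h+t(n-p+1)\sqrt{\tfrac{(n-p)w^2+h^2}{n-p+1}}\sqrt{1-\rho^2},$$ $$k^\dagger(h,w,\gamma,\rho)=\Psi\big(\ell_1(w),u_1(w);\rho(h-\gamma),1-\rho^2\big),\qquad k(h,w,\gamma,\rho)=\Psi\big(\ell_2(h,w,\rho),u_2(h,w,\rho);\rho(h-\gamma),1-\rho^2\big),$$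 where $\Psi(x,y;\mu,v)=P(x\le Z\le y)$ for $Z\sim N(\mu,v)$ (with $N(\mu,0)$ the point mass at $\mu$). *)

(* Defs.v *)
From mathcomp Require Export all_boot all_order all_algebra.
From mathcomp Require Export all_classical all_reals all_analysis.
Export Order.TTheory GRing.Theory Num.Theory numFieldNormedType.Exports.

Set Implicit Arguments.
Unset Strict Implicit.
Unset Printing Implicit Defensive.

Local Open Scope classical_set_scope.
Local Open Scope ring_scope.

Definition Gamma (R : realType) (s : R) : R :=
  \int[lebesgue_measure]_(x in `]0, +oo[) (x `^ (s - 1) * expR (- x)).

Definition student_pdf (R : realType) (m : nat) (x : R) : R :=
  Gamma (m.+1%:R / 2) / (Num.sqrt (m%:R * pi) * Gamma (m%:R / 2))
    * (1 + x ^+ 2 / m%:R) `^ (- (m.+1%:R / 2)).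

Definition student_prob (R : realType) (m : nat) (A : set R) : \bar R :=
  (\int[lebesgue_measure]_(x in A) (student_pdf m x)%:E)%E.

(* For 0 < alpha < 1 and 0 < m there is exactly one such t. *)
Definition tquantile (R : realType) (alpha : R) (m : nat) : R :=
  xget 0 [set t : R | student_prob m `[- t, t] = (1 - alpha)%:E].

(* [normal_prob] takes the standard deviation, and at standard deviation 0 it
   is a dummy law rather than the point mass, hence the case distinction. *)
Definition Psi (R : realType) (x y mu v : R) : R :=
  if v == 0 then (if x <= mu <= y then 1 else 0)
  else fine (normal_prob mu (Num.sqrt v) `[x, y]).

Definition is_pdf_of d (Om : measurableType d) (R : realType)
    (P : probability Om R) (Z : Om -> R) (f : R -> R) : Prop :=
  [/\ measurable_fun [set: R] f,
      forall x, 0 <= f x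
    & forall A : set R, measurable A ->
        P (Z @^-1` A) = (\int[lebesgue_measure]_(x in A) (f x)%:E)%E].

Definition corr d (Om : measurableType d) (R : realType)
    (P : probability Om R) (Z1 Z2 : Om -> R) : R :=
  fine (covariance P Z1 Z2)
    / Num.sqrt (fine (variance P Z1) * fine (variance P Z2)).

(* The product rule for all measurable boxes says that the coordinates of
   [Y - X beta] are independent N(0, sigma^2), i.e. that it is
   N(0, sigma^2 I_n). *)
Definition normal_linear_model d (Om : measurableType d) (R : realType)
    (n p : nat) (P : probability Om R) (X : 'M[R]_(n, p)) (beta : 'cV[R]_p)
    (sigma : R) (Y : Om -> 'cV[R]_n) : Prop :=
  (forall i, measurable_fun [set: Om] (fun w => Y w i 0)) /\
  forall A : 'I_n -> set R, (forall i, measurable (A i)) ->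
    P [set w | forall i, A i ((Y w - X *m beta) i 0)]
    = (\prod_(i < n) normal_prob 0 sigma (A i))%E.

Section LeastSquares.
Context {R : realType} {n p : nat}.
Implicit Types (X : 'M[R]_(n, p)) (a b : 'cV[R]_p) (y : 'cV[R]_n).
Implicit Type K : {set 'I_p}.

Definition sqresid X y b : R := ((y - X *m b)^T *m (y - X *m b)) 0 0.

Definition is_lse X y K b : Prop :=
  (forall i, i \in K -> b i 0 = 0) /\
  forall b' : 'cV[R]_p, (forall i, i \in K -> b' i 0 = 0) ->
    sqresid X y b <= sqresid X y b'.

(* When X has full column rank, the minimiser exists and is unique. *)
Definition lse X K y : 'cV[R]_p := xget 0 [set b | is_lse X y K b].

Definition dotv a b : R := (a^T *m b) 0 0.

Definition RSS X K y : R := sqresid X y (lse X K y).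

Definition Sres X K y : R := Num.sqrt (RSS X K y / (n - p + #|K|)%:R).

(* [v] stands for v(K) = Var(a^T lse_K) / sigma^2. *)
Definition naive_ci X a (alpha : R) (v : {set 'I_p} -> R) K y : interval R :=
  let dK := tquantile alpha (n - p + #|K|) * Sres X K y * Num.sqrt (v K) in
  `[dotv a (lse X K y) - dK, dotv a (lse X K y) + dK].

Definition AIC X (f : R) y K : R :=
  n%:R * ln (RSS X K y) + 2 * (p - #|K|)%:R * f.

Definition Cp X y K : R :=
  RSS X K y / (RSS X finset.set0 y / (n - p)%:R) - n%:R + 2 * (p - #|K|)%:R.

Definition Bcrit X y K : R := RSS X K y / (n - p + #|K|)%:R.

Definition tstat X (j : 'I_p) y : R :=
  lse X finset.set0 y j 0
    / (Num.sqrt (RSS X finset.set0 y / (n - p)%:R)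
       * Num.sqrt (invmx (X^T *m X) j j)).

(* Indices are 0-based: [droppable q] is {q+1, ..., p} of the 1-based
   convention. *)
Definition droppable (q : nat) : {set 'I_p} := [set j : 'I_p | (q <= j)%N]%SET.

(* RSS = 0 is a null event, on which the criteria and the t-statistics are
   undefined; nothing is required of the selection there. *)
Definition minimizes X (q : nat) (crit : 'cV[R]_n -> {set 'I_p} -> R)
    (Ktilde : 'cV[R]_n -> {set 'I_p}) : Prop :=
  forall y, 0 < RSS X finset.set0 y ->
    Ktilde y \subset droppable q /\
    forall K, K \subset droppable q -> crit y (Ktilde y) <= crit y K.

Definition accepted_by_ttest X (q : nat) (c : 'I_p -> R)
    (Ktilde : 'cV[R]_n -> {set 'I_p}) : Prop :=
  forall y, 0 < RSS X finset.set0 y ->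
    Ktilde y = [set j in droppable q | `|tstat X j y| < c j]%SET.

(* f = 1 gives AIC, f = ln n / 2 gives BIC. *)
Definition case1 X (q : nat) (Ktilde : 'cV[R]_n -> {set 'I_p}) (d : R) : Prop :=
  exists f : R, [/\ f = 1 \/ f = ln n%:R / 2,
    minimizes X q (AIC X f) Ktilde
  & d = Num.sqrt ((expR (2 * f / n%:R) - 1) * (n - p)%:R)].

Definition case2 X (q : nat) (Ktilde : 'cV[R]_n -> {set 'I_p}) (d : R) : Prop :=
  minimizes X q (Cp X) Ktilde /\ d = Num.sqrt 2.

Definition case3 X (q : nat) (Ktilde : 'cV[R]_n -> {set 'I_p}) (d : R) : Prop :=
  minimizes X q (Bcrit X) Ktilde /\ d = 1.

Definition case4 X (q : nat) (l : 'I_p) (Ktilde : 'cV[R]_n -> {set 'I_p})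
    (d : R) : Prop :=
  exists c : 'I_p -> R, [/\ forall j, j \in droppable q -> 0 < c j,
    accepted_by_ttest X q c Ktilde
  & d = c l].

End LeastSquares.

(* [m] stands for n - p. *)
Section Bound.
Context {R : realType}.
Variables (alpha : R) (m : nat).
Implicit Types h w gamma rho : R.

Definition ell1 w : R := - (tquantile alpha m * w).
Definition u1 w : R := tquantile alpha m * w.

Definition halfwidth2 h w rho : R :=
  tquantile alpha m.+1 * Num.sqrt ((m%:R * w ^+ 2 + h ^+ 2) / m.+1%:R)
    * Num.sqrt (1 - rho ^+ 2).
Definition ell2 h w rho : R := rho * h - halfwidth2 h w rho.
Definition u2 h w rho : R := rho * h + halfwidth2 h w rho.

Definition kdagger h w gamma rho : R :=
  Psi (ell1 w) (u1 w) (rho * (h - gamma)) (1 - rho ^+ 2).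
Definition kfun h w gamma rho : R :=
  Psi (ell2 h w rho) (u2 h w rho) (rho * (h - gamma)) (1 - rho ^+ 2).

Definition coverage_bound (fW : R -> R) (d rho gamma : R) : \bar R :=
  ((1 - alpha)%:E +
   \int[lebesgue_measure]_(w in `]0%R, +oo[)
     \int[lebesgue_measure]_(x in `[(- d)%R, d])
       ((kfun (w * x) w gamma rho - kdagger (w * x) w gamma rho)
          * normal_pdf 0 1 (w * x - gamma) * w * fW w)%:E)%E.

End Bound.

(* Main.v *)
(* Write eps = (Y - X beta) / sigma0, a standard Gaussian vector. Fix gamma >= 0,
   let beta_l = gamma sigma0 sqrt v22, and let all other coefficients equal M.
   As M grows, each of the four selection rules drops no index other than l,
   except on the event that a linear statistic of eps exceeds M, whose
   probability tends to 0. Apart from that event (and a null set of ties), l is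
   dropped exactly when |h| <= d W, where h = betahat_l / (sigma0 sqrt v22), and
   then the naive interval covers exactly when the standardized error of
   Thetahat lies in [ell2, u2]; otherwise it covers when this error lies in
   [ell1, u1]. The probability of this limiting event does not depend on M:
   conditioning on (h, W) gives the terms in k and k^dagger, and Student's theorem
   gives 1 - alpha.

   The laws involved are obtained from the Cameron-Martin shift formula: averaging
   it over all shifts along a unit vector u integrates out the coordinate along u
   of any integrand of the form Phi(<u, x>, x) with Phi(z, .) invariant under
   translation by u. This replaces independence and rotation invariance.
   Student's law then follows, up to its normalizing constant, from scaling the
   residual vector, and the constant is recovered from the total mass. *)
From HB Require Import structures.
Require Import Defs.
From mathcomp Require Import measurable_realfun.
From mathcomp Require Import ring lra.

Set Implicit Arguments.
Unset Strict Implicit.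
Unset Printing Implicit Defensive.

Local Open Scope classical_set_scope.
Local Open Scope ring_scope.

(** [P beta sigma] is an unrelated measure for each parameter, and the model speaks only of boxes.
    Everything is therefore moved to the space of vectors with the sigma-algebra generated by boxes,
    where the standardized error has the same law for every parameter; so [beta] can run off to
    infinity while one fixed measure [mu] evaluates the limiting event. The law of [W] is never
    computed. Its density is given and serves to integrate over [W] and to discard [RSS = 0];
    Student's law involves [W] only through the number E W, which is eliminated by the total mass.
    The difference of k and k^dagger arises from writing P([l] kept, z1 in its interval) as P(z1 in
    its interval) minus P([l] dropped, z1 in its interval). The first term is the unconditional
    Student coverage; what remains are integrals over |h| <= d W. Since v(K) and rho are given as
    moments, Gaussian first and second moments are needed to turn them into lengths and cosines of
    vectors in the column space of [X]. *)

Definition pushforward_measure d d' (T : measurableType d)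
    (T' : measurableType d') (R : realType) (m : {measure set T -> \bar R})
    (f : T -> T') (mf : measurable_fun setT f) : {measure set T' -> \bar R} :=
  measure_function_pushforward__canonical__measure_function_Measure m mf.

(** * Integration and Gaussian vectors *)

Section LebesgueAffine.
Context {R : realType}.
Notation leb := (@lebesgue_measure R).

Lemma measurable_fun_affine (c s : R) :
  measurable_fun [set: measurableTypeR R] ((fun x => c * x + s) : _ -> measurableTypeR R).
Proof. by apply: measurable_funD => //; apply: measurable_funM. Qed.

(** The scaled image measure gives the interval from a to b the mass b - a, and Lebesgue measure is
    the only measure that does so. *)
Lemma lebesgue_measure_affine (c s : R) (A : set R) : 0 < c -> measurable A ->
  (c%:E * leb ((fun x => c * x + s)%R @^-1` A) = leb A)%E.
Proof.
move=> c0 mA.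
have mf := measurable_fun_affine c s.
pose m1 : {measure set (measurableTypeR R) -> \bar R} :=
  pushforward_measure leb mf.
have c0' : (0 <= c)%R by exact: ltW.
pose m := mscale (NngNum c0') m1.
rewrite (_ : (c%:E * _)%E = m A) //.
apply/esym/lebesgue_measure_unique => //= _ [[a b]] _ <-.
rewrite /m /mscale /=  /pushforward /=.
have -> : (fun x : R => c * x + s) @^-1` `]a, b]%classic
   = `](a - s) / c, (b - s) / c]%classic.
  by apply/seteqP; split => x /=; rewrite !in_itv /=;
   rewrite ltr_pdivrMr// ler_pdivlMr// ltrBlDr lerBrDr mulrC.
rewrite !lebesgue_measure_itv /= !lte_fin ltr_pM2r ?invr_gt0// ltrD2r.
case: ifP => _; last by rewrite mule0.
rewrite -EFinM; congr EFin; field; lra.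
Qed.

Lemma ge0_integral_affine (c s : R) (f : R -> \bar R) : 0 < c ->
  measurable_fun setT f -> (forall x, 0 <= f x)%E ->
  (\int[leb]_x (c%:E * f (c * x + s)%R) = \int[leb]_x f x)%E.
Proof.
move=> c0 mf f0.
have mc := measurable_fun_affine c s.
pose m1 : {measure set (measurableTypeR R) -> \bar R} :=
  pushforward_measure leb mc.
have c0' : (0 <= c)%R by exact: ltW.
pose m : {measure set (measurableTypeR R) -> \bar R} := mscale (NngNum c0') m1.
have -> : (\int[leb]_x f x = \int[m]_x f x)%E.
  apply: eq_measure_integral => A mA _.
  exact/esym/lebesgue_measure_affine.
rewrite ge0_integral_mscale //=.
rewrite (ge0_integral_pushforward mc)//=.
rewrite ge0_integralZl //=.
exact: measurableT_comp.
Qed.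

Lemma ge0_integral_translation (s : R) (f : R -> \bar R) :
  measurable_fun setT f -> (forall x, 0 <= f x)%E ->
  (\int[leb]_x f (x + s)%R = \int[leb]_x f x)%E.
Proof.
move=> mf f0; rewrite -(ge0_integral_affine s ltr01 mf f0).
by apply: eq_integral => x _; rewrite mul1e mul1r.
Qed.

End LebesgueAffine.

Section NormalDensity.
Context {R : realType}.
Notation leb := (@lebesgue_measure R).
Notation phi := (@normal_pdf R 0 1).

Lemma normal_pdf01E x : phi x = (Num.sqrt (pi *+ 2))^-1 * expR (- x ^+ 2 / 2).
Proof.
rewrite normal_pdfE ?oner_eq0//= /normal_peak /normal_fun subr0 expr1n mul1r.
by [].
Qed.

Lemma normal_pdf_shift s x : phi (x - s) = expR (s * x - s ^+ 2 / 2) * phi x.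
Proof.
by rewrite !normal_pdf01E mulrCA -expRD; congr (_ * expR _); field.
Qed.

Lemma normal_pdf_scale (s x : R) : 0 < s ->
  s^-1 * phi (x / s) = s^-1 * expR (- (s ^- 2 - 1) * x ^+ 2 / 2) * phi x.
Proof.
move=> s0; rewrite !normal_pdf01E -(mulrA s^-1 (expR _)); congr (_ * _).
by rewrite mulrCA -expRD; congr (_ * expR _); field; lra.
Qed.

Lemma normal_pdfN x : phi (- x) = phi x.
Proof. by rewrite !normal_pdf01E sqrrN. Qed.

Lemma measurable_phiE : measurable_fun setT (fun x => (phi x)%:E).
Proof. by apply/measurable_EFinP; exact: measurable_normal_pdf. Qed.

Lemma normal_probE (A : set R) : measurable A ->
  normal_prob 0 1 A = (\int[leb]_x (\1_A x * phi x)%:E)%E.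
Proof.
move=> mA; rewrite /normal_prob integral_mkcond; apply: eq_integral => x _.
rewrite patchE indicE; case: (x \in A); by rewrite ?mul1r ?mul0r.
Qed.

End NormalDensity.

(** * Integration against densities *)

Section Density.
Context {R : realType} d d' (S : measurableType d) (T : measurableType d').
Variables (mu : {measure set S -> \bar R}) (m : {measure set T -> \bar R}).
Variables (g : S -> T) (rho : S -> R).
Hypotheses (mg : measurable_fun setT g) (mrho : measurable_fun setT rho).
Hypothesis rho0 : forall x, 0 <= rho x.
Hypothesis mE : forall A, measurable A ->
  (m A = \int[mu]_x (\1_A (g x) * rho x)%:E)%E.

Import HBNNSimple.

(** From indicators to nonnegative functions by simple approximation and monotone convergence.
    Having both a map [g] and a weight [rho] covers plain densities ([g = id]) as well as weighted
    marginals. *)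
Lemma ge0_integral_density (F : T -> \bar R) :
  measurable_fun setT F -> (forall x, 0 <= F x)%E ->
  (\int[m]_x F x = \int[mu]_x (F (g x) * (rho x)%:E))%E.
Proof.
move=> mF F0.
pose f_ := nnsfun_approx measurableT mF.
have mfg n : measurable_fun setT (fun x => f_ n (g x)).
  by apply: (@measurableT_comp _ _ _ _ _ _ (f_ n) _ g).
transitivity (limn (fun n => \int[m]_x (f_ n x)%:E)%E).
  rewrite -monotone_convergence//.
  - apply: eq_integral => y _; apply/esym/cvg_lim => //.
    exact: cvg_nnsfun_approx.
  - by move=> n; exact/measurable_EFinP.
  - by move=> n y _; rewrite lee_fin.
  - by move=> y _ a b ab; rewrite lee_fin; exact/lefP/nd_nnsfun_approx.
rewrite [X in limn X](_ : _ = (fun n => \int[mu]_x (f_ n (g x) * rho x)%:E)%E).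
  rewrite -monotone_convergence//; last 3 first.
  - by move=> n; apply/measurable_EFinP/measurable_funM.
  - by move=> n y _; rewrite lee_fin mulr_ge0.
  - move=> y _ a b ab; rewrite lee_fin ler_wpM2r//.
    exact/lefP/nd_nnsfun_approx.
  apply: eq_integral => y _; apply/cvg_lim => //.
  under eq_fun do rewrite EFinM.
  apply: cvgeZr => //.
  exact: cvg_nnsfun_approx.
apply/funext => n.
have mi r : measurable_fun setT (fun x => (\1_(f_ n @^-1` [set r]) : T -> R) (g x)).
  apply: (@measurableT_comp _ _ _ _ _ _ (\1_(f_ n @^-1` [set r]) : T -> R) _ g) => //.
transitivity (\sum_(k \in range (f_ n))
    \int[mu]_x (k * \1_(f_ n @^-1` [set k]) (g x) * rho x)%:E)%E.
  under eq_integral do rewrite fimfunE -fsumEFin//.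
  rewrite ge0_integral_fsum//; last 2 first.
  - by move=> r; apply/measurable_EFinP/measurable_funM.
  - by move=> r x _; rewrite nnfun_muleindic_ge0.
  apply: eq_fsbigr => r _; rewrite integralZl_indic_nnsfun// integral_indic//=.
  rewrite setIT mE//.
  (* The approximants are nonnegative, so a level [r < 0] has empty preimage and both sides
     vanish. *)
  have [r0|r0] := leP 0 r.
    rewrite -ge0_integralZl_EFin//.
    - by apply: eq_integral => x _; rewrite -EFinM mulrA.
    - by move=> x _; rewrite lee_fin mulr_ge0.
    - exact/measurable_EFinP/measurable_funM.
  rewrite preimage_nnfun0// indic0.
  rewrite [X in (_ * X)%E]integral0_eq => [|x _]; last by rewrite /= mul0r.
  by rewrite mule0 integral0_eq// => x _; rewrite /= mulr0 mul0r.
rewrite -ge0_integral_fsum//.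
- apply: eq_integral => x _; rewrite fsumEFin//.
  congr EFin; rewrite mulrC [in RHS]fimfunE mulr_fsumr.
  by apply: eq_fsbigr => r _; rewrite mulrC.
- move=> r; apply/measurable_EFinP/measurable_funM => //; exact: measurable_funM.
- move=> r x _; rewrite lee_fin mulr_ge0//.
  by have := nnfun_muleindic_ge0 (f_ n) r (g x); rewrite lee_fin.
Qed.

End Density.

Section DensityMeasure.
Context {R : realType} d (S : measurableType d).
Variables (mu : {measure set S -> \bar R}) (rho : S -> \bar R).
Hypotheses (mrho : measurable_fun setT rho) (rho0 : forall x, (0 <= rho x)%E).

Let nu A := (\int[mu]_(x in A) rho x)%E.

Let nu0 : nu set0 = 0%E. Proof. exact: integral_set0. Qed.

Let nu_ge0 A : (0 <= nu A)%E. Proof. exact: integral_ge0. Qed.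

Let nu_sigma_additive : semi_sigma_additive nu.
Proof.
move=> F mF tF mUF; rewrite /nu ge0_integral_bigcup//; last first.
  exact: measurable_funTS.
by apply: is_cvg_ereal_nneg_natsum_cond => k _ _; exact: integral_ge0.
Qed.

(** Packaged as a measure so that uniqueness on boxes can compare it with an image measure. *)
Definition density_measure : {measure set S -> \bar R} :=
  HB.pack_for {measure set S -> \bar R} nu
    (isMeasure.Build _ _ _ nu nu0 nu_ge0 nu_sigma_additive).

End DensityMeasure.

Lemma ge0_integral_indicM d (S : measurableType d) (R : realType)
    (mu : {measure set S -> \bar R}) (rho : S -> R) (A : set S) :
  measurable A ->
  (\int[mu]_(x in A) (rho x)%:E = \int[mu]_x (\1_A x * rho x)%:E)%E.
Proof.
move=> mA; rewrite integral_mkcond; apply: eq_integral => x _.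
by rewrite patchE indicE; case: (x \in A); rewrite ?mul1r ?mul0r.
Qed.

Lemma measurable_indic_comp d d' (S : measurableType d) (T : measurableType d')
    (R : realType) (A : set T) (f : S -> T) :
  measurable A -> measurable_fun setT f ->
  measurable_fun setT (fun x => \1_A (f x) : R).
Proof.
move=> mA mf; apply: (@measurableT_comp _ _ _ _ _ _ (\1_A : T -> R) _ f) => //.
Qed.

Lemma measurable_fun_natb d (S : measurableType d) (R : realType)
    (b : S -> bool) :
  measurable_fun setT b -> measurable_fun setT (fun x => (b x)%:R : R).
Proof.
move=> mb; rewrite (_ : (fun x => _) = fun x => if b x then 1 else 0 : R).
  exact: measurable_fun_ifT.
by apply/funext => x; case: (b x).
Qed.

Lemma measurable_set_bool d (S : measurableType d) (b : S -> bool) :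
  measurable_fun setT b -> measurable [set x | b x].
Proof.
move=> mb; rewrite -[X in measurable X]setTI.
exact: (mb measurableT [set true]).
Qed.

Lemma measure_set_bool d (S : measurableType d) (R : realType)
    (mu : {measure set S -> \bar R}) (b : S -> bool) :
  measurable_fun setT b -> (mu [set x | b x] = \int[mu]_x ((b x)%:R)%:E)%E.
Proof.
move=> mb; rewrite -[X in mu X]setIT -integral_indic//; last first.
  exact: measurable_set_bool.
apply: eq_integral => x _; congr EFin; rewrite indicE; congr (nat_of_bool _)%:R.
by apply/idP/idP; rewrite inE.
Qed.

Lemma ge0_integral_normal_prob (R : realType) (f : R -> \bar R) :
  measurable_fun setT f -> (forall x, 0 <= f x)%E ->
  (\int[normal_prob 0 1]_x f x =
   \int[lebesgue_measure]_x (f x * (normal_pdf 0 1 x)%:E))%E.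
Proof.
move=> mf f0; apply: (@ge0_integral_density R _ _ _ _
  (@lebesgue_measure R) (normal_prob 0 1) id) => //.
- exact: measurable_normal_pdf.
- exact: normal_pdf_ge0.
- by move=> A mA; exact: normal_probE.
Qed.

Definition box {R : realType} {n} (A : 'I_n -> set R) : set 'cV[R]_n :=
  [set x | forall i, A i (x i 0)].

Definition boxes (R : realType) n : set (set 'cV[R]_n) :=
  [set box A | A in [set A : 'I_n -> set R | forall i, measurable (A i)]].

(** The sigma-algebra is generated by exactly the sets whose probabilities the linear model
    prescribes. *)
Notation rvec R n := (g_sigma_algebraType (@boxes R n)).

Definition std_gauss (R : realType) n (mu : {measure set (rvec R n) -> \bar R}) :=
  forall A : 'I_n -> set R, (forall i, measurable (A i)) ->
    mu (box A) = (\prod_(i < n) normal_prob 0 1 (A i))%E.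

Section RandomVectors.
Context {R : realType} {n : nat}.

Lemma setI_closed_boxes : setI_closed (@boxes R n).
Proof.
move=> _ _ [A mA <-] [B mB <-]; exists (fun i => A i `&` B i).
  by move=> i; apply: measurableI; [exact: mA|exact: mB].
apply/seteqP; split => x /=; rewrite /box /=.
  by move=> AB; split=> i; have [] := AB i.
by move=> [Ax Bx] i; split; [exact: Ax|exact: Bx].
Qed.

Lemma measurable_box (A : 'I_n -> set R) : (forall i, measurable (A i)) ->
  measurable (box A : set (rvec R n)).
Proof. by move=> mA; apply: sub_sigma_algebra; exists A. Qed.

Lemma measurable_coord i : measurable_fun [set: rvec R n] (fun x => x i 0).
Proof.
move=> _ A mA; rewrite setTI.
rewrite [X in measurable X](_ : _ = box (fun j => if j == i then A else setT)).
  by apply: measurable_box => j; case: ifP.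
apply/seteqP; split => x /= Ax.
  by move=> j; case: eqP => // ->.
by have := Ax i; rewrite eqxx.
Qed.

Lemma measurable_fun_rvec d (S : measurableType d) (f : S -> rvec R n) :
  (forall i, measurable_fun setT (fun x => f x i 0)) -> measurable_fun setT f.
Proof.
move=> mf; apply: (@measurability _ _ S (rvec R n) setT f (@boxes R n) erefl).
move=> _ [_ [A mA <-] <-].
rewrite setTI [X in measurable X](_ : _ =
    \bigcap_(i in [set: 'I_n]) ((fun x => f x i 0) @^-1` A i)); last first.
  by apply/seteqP; split => x /= Ax i; [move=> _; exact: Ax|exact: (Ax i Logic.I)].
apply: fin_bigcap_measurable => //.
by move=> i _; rewrite -[X in measurable X]setTI; exact: mf.
Qed.

(** Boxes are stable under intersection and include the whole space, which has finite mass, so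
    Dynkin's argument applies. *)
Lemma rvec_measure_unique (m1 m2 : {measure set (rvec R n) -> \bar R}) :
  (forall A, (forall i, measurable (A i)) -> m1 (box A) = m2 (box A)) ->
  (m1 setT < +oo)%E -> forall A, measurable A -> m1 A = m2 A.
Proof.
move=> m12 m1oo A mA.
have bT : boxes (setT : set 'cV[R]_n).
  by exists (fun=> setT) => //; apply/seteqP; split.
apply: (@measure_unique _ R (rvec R n) (@boxes R n) (fun=> setT)) => //.
- exact: setI_closed_boxes.
- by rewrite bigcup_const//; exists 0%N.
- by move=> _ [B mB <-]; exact: m12.
Qed.

End RandomVectors.

Lemma dotvE (R : realType) n (a b : 'cV[R]_n) :
  dotv a b = \sum_i a i 0 * b i 0.
Proof. by rewrite /dotv mxE; apply: eq_bigr => i _; rewrite mxE. Qed.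

(** * Coordinatewise change of variables *)

Section GaussianChangeOfVariables.
Context {R : realType} {n : nat}.
Variable mu : probability (rvec R n) R.
Hypothesis gmu : std_gauss mu.
Variables (tau : 'I_n -> R -> R) (r : 'I_n -> R -> R).
Hypotheses (mtau : forall i, measurable_fun setT (tau i))
  (mr : forall i, measurable_fun setT (r i)) (r0 : forall i x, 0 <= r i x).
Hypothesis taur : forall i (A : set R), measurable A ->
  (normal_prob 0 1 (tau i @^-1` A) =
   \int[normal_prob 0 1]_x (\1_A x * r i x)%:E)%E.

Definition update_coord (i : 'I_n) (x : rvec R n) : rvec R n :=
  \col_j if j == i then tau j (x j 0) else x j 0.

Lemma measurable_update_coord i : measurable_fun setT (update_coord i).
Proof.
apply: measurable_fun_rvec => j.
under eq_fun do rewrite mxE.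
case: (j == i); last exact: measurable_coord.
exact: (measurableT_comp (mtau j) (measurable_coord j)).
Qed.

(** With the other sides of the box frozen, [mu] is a constant [c] times N(0,1) in the [i]-th side,
    so the one-dimensional hypothesis [taur] decides. *)
Lemma std_gauss_update_box i A : (forall j, measurable (A j)) ->
  (mu (update_coord i @^-1` box A) =
   \int[mu]_x (\1_(box A) x * r i (x i 0))%:E)%E.
Proof.
move=> mA.
pose A0 j := if j == i then setT else A j.
have mA0 j : measurable (A0 j) by rewrite /A0; case: ifP.
pose c := (\prod_(j < n | j != i) normal_prob 0 1 (A j))%E.
have cE : (\prod_(j < n | j != i) normal_prob 0 1 (A j) = c)%E by [].
have c_fin : c \is a fin_num.
  apply: prode_fin_num => j _.
  apply: fin_num_measure; exact: mA.
have c0 : (0 <= fine c)%R.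
  by rewrite fine_ge0// /c prode_ge0// => j _; exact: measure_ge0.
have muE B : measurable B ->
    (mu (box (fun j => if j == i then B else A j)) = c * normal_prob 0 1 B)%E.
  move=> mB; rewrite gmu => [|j]; last by case: ifP.
  rewrite (bigD1 i)//= eqxx muleC; congr (_ * _)%E.
  by apply: eq_bigr => j /negbTE ->.
(* [c] times N(0,1) is also the law of coordinate [i] restricted to the slab [box A0]; this lets the
   density lemma carry the one-dimensional integral back to [mu]. *)
pose m : {measure set (measurableTypeR R) -> \bar R} :=
  mscale (NngNum c0) (normal_prob 0 1).
have mE B : measurable B ->
    (m B = \int[mu]_x (\1_B (x i 0) * \1_(box A0) x)%:E)%E.
  move=> mB; transitivity (c * normal_prob 0 1 B)%E.
    by rewrite -[in RHS](fineK c_fin).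
  rewrite -muE//.
  rewrite -[X in mu X]setIT -integral_indic//; last first.
    by apply: measurable_box => j; case: ifP.
  apply: eq_integral => x _; congr EFin; rewrite !indicE -natrM mulnb.
  congr (nat_of_bool _)%:R; apply/idP/andP.
    rewrite inE => Bx; split; rewrite inE.
      by have := Bx i; rewrite eqxx.
    by move=> j; rewrite /A0; have := Bx j; case: ifP.
  rewrite !inE => -[Bx Ax] j; case: eqP => [->//|/eqP ji].
  by have := Ax j; rewrite /A0 (negbTE ji).
have -> : update_coord i @^-1` box A =
    box (fun j => if j == i then tau i @^-1` A i else A j).
  apply/seteqP; split => x /= Ax j.
    by have := Ax j; rewrite mxE; case: eqP => // ->.
  by rewrite mxE; have := Ax j; case: eqP => // ->.
have mti : measurable (tau i @^-1` A i).
  by rewrite -[X in measurable X]setTI; exact: mtau.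
rewrite muE// taur//.
have mrA : measurable_fun setT (fun x => (\1_(A i) x * r i x)%:E).
  by apply/measurable_EFinP/measurable_funM => //; exact: measurable_indic.
have rA0 x : (0 <= (\1_(A i) x * r i x)%:E)%E by rewrite lee_fin mulr_ge0.
rewrite -{1}(fineK c_fin) -(ge0_integral_mscale _ measurableT (NngNum c0))//.
rewrite (@ge0_integral_density R _ _ (rvec R n) _ mu m (fun x => x i 0)
  (\1_(box A0))) //.
- apply: eq_integral => x _; rewrite -EFinM; congr EFin.
  rewrite !indicE mulrAC -natrM mulnb; congr (_%:R * _).
  congr nat_of_bool; apply/andP/idP; rewrite !inE.
    move=> [Ax A0x] j; have := A0x j; rewrite /A0; case: eqP => // ->.
    by [].
  by move=> Ax; split => // j; rewrite /A0; case: ifP.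
- exact: measurable_coord.
- by apply: measurable_indic; exact: measurable_box.
Qed.

Lemma integral_update_coord i (F : rvec R n -> \bar R) :
  measurable_fun setT F -> (forall x, 0 <= F x)%E ->
  (\int[mu]_x F (update_coord i x) = \int[mu]_x (F x * (r i (x i 0))%:E))%E.
Proof.
move=> mF F0.
have mri : measurable_fun [set: rvec R n] (fun x => r i (x i 0)).
  exact: (measurableT_comp (mr i) (measurable_coord i)).
have mu_ := measurable_update_coord i.
pose m := pushforward_measure mu mu_.
have mri' : measurable_fun [set: rvec R n] (fun x => (r i (x i 0))%:E).
  exact/measurable_EFinP.
have ri0 x : (0 <= (r i ((x : rvec R n) i 0))%:E)%E by rewrite lee_fin.
pose m2 := density_measure mu mri' ri0.
have mE A : measurable A -> (m A = \int[mu]_x (\1_A x * r i (x i 0))%:E)%E.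
  move=> mA; rewrite -ge0_integral_indicM//.
  apply: (rvec_measure_unique (m1 := m) (m2 := m2)) => //.
    move=> B mB; rewrite [RHS]ge0_integral_indicM; last exact: measurable_box.
    exact: std_gauss_update_box.
  by rewrite /m /pushforward_measure /= /pushforward preimage_setT probability_setT ltry.
rewrite -(@ge0_integral_density R _ _ (rvec R n) _ mu m id)//.
by rewrite /m ge0_integral_pushforward.
Qed.

(** Coordinates are changed one at a time. The list must be duplicate-free so that updating [i]
    leaves the density factors already collected untouched. *)
Lemma integral_map_coord (F : rvec R n -> \bar R) :
  measurable_fun setT F -> (forall x, 0 <= F x)%E ->
  (\int[mu]_x F (\col_j tau j (x j 0))%R =
   \int[mu]_x (F x * (\prod_j r j (x j 0))%R%:E))%E.
Proof.
pose upd (s : seq 'I_n) (x : rvec R n) : rvec R n :=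
  \col_j if j \in s then tau j (x j 0) else x j 0.
have mprod (s : seq 'I_n) : measurable_fun [set: rvec R n]
    (fun x => (\prod_(j <- s) r j (x j 0))%:E).
  apply/measurable_EFinP; elim: s => [|i s IH].
    by under eq_fun do rewrite big_nil; exact: measurable_cst.
  under eq_fun do rewrite big_cons; apply: measurable_funM => //.
  exact: (measurableT_comp (mr i) (measurable_coord i)).
suff H s : uniq s -> forall F : rvec R n -> \bar R,
    measurable_fun setT F -> (forall x, 0 <= F x)%E ->
    (\int[mu]_x F (upd s x) =
     \int[mu]_x (F x * (\prod_(j <- s) r j (x j 0))%:E))%E.
  move=> mF F0; have := H _ (index_enum_uniq _) F mF F0.
  move=> <-; apply: eq_integral => x _; congr F.
  by apply/matrixP => j k; rewrite !mxE mem_index_enum.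
elim: s {F} => [_ F mF F0|i s IH /= /andP[si us] F mF F0].
  apply: eq_integral => x _; rewrite big_nil mule1; congr F.
  by apply/matrixP => j k; rewrite !mxE ord1.
have mFu : measurable_fun setT (F \o update_coord i).
  exact: (measurableT_comp mF (measurable_update_coord i)).
transitivity (\int[mu]_x (F \o update_coord i) (upd s x))%E.
  apply: eq_integral => x _ /=; congr F.
  apply/matrixP => j k; rewrite !mxE in_cons.
  by case: eqP => // ->; rewrite (negbTE si).
rewrite IH//; last by move=> x /=.
have sE x : \prod_(j <- s) r j ((update_coord i x) j 0) =
            \prod_(j <- s) r j (x j 0).
  apply: eq_big_seq => j js; rewrite mxE; case: eqP => // ji.
  by rewrite -ji js in si.
pose G (y : rvec R n) := (F y * (\prod_(j <- s) r j (y j 0))%R%:E)%E.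
transitivity (\int[mu]_x G (update_coord i x))%E.
  by apply: eq_integral => x _; rewrite /G /= sE.
rewrite (@integral_update_coord i G).
- apply: eq_integral => x _; rewrite /G big_cons -muleA -EFinM.
  by rewrite [X in (_ * X%:E)%E]mulrC.
- exact: emeasurable_funM.
- by move=> x; rewrite mule_ge0// lee_fin prodr_ge0.
Qed.

End GaussianChangeOfVariables.

Section GaussianShiftScale.
Context {R : realType} {n : nat}.
Variable mu : probability (rvec R n) R.
Hypothesis gmu : std_gauss mu.
Notation leb := (@lebesgue_measure R).
Notation phi := (@normal_pdf R 0 1).

Lemma measurable_indicM (A : set R) (g : R -> R) : measurable A ->
  measurable_fun setT g -> measurable_fun setT (fun x => (\1_A x * g x)%:E).
Proof.
by move=> mA mg; apply/measurable_EFinP/measurable_funM => //; exact: measurable_indic.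
Qed.

Lemma normal_prob_shift (s : R) (A : set R) : measurable A ->
  (normal_prob 0 1 ((fun x => x + s)%R @^-1` A) =
   \int[normal_prob 0 1]_x (\1_A x * expR (s * x - s ^+ 2 / 2))%:E)%E.
Proof.
move=> mA.
have mexp : measurable_fun [set: R] (fun x => expR (s * x - s ^+ 2 / 2)).
  apply: measurableT_comp => //; apply: measurable_funB => //; exact: measurable_funM.
rewrite ge0_integral_normal_prob; last 2 first.
- exact: (measurable_indicM mA mexp).
- by move=> x; rewrite lee_fin mulr_ge0// expR_ge0.
rewrite normal_probE; last first.
  by rewrite -[X in measurable X]setTI; exact: measurable_funD.
pose f x := (\1_A x * phi (x - s))%:E.
transitivity (\int[leb]_x f x)%E; last first.
  apply: eq_integral => x _; rewrite /f normal_pdf_shift -EFinM.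
  by rewrite mulrA.
rewrite -[RHS](ge0_integral_translation s).
- by apply: eq_integral => x _; rewrite /f addrK.
- apply: measurable_indicM => //.
  apply: measurableT_comp => //; first exact: measurable_normal_pdf; exact: measurable_funB.
- by move=> x; rewrite lee_fin mulr_ge0// normal_pdf_ge0.
Qed.

Lemma normal_prob_scale (s : R) (A : set R) : 0 < s -> measurable A ->
  (normal_prob 0 1 ((fun x => s * x)%R @^-1` A) =
   \int[normal_prob 0 1]_x
     (\1_A x * (s^-1 * expR (- (s ^- 2 - 1) * x ^+ 2 / 2)))%:E)%E.
Proof.
move=> s0 mA.
have mexp : measurable_fun [set: R]
    (fun x => s^-1 * expR (- (s ^- 2 - 1) * x ^+ 2 / 2)).
  apply: measurable_funM => //; apply: measurableT_comp => //.
  by apply: measurable_funM => //; apply: measurable_funM.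
rewrite ge0_integral_normal_prob; last 2 first.
- exact: (measurable_indicM mA mexp).
- by move=> x; rewrite lee_fin !mulr_ge0// ?expR_ge0// invr_ge0 ltW.
rewrite normal_probE; last first.
  by rewrite -[X in measurable X]setTI; exact: measurable_funM.
pose f x := (\1_A x * (s^-1 * phi (x / s)))%:E.
transitivity (\int[leb]_x f x)%E; last first.
  apply: eq_integral => x _; rewrite /f normal_pdf_scale// -EFinM.
  by rewrite mulrA.
rewrite -[RHS](ge0_integral_affine 0 s0).
- apply: eq_integral => x _; rewrite /f addr0 -EFinM; congr EFin.
  rewrite [RHS]mulrCA; congr (_ * _); rewrite mulrA divff ?gt_eqF// mul1r.
  by congr (phi _); rewrite mulrAC divff ?gt_eqF// mul1r.
- apply: measurable_indicM => //; apply: measurable_funM => //.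
  apply: measurableT_comp => //; first exact: measurable_normal_pdf; exact: measurable_funM.
- move=> x; rewrite lee_fin !mulr_ge0// ?normal_pdf_ge0// invr_ge0 ltW//.
Qed.

(** The Cameron-Martin formula: one-dimensional likelihood ratios multiply, and their exponents add
    up to dot products. *)
Lemma integral_gauss_shift (h : 'cV[R]_n) (F : rvec R n -> \bar R) :
  measurable_fun setT F -> (forall x, 0 <= F x)%E ->
  (\int[mu]_x F (x + h)%R =
   \int[mu]_x (F x * (expR (dotv h x - dotv h h / 2))%:E))%E.
Proof.
move=> mF F0.
pose tau i (x : R) := x + h i 0.
pose r i (x : R) := expR (h i 0 * x - h i 0 ^+ 2 / 2).
transitivity (\int[mu]_x F (\col_j tau j (x j 0))%R)%E.
  by apply: eq_integral => x _; congr F; apply/matrixP => j k;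
    rewrite !mxE !ord1.
rewrite (@integral_map_coord R n mu gmu tau r) //.
- apply: eq_integral => x _; congr (_ * _%:E)%E.
  rewrite /r -expR_sum; congr expR; rewrite big_split/=; congr (_ + _).
    by rewrite dotvE.
  by rewrite sumrN dotvE mulr_suml; congr (- _); apply: eq_bigr.
- by move=> i; exact: measurable_funD.
- move=> i; apply: measurableT_comp => //; apply: measurable_funB => //; exact: measurable_funM.
- by move=> i x; exact: expR_ge0.
- by move=> i A mA; exact: normal_prob_shift.
Qed.

Lemma integral_gauss_scale (s : R) (F : rvec R n -> \bar R) : 0 < s ->
  measurable_fun setT F -> (forall x, 0 <= F x)%E ->
  (\int[mu]_x F (s *: x)%R =
   \int[mu]_x (F x *
     (s ^- n * expR (- (s ^- 2 - 1) * dotv x x / 2))%:E))%E.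
Proof.
move=> s0 mF F0.
pose tau (i : 'I_n) (x : R) := s * x.
pose r (i : 'I_n) (x : R) := s^-1 * expR (- (s ^- 2 - 1) * x ^+ 2 / 2).
transitivity (\int[mu]_x F (\col_j tau j (x j 0))%R)%E.
  by apply: eq_integral => x _; congr F; apply/matrixP => j k;
    rewrite !mxE !ord1.
rewrite (@integral_map_coord R n mu gmu tau r) //.
- apply: eq_integral => x _; congr (_ * _%:E)%E.
  rewrite /r big_split/= prodr_const card_ord exprVn -expR_sum; congr (_ * expR _).
  by rewrite dotvE mulr_sumr mulr_suml; apply: eq_bigr.
- by move=> i; exact: measurable_funM.
- move=> i; apply: measurable_funM => //; apply: measurableT_comp => //.
  by apply: measurable_funM => //; apply: measurable_funM.
- by move=> i x; rewrite mulr_ge0// ?expR_ge0// invr_ge0 ltW.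
- by move=> i A mA; exact: normal_prob_scale.
Qed.

Lemma dotvDr (a b c : 'cV[R]_n) : dotv a (b + c) = dotv a b + dotv a c.
Proof. by rewrite /dotv mulmxDr mxE. Qed.

Lemma dotvZr k (a b : 'cV[R]_n) : dotv a (k *: b) = k * dotv a b.
Proof. by rewrite /dotv -scalemxAr mxE. Qed.

Lemma dotvC (a b : 'cV[R]_n) : dotv a b = dotv b a.
Proof. by rewrite !dotvE; apply: eq_bigr => i _; rewrite mulrC. Qed.

Lemma dotvZl k (a b : 'cV[R]_n) : dotv (k *: a) b = k * dotv a b.
Proof. by rewrite dotvC dotvZr dotvC. Qed.

Lemma measurable_dotv (u : 'cV[R]_n) :
  measurable_fun [set: rvec R n] (fun x => dotv u x).
Proof.
under eq_fun do rewrite dotvE.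
apply: measurable_sum => i; apply: measurable_funM => //.
exact: measurable_coord.
Qed.

Lemma integral_normal_shift (t : R) :
  (\int[leb]_s (phi (t - s))%:E = 1)%E.
Proof.
have mphi := @measurable_phiE R.
transitivity (\int[leb]_s (phi (s + - t))%:E)%E.
  by apply: eq_integral => s _; rewrite -normal_pdfN opprB.
rewrite (ge0_integral_translation (- t) mphi) ?integral_normal_pdf//.
by move=> x; rewrite lee_fin normal_pdf_ge0.
Qed.

(* Integrate the shift formula over all shifts along [u]: the shift-invariant
   argument of [Phi] is untouched while the coordinate along [u] sweeps R. *)
Lemma integral_gauss_split (u : 'cV[R]_n) (Phi : R * rvec R n -> \bar R) :
  dotv u u = 1 -> measurable_fun setT Phi -> (forall zx, 0 <= Phi zx)%E ->
  (forall z (x : rvec R n) s, Phi (z, x + s *: u) = Phi (z, x)) ->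
  (\int[mu]_x Phi (dotv u x, x) =
   \int[mu]_x \int[leb]_z (Phi (z, x) * (phi z)%:E))%E.
Proof.
move=> u1 mPhi Phi0 Phiu.
have mphi : measurable_fun setT phi by exact: measurable_normal_pdf.
have md := measurable_dotv u.
have mPd : measurable_fun [set: rvec R n] (fun x => Phi (dotv u x, x)).
  apply: (measurableT_comp mPhi); exact: measurable_fun_pair.
pose Xi (x : rvec R n) := (Phi (dotv u x, x) * (phi (dotv u x))%:E)%E.
have mXi : measurable_fun setT Xi.
  apply: emeasurable_funM => //; apply/measurable_EFinP.
  exact: (measurableT_comp mphi).
have Xi0 x : (0 <= Xi x)%E by rewrite mule_ge0// lee_fin normal_pdf_ge0.
(* Insert the factor 1, written as the integral of [phi (dotv u x - s)] over all [s]. *)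
transitivity (\int[mu]_x \int[leb]_s
    (Phi (dotv u x, x) * (phi (dotv u x - s))%:E))%E.
  apply: eq_integral => x _; rewrite ge0_integralZl//=.
  - by rewrite integral_normal_shift mule1.
  - apply/measurable_EFinP/(measurableT_comp mphi); exact: measurable_funB.
  - by move=> s _; rewrite lee_fin normal_pdf_ge0.
pose H (xs : rvec R n * R) :=
  (Phi (dotv u xs.1, xs.1) * (phi (dotv u xs.1 - xs.2))%:E)%E.
have mH : measurable_fun setT H.
  apply: emeasurable_funM; first exact: (measurableT_comp mPd).
  apply/measurable_EFinP/(measurableT_comp mphi)/measurable_funB => //.
  exact: (measurableT_comp md).
have H0 xs : (0 <= H xs)%E by rewrite mule_ge0// lee_fin normal_pdf_ge0.
transitivity (\int[leb]_s \int[mu]_x H (x, s))%E.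
  exact: (fubini_tonelli (m1 := mu) (m2 := leb) H mH H0).
(* For fixed [s], the ratio of [phi (dotv u x - s)] to [phi (dotv u x)] is the Cameron-Martin
   density of the shift [s *: u], so it can be traded for that shift. *)
transitivity (\int[leb]_s \int[mu]_x
    (Phi ((dotv u x + s)%R, x) * (phi (dotv u x + s))%:E))%E.
  apply: eq_integral => s _.
  transitivity (\int[mu]_x Xi (x + s *: u)%R)%E; last first.
    by apply: eq_integral => x _; rewrite /Xi dotvDr dotvZr u1 mulr1 Phiu.
  rewrite (integral_gauss_shift _ mXi Xi0); apply: eq_integral => x _.
  rewrite /H/= /Xi -muleA -EFinM normal_pdf_shift.
  rewrite [X in _ = (_ * X%:E)%E]mulrC.
  congr (_ * (expR _ * _)%:E)%E.
  by rewrite !dotvZl dotvZr u1 mulr1 expr2.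
pose G (xs : rvec R n * R) :=
  (Phi ((dotv u xs.1 + xs.2)%R, xs.1) * (phi (dotv u xs.1 + xs.2))%:E)%E.
have mG : measurable_fun setT G.
  have mds : measurable_fun [set: rvec R n * R] (fun xs => dotv u xs.1 + xs.2).
    by apply: measurable_funD => //; exact: (measurableT_comp md).
  apply: emeasurable_funM.
    by apply: (measurableT_comp mPhi); exact: measurable_fun_pair.
  exact/measurable_EFinP/(measurableT_comp mphi).
have G0 xs : (0 <= G xs)%E by rewrite mule_ge0// lee_fin normal_pdf_ge0.
rewrite -(fubini_tonelli (m1 := mu) (m2 := leb) G mG G0).
apply: eq_integral => x _; rewrite /G /=.
pose g z := (Phi (z, x) * (phi z)%:E)%E.
(* With [x] fixed, translating [s] by [dotv u x] makes the first argument a free variable. *)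
transitivity (\int[leb]_s g (s + dotv u x)%R)%E.
  by apply: eq_integral => s _; rewrite /g addrC.
rewrite ge0_integral_translation//.
- apply: emeasurable_funM; last exact/measurable_EFinP.
  by apply: (measurableT_comp mPhi); exact: measurable_fun_pair.
- by move=> z; rewrite mule_ge0// lee_fin normal_pdf_ge0.
Qed.

End GaussianShiftScale.

(** * Least squares *)

Section DotProduct.
Context {R : realType}.

Lemma dotv_ge0 n (x : 'cV[R]_n) : 0 <= dotv x x.
Proof. by rewrite dotvE sumr_ge0// => i _; rewrite -expr2 sqr_ge0. Qed.

Lemma dotv_eq0 n (x : 'cV[R]_n) : dotv x x = 0 -> x = 0.
Proof.
rewrite dotvE => /eqP; rewrite psumr_eq0; last first.
  by move=> i _; rewrite -expr2 sqr_ge0.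
move=> /allP H; apply/matrixP => i j; rewrite ord1 mxE.
have := H i (mem_index_enum i); rewrite -expr2 sqrf_eq0.
by move=> /eqP.
Qed.

Lemma dotvDl n (a b c : 'cV[R]_n) : dotv (a + b) c = dotv a c + dotv b c.
Proof. by rewrite dotvC dotvDr !(dotvC c). Qed.

Lemma dotvNr n (a b : 'cV[R]_n) : dotv a (- b) = - dotv a b.
Proof. by rewrite -scaleN1r dotvZr mulN1r. Qed.

Lemma dotvNl n (a b : 'cV[R]_n) : dotv (- a) b = - dotv a b.
Proof. by rewrite dotvC dotvNr dotvC. Qed.

Lemma dotv0r n (a : 'cV[R]_n) : dotv a 0 = 0.
Proof. by rewrite -[0](scale0r 0) dotvZr mul0r. Qed.

Lemma dotv_mulmx n p (A : 'M[R]_(n, p)) b y :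
  dotv (A *m b) y = dotv b (A^T *m y).
Proof. by rewrite /dotv trmx_mul mulmxA. Qed.

Lemma dotv_delta n (j : 'I_n) (b : 'cV[R]_n) : dotv (delta_mx j 0) b = b j 0.
Proof.
rewrite dotvE (bigD1 j)//= big1 ?addr0 => [|i ij].
  by rewrite mxE !eqxx mul1r.
by rewrite mxE (negbTE ij) mul0r.
Qed.

Lemma sqrnormD n (a b : 'cV[R]_n) : dotv a b = 0 ->
  dotv (a + b) (a + b) = dotv a a + dotv b b.
Proof.
by move=> ab; rewrite dotvDl !dotvDr (dotvC b) ab addr0 add0r.
Qed.

End DotProduct.

(** * Orthonormalization of a positive definite form *)

Section PositiveDefinite.
Context {R : realType}.

Lemma unitmx_inj n (A : 'M[R]_n) :
  (forall b : 'cV[R]_n, A *m b = 0 -> b = 0) -> A \in unitmx.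
Proof.
move=> H; rewrite -unitmx_tr -row_free_unit -kermx_eq0.
apply/rowV0P => v /sub_kermxP vA0.
have : A *m v^T = 0 by rewrite -[A]trmxK -trmx_mul vA0 trmx0.
by move=> /H /(congr1 trmx); rewrite trmxK trmx0.
Qed.

(* The Gram matrix of [X] plays the role of [G]: the rows of [L *m X^T] are
   then an orthonormal basis of the column space of [X]. *)
Lemma posdef_orthonormalize k (G : 'M[R]_k) : G^T = G ->
  (forall v : 'cV[R]_k, v != 0 -> 0 < dotv v (G *m v)) ->
  exists L : 'M[R]_k, L *m G *m L^T = 1%:M.
Proof.
elim: k G => [|k IH] G symG posG; first by exists 0; apply/matrixP => -[].
rewrite -[k.+1]/(1 + k)%N in G symG posG *.
pose g := G 0 0; pose r := ursubmx G; pose G' := drsubmx G.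
have Gb : G = block_mx g%:M r r^T G'.
  rewrite -[LHS]submxK; congr block_mx.
    by apply/matrixP => i j; rewrite !ord1 !mxE eqxx mulr1n; congr (G _ _);
      apply/val_inj.
  by rewrite -[in LHS]symG /r trmx_ursub.
have g0 : 0 < g.
  have := posG (delta_mx 0 0).
  rewrite dotv_delta -colE mxE; apply.
  apply/eqP => /matrixP /(_ 0 0); rewrite !mxE !eqxx => /eqP.
  by rewrite oner_eq0.
have symG' : G'^T = G' by rewrite /G' trmx_drsub symG.
(* The Schur complement of the corner entry [g], to which the induction hypothesis applies. *)
pose S := G' - g^-1 *: (r^T *m r).
have symS : S^T = S.
  by rewrite /S linearB/= linearZ/= trmx_mul trmxK symG'.
have posS v : v != 0 -> 0 < dotv v (S *m v).
  (* This [c] minimizes the quadratic form over its first coordinate; the minimum is the form of [S]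
     at [v]. *)
  move=> v0; pose c : 'cV[R]_1 := - g^-1 *: (r *m v).
  have := posG (col_mx c v); rewrite Gb mul_block_col.
  rewrite /dotv tr_col_mx mul_row_col => H.
  have {H} := H _.
  have -> : g%:M *m c + r *m v = 0.
    rewrite mul_scalar_mx /c scalerA mulrN divff ?gt_eqF//.
    by rewrite scaleN1r addNr.
  rewrite mulmx0 add0r.
  have -> : r^T *m c + G' *m v = S *m v.
    rewrite /S mulmxBl -scalemxAl /c -scalemxAr scaleNr addrC.
    by rewrite mulmxA.
  apply; apply: contra_neq v0 => /(congr1 dsubmx).
  by rewrite col_mxKd => ->; rewrite linear0.
have [M MS] := IH S symS posS.
(* One step of Gaussian elimination followed by [M] on the complement; the lower left block cancels
   the off-diagonal part of [G]. *)
exists (block_mx (Num.sqrt g)^-1%:M 0 (- g^-1 *: (M *m r^T)) M).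
have sg : Num.sqrt g != 0 by rewrite gt_eqF// sqrtr_gt0.
rewrite [X in _ *m X *m _]Gb tr_block_mx !mulmx_block.
rewrite !mul0mx !addr0 !trmx0 !tr_scalar_mx !mulmx0 !addr0.
rewrite (_ : (1%:M : 'M[R]_(1 + k)) = block_mx 1%:M 0 0 1%:M); last first.
  by rewrite -scalar_mx_block.
congr block_mx.
- rewrite -!scalar_mxM; congr (_%:M).
  by rewrite -{2}(sqr_sqrtr (ltW g0)) expr2; field.
- rewrite linearZ/= trmx_mul trmxK -scalar_mxM -mulmxA !mul_scalar_mx.
  rewrite scalerA -scalerDl mulrN mulfK ?gt_eqF// addNr scale0r//.
- by rewrite !mul_mx_scalar scalerA mulrN divff ?gt_eqF// scaleN1r addNr scaler0.
- rewrite mul_mx_scalar !scalerA mulrN divff ?gt_eqF// scaleN1r addNr mul0mx.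
  rewrite add0r -MS /S; congr (_ *m _).
  by rewrite mulmxBr -scalemxAr -scalemxAl mulmxA scaleNr addrC.
Qed.

End PositiveDefinite.

Section LeastSquares.
Context {R : realType} {n p : nat}.
Variable X : 'M[R]_(n, p).
Hypothesis rX : row_free X^T.

Lemma design_inj (b : 'cV[R]_p) : X *m b = 0 -> b = 0.
Proof.
move=> /(congr1 trmx); rewrite trmx_mul trmx0 => bX.
by apply: (can_inj (@trmxK _ _ _)); apply: (row_free_inj rX); rewrite bX trmx0 mul0mx.
Qed.

Definition gram_inv := invmx (X^T *m X).

Lemma gram_unit : X^T *m X \in unitmx.
Proof.
apply: unitmx_inj => b Gb0; apply: design_inj; apply: dotv_eq0.
by rewrite dotv_mulmx mulmxA Gb0 dotv0r.
Qed.

Lemma gram_inv_sym : gram_inv^T = gram_inv.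
Proof. by rewrite /gram_inv trmx_inv trmx_mul trmxK. Qed.

(** Pythagoras, given the normal equations at [b]. *)
Lemma sqresid_orth (y : 'cV[R]_n) (K : {set 'I_p}) (b b' : 'cV[R]_p) :
  (forall c : 'cV[R]_p, (forall i, i \in K -> c i 0 = 0) ->
     dotv (X *m c) (y - X *m b) = 0) ->
  (forall i, i \in K -> b i 0 = 0) -> (forall i, i \in K -> b' i 0 = 0) ->
  sqresid X y b' = sqresid X y b + dotv (X *m (b - b')) (X *m (b - b')).
Proof.
move=> orth bK b'K.
rewrite /sqresid -/(dotv (y - X *m b) (y - X *m b)).
rewrite -/(dotv (y - X *m b') (y - X *m b')).
rewrite -sqrnormD; first by rewrite mulmxBr addrA subrK.
by rewrite dotvC orth// => i iK; rewrite !mxE bK// b'K// subr0.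
Qed.

(** By Pythagoras a competitor [b'] exceeds [b] by the squared length of [X *m (b - b')], which
    vanishes only for [b' = b] because [X] is injective. Uniqueness is what identifies the value
    chosen by [xget]. *)
Lemma lse_orth (y : 'cV[R]_n) (K : {set 'I_p}) (b : 'cV[R]_p) :
  (forall i, i \in K -> b i 0 = 0) ->
  (forall c : 'cV[R]_p, (forall i, i \in K -> c i 0 = 0) ->
     dotv (X *m c) (y - X *m b) = 0) ->
  is_lse X y K b /\ lse X K y = b.
Proof.
move=> bK orth; have lb : is_lse X y K b.
  split=> // b' b'K; rewrite (sqresid_orth orth bK b'K).
  by rewrite lerDl dotv_ge0.
split=> //; apply: xget_unique => // b' [b'K b'min].
have := b'min b bK; rewrite (sqresid_orth orth bK b'K) gerDl => le0.
have /dotv_eq0 /design_inj /eqP : dotv (X *m (b - b')) (X *m (b - b')) = 0.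
  by apply/eqP; rewrite eq_le le0 dotv_ge0.
by rewrite subr_eq0 => /eqP.
Qed.

Lemma lse_orth0 (y : 'cV[R]_n) c :
  dotv (X *m c) (y - X *m (gram_inv *m X^T *m y)) = 0.
Proof.
rewrite dotv_mulmx mulmxBr !mulmxA mulmxV ?gram_unit// mul1mx.
by rewrite subrr dotv0r.
Qed.

Lemma lse_set0 y : lse X finset.set0 y = gram_inv *m X^T *m y.
Proof.
apply: (proj2 (lse_orth _ _)) => [i|c _]; first by rewrite inE.
exact: lse_orth0.
Qed.

(** The vector representing the linear functional that sends [y] to a^T betahat. Lying in the column
    space of [X], it is orthogonal to all residuals. *)
Definition lse_coord_vec (a : 'cV[R]_p) : 'cV[R]_n := X *m (gram_inv *m a).

Lemma dotv_lse_set0 a y : dotv a (lse X finset.set0 y) = dotv (lse_coord_vec a) y.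
Proof.
rewrite lse_set0 /lse_coord_vec dotv_mulmx dotv_mulmx gram_inv_sym.
by rewrite mulmxA.
Qed.

Lemma lse_set0_coord j y :
  lse X finset.set0 y j 0 = dotv (lse_coord_vec (delta_mx j 0)) y.
Proof. by rewrite -dotv_lse_set0 dotv_delta. Qed.

Lemma dotv_lse_coord_vec a b :
  dotv (lse_coord_vec a) (lse_coord_vec b) = dotv a (gram_inv *m b).
Proof.
rewrite /lse_coord_vec dotv_mulmx !mulmxA mulmxV ?gram_unit// mul1mx.
by rewrite dotv_mulmx gram_inv_sym.
Qed.

Lemma lse_coord_vec_gt0 a : a != 0 -> 0 < dotv (lse_coord_vec a) (lse_coord_vec a).
Proof.
move=> a0; rewrite lt_neqAle dotv_ge0 andbT eq_sym.
apply: contra_neq a0 => /dotv_eq0 /design_inj.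
move=> /(congr1 (mulmx (X^T *m X))); rewrite mulmxA mulmxV ?gram_unit// mul1mx.
by rewrite mulmx0.
Qed.

Lemma delta_neq0 (j : 'I_p) : (delta_mx j 0 : 'cV[R]_p) != 0.
Proof.
apply/eqP => /matrixP /(_ j 0); rewrite !mxE !eqxx => /eqP.
by rewrite oner_eq0.
Qed.

Lemma gram_inv_diag j :
  gram_inv j j = dotv (lse_coord_vec (delta_mx j 0)) (lse_coord_vec (delta_mx j 0)).
Proof. by rewrite dotv_lse_coord_vec dotv_delta -colE mxE. Qed.

Lemma gram_inv_diag_gt0 j : 0 < gram_inv j j.
Proof. by rewrite gram_inv_diag lse_coord_vec_gt0// delta_neq0. Qed.

(** The correction is the multiple of column [j] of the inverse Gram matrix that kills coordinate
    [j]. The Gram matrix maps this column to the [j]-th basis vector, so the correction is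
    orthogonal to every [X *m c] with [c j 0 = 0]. *)
Lemma lse_set1_spec y j (b := lse X finset.set0 y -
    (lse X finset.set0 y j 0 / gram_inv j j) *: (gram_inv *m delta_mx j 0)) :
  is_lse X y [set j]%SET b /\ lse X [set j]%SET y = b.
Proof.
apply: lse_orth => [i|c cj].
  rewrite inE => /eqP ->; rewrite /b !mxE -/(gram_inv).
  rewrite (_ : \sum_j0 _ = gram_inv j j).
    by rewrite divfK ?gt_eqF ?gram_inv_diag_gt0// subrr.
  rewrite (bigD1 j)//= big1 ?addr0 => [|k kj].
    by rewrite mxE !eqxx mulr1.
  by rewrite mxE (negbTE kj) mulr0.
have -> : y - X *m b = (y - X *m lse X finset.set0 y) +
    (lse X finset.set0 y j 0 / gram_inv j j) *: (X *m (gram_inv *m delta_mx j 0)).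
  by rewrite /b mulmxBr -scalemxAr opprB addrA [in RHS]addrAC.
rewrite dotvDr {1}lse_set0 lse_orth0 add0r dotvZr dotv_mulmx !mulmxA.
rewrite mulmxV ?gram_unit// mul1mx dotvC dotv_delta cj ?mulr0//.
by rewrite inE.
Qed.

Lemma RSS_set1 y j : RSS X [set j]%SET y =
  RSS X finset.set0 y + lse X finset.set0 y j 0 ^+ 2 / gram_inv j j.
Proof.
have [_ lE] := lse_set1_spec y j.
rewrite /RSS lE (sqresid_orth (K := finset.set0) (b := lse X finset.set0 y)).
- congr (_ + _).
  rewrite opprB addrC subrK -scalemxAr -/(lse_coord_vec _) dotvZr dotvZl.
  rewrite -gram_inv_diag.
  by field; rewrite gt_eqF// gram_inv_diag_gt0.
- by move=> c _; rewrite lse_set0 lse_orth0.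
- by move=> i; rewrite inE.
- by move=> i; rewrite inE.
Qed.

(** Yields existence of the restricted estimator for every [K], and with it measurability and the
    monotonicity of RSS in [K]. *)
Lemma lse_linear (K : {set 'I_p}) : exists L : 'M[R]_(p, n),
  forall y, is_lse X y K (L *m y) /\ lse X K y = L *m y.
Proof.
pose dv : 'rV[R]_p := \row_i (i \notin K)%:R.
pose D : 'M[R]_p := diag_mx dv.
have DE (b : 'cV[R]_p) i : (D *m b) i 0 = (i \notin K)%:R * b i 0.
  by rewrite mul_diag_mx !mxE.
have Dfix (b : 'cV[R]_p) : (forall i, i \in K -> b i 0 = 0) -> D *m b = b.
  move=> bK; apply/matrixP => i j; rewrite ord1 DE.
  by case: (boolP (i \in K)) => iK /=; [rewrite bK// mulr0|rewrite mul1r].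
have D2 : D *m D = D.
  apply/matrixP => i j; rewrite mul_diag_mx !mxE.
  by case: (i \in K); rewrite /= ?mul0r ?mul1r ?mul0rn//.
have DT : D^T = D by rewrite tr_diag_mx.
(* The Gram matrix on the kept coordinates and the identity on the dropped ones, hence
   invertible. *)
pose M := D *m X^T *m X *m D + (1%:M - D).
have E : (1%:M - D) *m D = 0 by rewrite mulmxBl mul1mx D2 subrr.
have MD : (1%:M - D) *m M = 1%:M - D.
  rewrite /M mulmxDr -!mulmxA (mulmxA (1%:M - D) D) E mul0mx add0r.
  by rewrite mulmxBr mulmx1 E subr0.
have M_unit : M \in unitmx.
  apply: unitmx_inj => b Mb.
  have eDb : D *m b = b.
    have : (1%:M - D) *m (M *m b) = 0 by rewrite Mb mulmx0.
    rewrite mulmxA MD mulmxBl mul1mx.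
    by move=> /eqP; rewrite subr_eq0 => /eqP <-.
  apply: design_inj; apply: dotv_eq0; rewrite dotv_mulmx -{1}eDb dotv_mulmx DT.
  move: Mb; rewrite /M mulmxDl mulmxBl mul1mx eDb subrr addr0.
  by rewrite -!mulmxA eDb !mulmxA => ->; rewrite dotv0r.
exists (D *m invmx M *m D *m X^T) => y.
apply: lse_orth => [i iK|c cK].
  by rewrite -!mulmxA DE iK mul0r.
rewrite dotv_mulmx -(Dfix c cK) dotv_mulmx DT mulmxBr mulmxBr.
set z := D *m (X^T *m y).
have -> : D *m invmx M *m D *m X^T *m y = D *m (invmx M *m z).
  by rewrite /z !mulmxA.
have -> : D *m (X^T *m (X *m (D *m (invmx M *m z)))) =
          (M - (1%:M - D)) *m (invmx M *m z).
  by rewrite /M addrK !mulmxA.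
rewrite mulmxBl [in X in _ - X]mulmxA mulmxV// mul1mx.
have -> : (1%:M - D) *m (invmx M *m z) = 0.
  rewrite -{1}MD -mulmxA [M *m _]mulmxA mulmxV// mul1mx /z mulmxA E.
  by rewrite mul0mx.
by rewrite subr0 subrr dotv0r.
Qed.

Lemma RSS_mono y (K1 K2 : {set 'I_p}) : K1 \subset K2 -> RSS X K1 y <= RSS X K2 y.
Proof.
move=> K12; have [L1 /(_ y) [[_ L1min] L1E]] := lse_linear K1.
have [L2 /(_ y) [[L2K _] L2E]] := lse_linear K2.
rewrite /RSS L1E L2E; apply: L1min => i iK1.
by apply: L2K; apply: (fintype.subsetP K12).
Qed.

Lemma RSS_ge0 K y : 0 <= RSS X K y. Proof. exact: dotv_ge0. Qed.

Lemma lse_set0_affine b s x : lse X finset.set0 (X *m b + s *: x) =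
  b + s *: lse X finset.set0 x.
Proof.
rewrite !lse_set0 mulmxDr -scalemxAr; congr (_ + _).
by rewrite !mulmxA -(mulmxA gram_inv) mulVmx ?gram_unit// mul1mx.
Qed.

Lemma RSS_set0_affine b s x : RSS X finset.set0 (X *m b + s *: x) =
  s ^+ 2 * RSS X finset.set0 x.
Proof.
rewrite /RSS lse_set0_affine.
set y := lse X finset.set0 x.
have E : X *m b + s *: x - X *m (b + s *: y) = s *: (x - X *m y).
  by rewrite mulmxDr opprD addrACA subrr add0r -scalemxAr scalerBr.
rewrite /sqresid -[LHS]/(dotv (X *m b + s *: x - X *m (b + s *: y)) _) E.
by rewrite dotvZr dotvZl mulrA -expr2.
Qed.

Lemma dotv_RSS x : dotv x x = RSS X finset.set0 x +
  dotv (X *m lse X finset.set0 x) (X *m lse X finset.set0 x).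
Proof.
rewrite -[RSS _ _ _]/(dotv (x - X *m _) (x - X *m _)).
rewrite -sqrnormD ?subrK// dotvC.
by rewrite lse_set0 lse_orth0.
Qed.

(** Orthonormalizing the Gram matrix splits [dotv x x] into RSS and [p] squared coordinates along
    the rows of [B], each of which can be integrated out separately. *)
Lemma column_basis : exists B : 'M[R]_(p, n),
  [/\ B *m B^T = 1%:M,
      exists L : 'M[R]_p, B = L *m X^T
    & forall x, dotv (X *m lse X finset.set0 x) (X *m lse X finset.set0 x)
        = \sum_i (B *m x) i 0 ^+ 2].
Proof.
have [] := @posdef_orthonormalize R p (X^T *m X).
- by rewrite trmx_mul trmxK.
- move=> v v0; rewrite -mulmxA -dotv_mulmx lt_neqAle dotv_ge0 andbT eq_sym.
  by apply: contra_neq v0 => /dotv_eq0 /design_inj.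
move=> L LG; exists (L *m X^T); split; last first.
- move=> x; have -> : \sum_i (L *m X^T *m x) i 0 ^+ 2 =
      dotv (L *m X^T *m x) (L *m X^T *m x).
    by rewrite dotvE; apply: eq_bigr => i _; rewrite expr2.
  (* A one-sided inverse of a square matrix is two-sided, so the factors of [L G L^T = 1] may be
     rotated cyclically. *)
  have LL : gram_inv = L^T *m L.
    have : X^T *m X *m (L^T *m L) = 1%:M.
      rewrite mulmxA; apply: mulmx1C; rewrite !mulmxA.
      by rewrite mulmxA in LG.
    move=> /(congr1 (mulmx gram_inv)); rewrite mulmx1 (mulmxA gram_inv).
    by rewrite mulVmx ?gram_unit// mul1mx => ->.
  rewrite lse_set0 -mulmxA -/(lse_coord_vec _) dotv_lse_coord_vec LL -!mulmxA.
  by rewrite [RHS]dotv_mulmx.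
- by exists L.
- by rewrite trmx_mul trmxK !mulmxA -(mulmxA L).
Qed.

End LeastSquares.

Notation student_kernel m s x := ((1 + x ^+ 2 / m) `^ (- s)).

(** * Student's law *)

Section GammaFunction.
Context {R : realType}.
Notation leb := (@lebesgue_measure R).
Notation phi := (@normal_pdf R 0 1).

Lemma integral_gauss_scaled (b : R) : 0 < b ->
  (\int[leb]_x (expR (- (b * x ^+ 2)))%:E = (Num.sqrt (pi / b))%:E)%E.
Proof.
move=> b0; have mphi := @measurable_phiE R.
have c0 : 0 < Num.sqrt (2 * b) by rewrite sqrtr_gt0 mulr_gt0.
pose k := Num.sqrt (pi * 2) / Num.sqrt (2 * b).
transitivity (\int[leb]_x (k%:E *
    ((Num.sqrt (2 * b))%:E * (phi (Num.sqrt (2 * b) * x + 0))%:E)))%E.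
  apply: eq_integral => x _; rewrite -!EFinM; congr EFin.
  rewrite addr0 normal_pdf01E exprMn sqr_sqrtr ?mulr_ge0 ?ltW// -(mulr_natr pi 2).
  have s2 : Num.sqrt (pi * 2) != 0 :> R.
    by rewrite gt_eqF// sqrtr_gt0 mulr_gt0// pi_gt0.
  rewrite !mulrA /k divfK ?gt_eqF// divff// mul1r.
  by congr expR; field.
rewrite ge0_integralZl//=.
- rewrite (ge0_integral_affine 0 c0 mphi) ?integral_normal_pdf ?mule1.
    rewrite /k -sqrtrV ?mulr_ge0 ?ltW// -sqrtrM ?mulr_ge0 ?pi_ge0//.
    by congr (Num.sqrt _)%:E; field; rewrite gt_eqF.
  by move=> x; rewrite lee_fin normal_pdf_ge0.
- apply: emeasurable_funM => //; apply: (measurableT_comp mphi).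
  by apply: measurable_funD => //; exact: measurable_funM.
- by move=> x _; rewrite mule_ge0// lee_fin ?normal_pdf_ge0// ltW.
- by rewrite lee_fin divr_ge0.
Qed.

Definition gamma_fun (s x : R) : R :=
  \1_`]0, +oo[ x * (x `^ (s - 1) * expR (- x)).

(** Kept in the extended reals so that Tonelli identities hold before finiteness is known; [Gamma]
    is its finite part. *)
Definition GammaE (s : R) : \bar R := (\int[leb]_x (gamma_fun s x)%:E)%E.

Lemma Gamma_fineE s : Gamma s = fine (GammaE s).
Proof.
rewrite /Gamma /GammaE /Rintegral; congr fine.
by rewrite ge0_integral_indicM.
Qed.

Lemma gamma_fun_ge0 s x : 0 <= gamma_fun s x.
Proof. by rewrite !mulr_ge0// ?powR_ge0 ?expR_ge0. Qed.

Lemma measurable_gamma_fun s : measurable_fun setT (gamma_fun s).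
Proof.
apply: measurable_funM; first exact: measurable_indic.
apply: measurable_funM; first exact: measurable_powR.
by apply: measurableT_comp => //; exact: measurable_funN.
Qed.

Lemma GammaE_ge0 s : (0 <= GammaE s)%E.
Proof. by apply: integral_ge0 => x _; rewrite lee_fin gamma_fun_ge0. Qed.

Lemma indic_gt0 (c x : R) : 0 < c ->
  \1_`]0, +oo[ (c * x) = \1_`]0, +oo[ x :> R.
Proof.
move=> c0; rewrite !indicE; congr (nat_of_bool _)%:R.
by apply/idP/idP; rewrite !inE /= !in_itv /= !andbT pmulr_rgt0.
Qed.

Lemma GammaE_scale s (c : R) : 0 < c ->
  (\int[leb]_y (\1_`]0%R, +oo[ y * (y `^ (s - 1) * expR (- (y * c))))%:E =
   (c `^ (- s))%:E * GammaE s)%E.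
Proof.
move=> c0; have mg := measurable_gamma_fun s.
have -> : GammaE s = (\int[leb]_y (c%:E * (gamma_fun s (c * y + 0))%:E))%E.
  rewrite (@ge0_integral_affine _ c 0 (fun y => (gamma_fun s y)%:E))//.
    exact/measurable_EFinP.
  by move=> x; rewrite lee_fin gamma_fun_ge0.
rewrite -ge0_integralZl//=.
- apply: eq_integral => y _; rewrite -!EFinM addr0 /gamma_fun indic_gt0//.
  congr EFin; case: (ltP 0 y) => y0; last first.
    rewrite !indicE memNset; first by rewrite !mul0r !mulr0.
    by rewrite /= in_itv /= andbT; apply/negP; rewrite -leNgt.
  have -> : expR (- (c * y)) = expR (- (y * c)) by rewrite mulrC.
  have cc : c `^ (- s) * (c * c `^ (s - 1)) = 1.
    rewrite -{2}(powRr1 (ltW c0)) -!powRD ?(gt_eqF c0) ?implybT//.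
    by rewrite [_ + (s - 1)]addrC subrK addNr powRr0.
  by rewrite powRM ?ltW// -[LHS]mul1r -{1}cc; ring.
- apply: emeasurable_funM => //; apply/measurable_EFinP.
  apply: (measurableT_comp mg).
  by apply: measurable_funD => //; exact: measurable_funM.
- by move=> y _; rewrite mule_ge0// lee_fin ?gamma_fun_ge0// ltW.
- by rewrite lee_fin powR_ge0.
Qed.

(** Gamma(s) c^(-s) is the integral of y^(s-1) exp(-c y). With c = 1 + x^2/m, Tonelli leaves a
    Gaussian integral in x equal to sqrt(pi m / y), which lowers the exponent by one half. At s =
    (m+1)/2 this is the reciprocal of Student's constant. *)
Lemma GammaE_student_kernel (m s : R) : 0 < m ->
  (GammaE s * \int[leb]_x (student_kernel m s x)%:E =
   (Num.sqrt (m * pi))%:E * GammaE (s - 2^-1))%E.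
Proof.
move=> m0.
have cpos x : 0 < 1 + x ^+ 2 / m.
  by rewrite ltr_pwDl// divr_ge0// ?sqr_ge0 ?ltW.
have mc : measurable_fun setT (fun x : R => 1 + x ^+ 2 / m).
  by apply: measurable_funD => //; apply: measurable_funM.
have mk : measurable_fun setT (fun x : R => (student_kernel m s x)%:E).
  by apply/measurable_EFinP; exact: (measurableT_comp (measurable_powR (- s)) mc).
pose H (xy : R * R) := (\1_`]0%R, +oo[ xy.2 *
  (xy.2 `^ (s - 1) * expR (- (xy.2 * (1 + xy.1 ^+ 2 / m)))))%:E.
have mH : measurable_fun setT H.
  apply/measurable_EFinP/measurable_funM.
    exact: measurable_indic_comp.
  apply: measurable_funM; first exact: (measurableT_comp (measurable_powR _)).
  apply: measurableT_comp => //; apply: measurable_funN.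
  by apply: measurable_funM => //; exact: (measurableT_comp mc).
have H0 xy : (0 <= H xy)%E by rewrite lee_fin !mulr_ge0// ?powR_ge0 ?expR_ge0.
transitivity (\int[leb]_x \int[leb]_y H (x, y))%E.
  rewrite muleC -ge0_integralZr//; last 2 first.
  - by move=> x _; rewrite lee_fin powR_ge0.
  - exact: GammaE_ge0.
  by apply: eq_integral => x _; rewrite -GammaE_scale.
rewrite (fubini_tonelli (m1 := leb) (m2 := leb) H mH H0) /GammaE -ge0_integralZl//=; last 2 first.
- apply/measurable_EFinP; exact: measurable_gamma_fun.
- by move=> x _; rewrite lee_fin gamma_fun_ge0.
apply: eq_integral => y _.
transitivity (\int[leb]_x ((\1_`]0%R, +oo[ y * (y `^ (s - 1) * expR (- y)))%:E *
    (expR (- (y / m * x ^+ 2)))%:E))%E.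
  apply: eq_integral => x _; rewrite /H /= -EFinM -!mulrA -expRD.
  by congr (_ * (_ * expR _))%:E; field; rewrite gt_eqF.
have [y0|y0] := ltP 0 y; last first.
  rewrite /gamma_fun !indicE memNset; last first.
    by rewrite /= in_itv /= andbT; apply/negP; rewrite -leNgt.
  by rewrite !mul0r mule0 integral0_eq// => x _; rewrite mul0e.
rewrite ge0_integralZl//=; last 2 first.
- apply/measurable_EFinP/measurableT_comp => //; apply: measurable_funN.
  by apply: measurable_funM.
- by rewrite lee_fin !mulr_ge0// ?powR_ge0 ?expR_ge0.
rewrite integral_gauss_scaled ?divr_gt0// -EFinM; congr EFin.
rewrite /gamma_fun.
have -> : s - 2^-1 - 1 = (s - 1) + - 2^-1 by rewrite addrAC.
rewrite [y `^ (s - 1 - 2^-1)]powRD ?(gt_eqF y0) ?implybT// powRN.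
rewrite powR12_sqrt ?ltW//.
have -> : pi / (y / m) = (m * pi) / y :> R by field; rewrite !gt_eqF.
rewrite (sqrtrM _) ?mulr_ge0 ?pi_ge0 ?ltW// sqrtrV ?ltW//.
ring.
Qed.

Lemma GammaE_lty (k : nat) (s : R) : 1 <= s -> s - 1 <= k.+1%:R ->
  (GammaE s < +oo)%E.
Proof.
move=> s1 sk.
(* [C] bounds x^(s-1) exp(-x/2): by 1 for x <= 1, and beyond by the term of degree [k.+1] in the
   series of exp(x/2). The remaining exp(-x/2) is twice the exponential density of rate 1/2. *)
pose C : R := 1 + (k.+1)`!%:R * 2 ^+ k.+1.
have C0 : 0 <= C by rewrite addr_ge0// mulr_ge0// exprn_ge0.
apply: (@le_lt_trans _ _ (\int[leb]_x ((C * 2)%:E * (exponential_pdf 2^-1 x)%:E))%E).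
  apply: ge0_le_integral => //.
  - by move=> x _; rewrite lee_fin gamma_fun_ge0.
  - apply/measurable_EFinP; exact: measurable_gamma_fun.
  - apply: emeasurable_funM => //.
    apply/measurable_EFinP; exact: measurable_exponential_pdf.
  move=> x _. rewrite -EFinM lee_fin.
  have [x0|x0] := ltP 0 x; last first.
    rewrite /gamma_fun indicE memNset; last first.
      by rewrite /= in_itv /= andbT; apply/negP; rewrite -leNgt.
    by rewrite mul0r !mulr_ge0// exponential_pdf_ge0.
  rewrite /gamma_fun indicE mem_set; last by rewrite /= in_itv /= andbT.
  rewrite [_%:R]/= mul1r.
  rewrite exponential_pdfE ?(ltW x0)// (_ : C * 2 * _ = C * expR (- (x / 2))); last first.
    by rewrite -!mulrA (mulrA 2) divff// mul1r; congr (_ * expR _); field.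
  have -> : expR (- x) = expR (- (x / 2)) * expR (- (x / 2)).
    by rewrite -expRD; congr expR; field.
  rewrite mulrA ler_wpM2r ?expR_ge0// expRN ler_pdivrMr ?expR_gt0//.
  have e1 : 1 <= expR (x / 2) by rewrite -expR0 ler_expR divr_ge0// ltW.
  rewrite /C mulrDl mul1r.
  have [x1|x1] := leP x 1.
    apply: (@le_trans _ _ 1).
      apply: (@le_trans _ _ (1 `^ (s - 1))); last by rewrite powR1.
      by apply: ge0_ler_powR; rewrite ?nnegrE ?subr_ge0// (ltW x0).
    by rewrite (le_trans e1)// lerDl !mulr_ge0 ?exprn_ge0 ?expR_ge0.
  apply: (@le_trans _ _ (x ^+ k.+1)).
    by rewrite -powR_mulrn ?(ltW x0)// ler_powR// ltW.
  have := expR_ge1Dxn k (divr_ge0 (ltW x0) (ler0n R 2)).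
  move=> H; apply: (@le_trans _ _ ((k.+1)`!%:R * 2 ^+ k.+1 * expR (x / 2))).
    rewrite -mulrA -ler_pdivrMl ?ltr0n ?fact_gt0// mulrC.
    rewrite -ler_pdivrMl ?exprn_gt0//.
    apply: le_trans H; rewrite -[leLHS]add0r lerD// expr_div_n.
    by rewrite mulrCA mulrA mulrAC mulrC lexx.
  by rewrite lerDr expR_ge0.
rewrite ge0_integralZl//=.
- by rewrite integral_exponential_pdf// mule1 ltry.
- apply/measurable_EFinP; exact: measurable_exponential_pdf.
- by move=> x _; rewrite lee_fin exponential_pdf_ge0.
- by rewrite lee_fin mulr_ge0.
Qed.

Lemma GammaE_gt0 s : (0 < GammaE s)%E.
Proof.
rewrite lt_neqAle GammaE_ge0 andbT eq_sym; apply/eqP => G0.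
have mg := measurable_gamma_fun s.
have mgE : measurable_fun setT (fun x => (gamma_fun s x)%:E).
  exact/measurable_EFinP.
have : (\int[leb]_x `|(gamma_fun s x)%:E| = 0)%E.
  rewrite -G0; apply: eq_integral => x _.
  by rewrite gee0_abs// lee_fin gamma_fun_ge0.
move=> /(ae_eq_integral_abs leb measurableT mgE) [N [mN N0 sN]].
have : (leb `]0%R, 1%R] <= leb N)%E.
  apply: le_measure; rewrite ?inE//=.
  apply: subset_trans sN => x /=; rewrite in_itv /= => /andP[x0 x1] H.
  have /eqP := H Logic.I; apply/negP; rewrite eqe gt_eqF//.
  rewrite /gamma_fun indicE mem_set; last by rewrite /= in_itv /= andbT.
  by rewrite mul1r mulr_gt0 ?expR_gt0 ?powR_gt0.
by rewrite N0 lebesgue_measure_itv /= lte_fin ltr01 sube0 lee_fin ler10.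
Qed.

End GammaFunction.

Section Measurability.
Context {R : realType} {n p : nat}.
Variable X : 'M[R]_(n, p).
Hypothesis rX : row_free X^T.

Lemma measurable_mulmx k (A : 'M[R]_(k, n)) i :
  measurable_fun [set: rvec R n] (fun x : rvec R n => (A *m x) i 0).
Proof.
under eq_fun do rewrite mxE.
apply: measurable_sum => j; apply: measurable_funM => //.
exact: measurable_coord.
Qed.

Lemma measurable_prod_mulmx k (A : 'M[R]_(k, n)) (e : seq 'I_k) (f : R -> R) :
  measurable_fun setT f ->
  measurable_fun [set: rvec R n] (fun x : rvec R n => \prod_(j <- e) f ((A *m x) j 0)).
Proof.
move=> mf; elim: e => [|j e IHe].
  by under eq_fun do rewrite big_nil; exact: measurable_cst.
under eq_fun do rewrite big_cons; apply: measurable_funM => //.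
exact: (measurableT_comp mf (measurable_mulmx A j)).
Qed.

Lemma measurable_lse K i :
  measurable_fun [set: rvec R n] (fun x : rvec R n => lse X K x i 0).
Proof.
have [L LE] := lse_linear rX K.
by under eq_fun do rewrite (LE _).2; exact: measurable_mulmx.
Qed.

Lemma measurable_dotv_lse K a :
  measurable_fun [set: rvec R n] (fun x : rvec R n => dotv a (lse X K x)).
Proof.
under eq_fun do rewrite dotvE.
by apply: measurable_sum => j; apply: measurable_funM => //; exact: measurable_lse.
Qed.

Lemma measurable_RSS K :
  measurable_fun [set: rvec R n] (fun x : rvec R n => RSS X K x).
Proof.
have [L LE] := lse_linear rX K.
have E (x : 'cV[R]_n) : RSS X K x = \sum_i ((1%:M - X *m L) *m x) i 0 ^+ 2.
  rewrite -[LHS]/(dotv (x - X *m lse X K x) (x - X *m lse X K x)) dotvE.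
  rewrite (LE _).2 mulmxA mulmxBl mul1mx.
  by apply: eq_bigr => i _; rewrite expr2.
under eq_fun do rewrite E.
by apply: measurable_sum => i; apply: measurable_funX; exact: measurable_mulmx.
Qed.

Lemma measurable_sqrt : measurable_fun [set: R] (@Num.sqrt R).
Proof.
apply: continuous_measurable_fun; exact: sqrt_continuous.
Qed.

End Measurability.

Lemma measurable_student_kernel (R : realType) (c s : R) :
  measurable_fun setT (fun x : R => (student_kernel c s x)%:E).
Proof.
have mc : measurable_fun setT (fun x : R => 1 + x ^+ 2 / c).
  by apply: measurable_funD => //; apply: measurable_funM.
by apply/measurable_EFinP; exact: (measurableT_comp (measurable_powR (- s)) mc).
Qed.

Section StudentLaw.
Context {R : realType} {n p : nat}.
Variable X : 'M[R]_(n, p).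
Hypotheses (rX : row_free X^T) (pn : (p < n)%N).
Variable mu : probability (rvec R n) R.
Hypothesis gmu : std_gauss mu.
Notation leb := (@lebesgue_measure R).
Notation phi := (@normal_pdf R 0 1).
Notation m := (n - p)%N.

(** On the standardized error vector this is the statistic [W] of the theorem. *)
Definition resid_scale (x : 'cV[R]_n) : R :=
  Num.sqrt (RSS X finset.set0 x / (n - p)%:R).

Lemma dof_gt0 : 0 < (n - p)%:R :> R.
Proof. by rewrite ltr0n subn_gt0. Qed.

Lemma resid_scale_ge0 x : 0 <= resid_scale x. Proof. exact: sqrtr_ge0. Qed.

Lemma measurable_resid_scale :
  measurable_fun [set: rvec R n] (fun x : rvec R n => resid_scale x).
Proof.
apply: (measurableT_comp measurable_sqrt); apply: measurable_funM => //.
exact: measurable_RSS.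
Qed.

Lemma sqr_resid_scale x :
  resid_scale x ^+ 2 = RSS X finset.set0 x / (n - p)%:R.
Proof. by rewrite sqr_sqrtr// divr_ge0 ?RSS_ge0// ltW// dof_gt0. Qed.

Lemma RSS_set0_shift x c : RSS X finset.set0 (x + X *m c) = RSS X finset.set0 x.
Proof.
by have := RSS_set0_affine rX c 1 x; rewrite expr1n mul1r scale1r addrC.
Qed.

Lemma resid_scale_shift x c : resid_scale (x + X *m c) = resid_scale x.
Proof. by rewrite /resid_scale RSS_set0_shift. Qed.

Lemma resid_scaleZ s x : 0 < s -> resid_scale (s *: x) = s * resid_scale x.
Proof.
move=> s0; rewrite /resid_scale.
have := RSS_set0_affine rX 0 s x; rewrite mulmx0 add0r => ->.
rewrite -mulrA sqrtrM ?sqr_ge0// sqrtr_sqr gtr0_norm//.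
Qed.

(** The integrand is [s] times the N(0, s^2) density. *)
Lemma integral_gauss_factor (s : R) : 0 < s ->
  (\int[leb]_z ((expR (- (s ^- 2 - 1) * z ^+ 2 / 2))%:E * (phi z)%:E) = s%:E)%E.
Proof.
move=> s0; have mphi := @measurable_phiE R.
have s'0 : 0 < s^-1 by rewrite invr_gt0.
have mc : measurable_fun setT (fun z => (phi (s^-1 * z + 0))%:E).
  apply: (measurableT_comp mphi).
  by apply: measurable_funD => //; exact: measurable_funM.
transitivity (\int[leb]_z (s%:E * (s^-1%:E * (phi (s^-1 * z + 0))%:E)))%E.
  apply: eq_integral => z _; rewrite -!EFinM addr0 [s^-1 * z]mulrC.
  by rewrite (normal_pdf_scale _ s0) !mulrA divff ?gt_eqF// mul1r.
rewrite ge0_integralZl//=.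
- rewrite (ge0_integral_affine 0 s'0 mphi) ?integral_normal_pdf ?mule1//.
  by move=> x; rewrite lee_fin normal_pdf_ge0.
- by apply: emeasurable_funM.
- by move=> x _; rewrite mule_ge0// lee_fin ?normal_pdf_ge0// ltW.
- by rewrite lee_fin ltW.
Qed.

(** The rows of [B] are orthonormal vectors of the column space, to whose translations [g] is blind;
    each is integrated out and contributes one factor [s]. *)
Lemma integral_gauss_factors (B : 'M[R]_(p, n)) (s : R) (e : seq 'I_p)
    (g : rvec R n -> \bar R) :
  B *m B^T = 1%:M -> (exists L : 'M[R]_p, B = L *m X^T) -> 0 < s -> uniq e ->
  measurable_fun setT g -> (forall x, 0 <= g x)%E ->
  (forall (x : rvec R n) c, g (x + X *m c) = g x) ->
  (\int[mu]_x (g x * (\prod_(i <- e)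
      expR (- (s ^- 2 - 1) * ((B *m x) i 0)%R ^+ 2 / 2))%R%:E) =
   (s ^+ size e)%:E * \int[mu]_x g x)%E.
Proof.
move=> BB [L BL] s0 + mg g0 gX; elim: e => [_|i e IH /= /andP[ie ue]].
  by rewrite mul1e; apply: eq_integral => x _; rewrite big_nil mule1.
pose f (z : R) := expR (- (s ^- 2 - 1) * z ^+ 2 / 2).
have mf : measurable_fun setT f.
  apply: measurableT_comp => //; apply: measurable_funM => //.
  by apply: measurable_funM => //; exact: measurable_funX.
have f0 z : 0 <= f z by exact: expR_ge0.
pose P (x : rvec R n) := (g x * (\prod_(j <- e) f ((B *m x) j 0))%R%:E)%E.
have mP : measurable_fun setT P.
  apply: emeasurable_funM => //; apply/measurable_EFinP.
  exact: measurable_prod_mulmx.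
have P0 x : (0 <= P x)%E by rewrite mule_ge0// lee_fin prodr_ge0.
(* By orthonormality, a shift along row [i] changes neither [g] nor the factors of the other
   rows. *)
pose u : 'cV[R]_n := (row i B)^T.
have ux (x : 'cV[R]_n) : dotv u x = (B *m x) i 0.
  by rewrite dotvE mxE; apply: eq_bigr => k _; rewrite !mxE.
have Bu j : (B *m u) j 0 = (j == i)%:R.
  have -> : (B *m u) j 0 = (B *m B^T) j i.
    by rewrite !mxE; apply: eq_bigr => k _; rewrite !mxE.
  by rewrite BB mxE.
have uX : u = X *m (L^T *m delta_mx i 0).
  by rewrite /u tr_row BL trmx_mul trmxK colE mulmxA.
pose Phi (zx : R * rvec R n) := (P zx.2 * (f zx.1)%:E)%E.
transitivity (\int[mu]_x Phi (dotv u x, x))%E.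
  apply: eq_integral => x _; rewrite big_cons /Phi /= /P ux -muleA -EFinM.
  by rewrite [X in (_ * X%:E)%E]mulrC.
rewrite (integral_gauss_split gmu).
- transitivity (\int[mu]_x (P x * s%:E))%E.
    apply: eq_integral => x _; rewrite -(integral_gauss_factor s0).
    rewrite -ge0_integralZl//=.
    + by apply: eq_integral => z _; rewrite /Phi /= muleA.
    + apply: emeasurable_funM; first exact/measurable_EFinP.
      exact: measurable_phiE.
    + by move=> z _; rewrite mule_ge0// lee_fin ?normal_pdf_ge0.
  rewrite ge0_integralZr//= ?lee_fin ?ltW//.
  by rewrite IH// muleC muleA -EFinM exprS.
- by rewrite ux Bu eqxx.
- apply: emeasurable_funM; first exact: (measurableT_comp mP).
  by apply/measurable_EFinP; exact: (measurableT_comp mf).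
- by move=> zx; rewrite mule_ge0// lee_fin.
- move=> z x t; rewrite /Phi /=; congr (_ * _)%E; rewrite /P; congr (_ * _%:E)%E.
    by rewrite uX scalemxAr gX.
  apply: eq_big_seq => j je; congr f.
  rewrite mulmxDr -scalemxAr mxE [X in _ + X]mxE Bu.
  by case: eqP => [ji|_]; rewrite ?mulr0 ?addr0//; rewrite -ji je in ie.
Qed.

(** Compute E W(s x) twice. Homogeneity gives s E W; the scaling density gives s^(-n) times a
    Gaussian factor in [dotv x x], whose column-space part integrates to s^p and whose RSS part is
    the exponential on the left. Hence the factor s^(n-p+1), with no chi-square density involved. *)
Lemma integral_resid_scale_exp (t : R) :
  (\int[mu]_x (resid_scale x * expR (- (t ^+ 2 * resid_scale x ^+ 2 / 2)))%:E =
   (student_kernel (n - p)%:R (m.+1%:R / 2) t)%:E *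
   \int[mu]_x (resid_scale x)%:E)%E.
Proof.
have [B [BB BL Bx]] := column_basis rX.
have d0 := dof_gt0.
pose c : R := 1 + t ^+ 2 / m%:R.
have c0 : 0 < c by rewrite ltr_pwDl// divr_ge0 ?sqr_ge0// ltW.
(* Chosen so that s^(-2) - 1 = t^2/m, which turns the RSS exponent into t^2 W^2 / 2. *)
pose s := (Num.sqrt c)^-1.
have s0 : 0 < s by rewrite invr_gt0 sqrtr_gt0.
have s2 : s ^- 2 = c by rewrite exprVn invrK sqr_sqrtr// ltW.
have mW := measurable_resid_scale.
pose g (x : rvec R n) :=
  (resid_scale x * expR (- (t ^+ 2 * resid_scale x ^+ 2 / 2)))%:E.
have mg : measurable_fun setT g.
  apply/measurable_EFinP; apply: measurable_funM => //.
  apply: measurableT_comp => //; apply: measurable_funN.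
  by do 2 apply: measurable_funM => //; exact: measurable_funX.
have g0 x : (0 <= g x)%E by rewrite lee_fin mulr_ge0 ?resid_scale_ge0 ?expR_ge0.
have W0 x : (0 <= (resid_scale x)%:E)%E by rewrite lee_fin resid_scale_ge0.
have mWE : measurable_fun [set: rvec R n] (fun x : rvec R n => (resid_scale x)%:E).
  exact/measurable_EFinP.
have := integral_gauss_scale gmu s0 mWE W0.
rewrite [LHS](_ : _ = s%:E * \int[mu]_x (resid_scale x)%:E)%E; last first.
  rewrite -ge0_integralZl//= ?lee_fin ?ltW//.
  by apply: eq_integral => x _; rewrite resid_scaleZ// EFinM.
move=> E1.
pose e := enum 'I_p.
have H := @integral_gauss_factors B s e g BB BL s0 (enum_uniq _) mg g0.
have {}H := H (fun x y => congr1 (fun w => (w * expR (- (t ^+ 2 * w ^+ 2 / 2)))%:E)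
  (resid_scale_shift x y)).
rewrite size_enum_ord in H.
have E2 : (\int[mu]_x ((resid_scale x)%:E *
     (s ^- n * expR (- (s ^- 2 - 1) * dotv x x / 2))%:E) =
     (s ^- n)%:E * ((s ^+ p)%:E * \int[mu]_x g x))%E.
  rewrite -H -ge0_integralZl//=; last 3 first.
  - apply: emeasurable_funM => //; apply/measurable_EFinP.
    apply: (measurable_prod_mulmx B e (f := fun z =>
      expR (- (s ^- 2 - 1) * z ^+ 2 / 2))).
    apply: measurableT_comp => //; apply: measurable_funM => //.
    by apply: measurable_funM => //; exact: measurable_funX.
  - by move=> x _; rewrite mule_ge0// lee_fin prodr_ge0// => i _; exact: expR_ge0.
  - by rewrite lee_fin invr_ge0 exprn_ge0// ltW.
  apply: eq_integral => x _; rewrite /g -!EFinM; congr EFin.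
  rewrite mulrCA; congr (_ * _); rewrite -[RHS]mulrA; congr (_ * _).
  rewrite -expR_sum -expRD; congr expR.
  rewrite (dotv_RSS rX) Bx /e big_enum/= -mulr_suml -mulr_sumr s2 /c.
  rewrite sqr_resid_scale; field; rewrite gt_eqF//.
move: E1; rewrite E2 muleA -EFinM.
have -> : s ^- n * s ^+ p = s ^- m.
  have sn : s ^+ n = s ^+ m * s ^+ p by rewrite -exprD subnK// ltnW.
  by rewrite sn invfM divfK// expf_neq0// gt_eqF.
move=> E3.
have : ((s ^+ m)%:E * (s%:E * \int[mu]_x (resid_scale x)%:E) =
        \int[mu]_x g x)%E.
  by rewrite E3 muleA -EFinM divff ?mul1e// expf_neq0// gt_eqF.
rewrite muleA -EFinM -exprSr => <-; congr (_%:E * _)%E.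
rewrite /s -/c exprVn -powR_mulrn ?sqrtr_ge0// powRN; congr (_^-1).
rewrite -powR12_sqrt ?(ltW c0)// -powRrM; congr (_ `^ _).
by rewrite mulrC.
Qed.

(** For W > 0, the density in y of z / W given W, with z an independent N(0,1), restricted to
    [A]. *)
Definition studentized (A : set R) (xy : rvec R n * R) : \bar R :=
  (\1_A xy.2 * (resid_scale xy.1 * phi (resid_scale xy.1 * xy.2)))%:E.

Lemma measurable_studentized A : measurable A -> measurable_fun setT (studentized A).
Proof.
move=> mA; have mW := measurable_resid_scale.
have mphi : measurable_fun setT phi by exact: measurable_normal_pdf.
have mW1 : measurable_fun [set: rvec R n * R] (fun xy => resid_scale xy.1).
  exact: (measurableT_comp mW).
apply/measurable_EFinP; apply: measurable_funM.
  exact: measurable_indic_comp.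
apply: measurable_funM => //; apply: (measurableT_comp mphi).
exact: measurable_funM.
Qed.

Lemma studentized_ge0 A xy : (0 <= studentized A xy)%E.
Proof. by rewrite lee_fin !mulr_ge0// ?resid_scale_ge0 ?normal_pdf_ge0. Qed.

Lemma integral_studentized (A : set R) : measurable A ->
  (\int[mu]_x \int[leb]_y studentized A (x, y) =
   (Num.sqrt (pi *+ 2))^-1%:E * \int[mu]_x (resid_scale x)%:E *
   \int[leb]_(y in A) (student_kernel (n - p)%:R (m.+1%:R / 2) y)%:E)%E.
Proof.
move=> mA; have mW := measurable_resid_scale.
rewrite (fubini_tonelli (m1 := mu) (m2 := leb) _ (measurable_studentized mA)
  (studentized_ge0 A)).
have k0 : 0 <= (Num.sqrt (pi *+ 2))^-1 :> R by rewrite invr_ge0.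
have EW0 : (0 <= \int[mu]_x (resid_scale x)%:E)%E.
  by apply: integral_ge0 => x _; rewrite lee_fin resid_scale_ge0.
rewrite -ge0_integralZl//=; last 3 first.
- by apply: measurable_funTS; exact: measurable_student_kernel.
- by move=> x _; rewrite lee_fin powR_ge0.
- by rewrite mule_ge0// lee_fin.
rewrite [RHS]integral_mkcond; apply: eq_integral => y _.
rewrite patchE /studentized /=.
have mg : measurable_fun [set: rvec R n] (fun x : rvec R n =>
    resid_scale x * expR (- (y ^+ 2 * resid_scale x ^+ 2 / 2))).
  apply: measurable_funM => //.
  apply: measurableT_comp => //; apply: measurable_funN.
  by do 2 apply: measurable_funM => //; exact: measurable_funX.
transitivity (\int[mu]_x ((\1_A y * (Num.sqrt (pi *+ 2))^-1)%:E *
    (resid_scale x * expR (- (y ^+ 2 * resid_scale x ^+ 2 / 2)))%:E))%E.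
  apply: eq_integral => x _; rewrite -EFinM normal_pdf01E exprMn.
  have -> : - (resid_scale x ^+ 2 * y ^+ 2) / 2 =
            - (y ^+ 2 * resid_scale x ^+ 2 / 2) by field.
  by congr EFin; ring.
rewrite ge0_integralZl//=; last 2 first.
- exact/measurable_EFinP.
- by move=> x _; rewrite lee_fin mulr_ge0 ?resid_scale_ge0 ?expR_ge0.
rewrite integral_resid_scale_exp indicE.
case: (y \in A) => /=; last by rewrite mul0r mul0e.
by rewrite mul1r -muleA [X in (_ * X = _)%E]muleC.
Qed.

Lemma integral_studentized_scale (w : R) (A : set R) : 0 < w -> measurable A ->
  (\int[leb]_y (\1_A y * (w * phi (w * y)))%:E =
   \int[leb]_z (\1_A (z / w) * phi z)%:E)%E.
Proof.
move=> w0 mA; have mphi : measurable_fun setT phi by exact: measurable_normal_pdf.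
rewrite -[RHS](ge0_integral_affine 0 w0).
- apply: eq_integral => y _; rewrite -EFinM addr0 mulrCA; congr (_ * _)%:E.
  by rewrite mulrAC divff ?gt_eqF// mul1r.
- apply/measurable_EFinP; apply: measurable_funM => //.
  by apply: measurable_indic_comp => //; exact: measurable_funM.
- by move=> z; rewrite lee_fin mulr_ge0// normal_pdf_ge0.
Qed.

Hypothesis RSS_neq0 : mu [set x | RSS X finset.set0 x = 0] = 0%E.

Lemma measurable_RSS_eq0 : measurable ([set x | RSS X finset.set0 x = 0] : set (rvec R n)).
Proof.
have mR := measurable_RSS rX finset.set0.
rewrite -[X in measurable X]setTI.
by apply: (mR measurableT [set 0]); exact: measurable_set1.
Qed.

Lemma resid_scale_eq0 x : (resid_scale x == 0) = (RSS X finset.set0 x == 0).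
Proof.
rewrite -(sqrf_eq0 (resid_scale x)) sqr_resid_scale mulf_eq0 invr_eq0.
by rewrite (gt_eqF dof_gt0) orbF.
Qed.

(** Wherever W > 0 the density W phi(W y) has total mass 1, and W = 0 is a null event. *)
Lemma student_const :
  ((Num.sqrt (pi *+ 2))^-1%:E * \int[mu]_x (resid_scale x)%:E *
   \int[leb]_y (student_kernel (n - p)%:R (m.+1%:R / 2) y)%:E = 1)%E.
Proof.
rewrite -integral_studentized//.
transitivity (\int[mu]_x (cst 1%E x : \bar R))%E; last first.
  by rewrite integral_cst// mul1e; exact: probability_setT.
apply: ge0_ae_eq_integral => //.
- exact: (measurable_fun_fubini_tonelli_F (m2 := leb) _
    (measurable_studentized measurableT) (studentized_ge0 setT)).
- by move=> x _; apply: integral_ge0 => y _; exact: studentized_ge0.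
- exists [set x | RSS X finset.set0 x = 0]; split => //.
    exact: measurable_RSS_eq0.
  move=> x /= H; apply: contrapT => /eqP x0; apply: H => _.
  have w0 : 0 < resid_scale x.
    by rewrite lt_neqAle resid_scale_ge0 eq_sym resid_scale_eq0 x0.
  rewrite /studentized /= integral_studentized_scale//.
  rewrite -[RHS](integral_normal_pdf (0 : R) 1).
  by apply: eq_integral => z _; rewrite indicT mul1r.
Qed.

(** Integrating out the coordinate along the unit vector [X *m c], which leaves W unchanged, makes
    the event a statement about z / W at fixed W. *)
Lemma student_prob_event (c : 'cV[R]_p) (t : R) : 0 <= t ->
  dotv (X *m c) (X *m c) = 1 ->
  (mu [set x : rvec R n | (`|dotv (X *m c) x| <= t * resid_scale x)%R] =
   (Num.sqrt (pi *+ 2))^-1%:E * \int[mu]_x (resid_scale x)%:E *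
   \int[leb]_(y in `[(- t)%R, t]) (student_kernel (n - p)%:R (m.+1%:R / 2) y)%:E)%E.
Proof.
move=> t0 u1; have mW := measurable_resid_scale.
have mb : measurable_fun [set: R * rvec R n]
    (fun zx => `|zx.1| <= t * resid_scale zx.2).
  apply: measurable_fun_ler; first exact: measurableT_comp.
  by apply: measurable_funM => //; exact: (measurableT_comp mW).
pose Phi (zx : R * rvec R n) := ((`|zx.1| <= t * resid_scale zx.2)%R%:R : R)%:E.
rewrite measure_set_bool; last first.
  apply: measurable_fun_ler; last exact: measurable_funM.
  by apply: measurableT_comp => //; exact: measurable_dotv.
rewrite (integral_gauss_split gmu u1 (Phi := Phi)); last 3 first.
- by apply/measurable_EFinP; exact: measurable_fun_natb.
- by move=> zx; rewrite lee_fin.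
- by move=> z x s; rewrite /Phi /= scalemxAr resid_scale_shift.
rewrite -integral_studentized; last exact: measurable_itv.
apply: eq_integral => x _.
rewrite /studentized /=.
have [/eqP w0|w0] := boolP (resid_scale x == 0).
  (* Where W vanishes the weight is 0, and the event shrinks to the single point z = 0, which
     Lebesgue measure ignores. *)
  rewrite [RHS]integral0_eq => [|y _]; last by rewrite w0 mul0r mulr0.
  rewrite -[RHS](integral_set1 (fun z => (phi z)%:E) 0) [RHS]integral_mkcond.
  apply: eq_integral => z _; rewrite patchE /Phi /= w0 mulr0 normr_le0.
  case: eqP => [->|z0]; first by rewrite mem_set// mul1e.
  by rewrite memNset// mul0e.
have {}w0 : 0 < resid_scale x by rewrite lt_neqAle resid_scale_ge0 eq_sym w0.
rewrite integral_studentized_scale//; apply: eq_integral => z _.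
rewrite /Phi /= -EFinM indicE; congr ((_ : bool)%:R * _)%:E.
apply/idP/idP; rewrite inE /= in_itv /= ler_norml.
  by rewrite ler_pdivlMr// ler_pdivrMr// mulNr.
by rewrite ler_pdivlMr// ler_pdivrMr// mulNr.
Qed.

(** The constant built from E W and the one built from Gamma both have product 1 with the same
    kernel integral, so they agree once all quantities are known to be finite. *)
Lemma student_pdf_const (y : R) :
  ((student_pdf m y)%:E =
   (Num.sqrt (pi *+ 2))^-1%:E * \int[mu]_x (resid_scale x)%:E *
   (student_kernel (n - p)%:R (m.+1%:R / 2) y)%:E)%E.
Proof.
have d0 := dof_gt0.
have := student_const.
set E0 := ((Num.sqrt (pi *+ 2))^-1%:E * _)%E.
have E00 : (0 <= E0)%E.
  rewrite mule_ge0 ?lee_fin ?invr_ge0//; apply: integral_ge0 => x _.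
  by rewrite lee_fin resid_scale_ge0.
have := @GammaE_student_kernel R (n - p)%:R (m.+1%:R / 2) d0.
have -> : m.+1%:R / 2 - 2^-1 = m%:R / 2 :> R by rewrite -natr1; field.
set I := (\int[leb]_x _)%E => GI EI.
have I0 : (0 <= I)%E by apply: integral_ge0 => x _; rewrite lee_fin powR_ge0.
have s1 : 1 <= m.+1%:R / 2 :> R.
  by rewrite ler_pdivlMr// mul1r ler_nat ltnS subn_gt0.
have := @GammaE_lty R m _ s1.
have -> : m.+1%:R / 2 - 1 <= m.+1%:R :> R.
  rewrite lerBlDr ler_pdivrMr// mulrDl mul1r mulr_natr mulr2n.
  by rewrite -addrA lerDl addr_ge0.
move=> /(_ isT); have := GammaE_gt0 (m.+1%:R / 2 : R).
rewrite /student_pdf !Gamma_fineE.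
move: GI (EI); have := GammaE_ge0 (m%:R / 2 : R).
move: (GammaE (m%:R / 2)) (GammaE (m.+1%:R / 2)) => h g.
have one_neq (x : \bar R) : x = 1%E -> x = 0%E \/ x = +oo%E -> False.
  by move=> -> [] /eqP; rewrite ?eqe ?oner_eq0.
(* Two nonnegative extended reals with product 1 are finite. *)
have fin_factor (x z : \bar R) : (0 <= x)%E -> (0 <= z)%E -> (x * z = 1)%E ->
    x \is a fin_num.
  case: x => [x|_ z0 /one_neq H|]//; exfalso; apply: H.
  by move: z0; rewrite le_eqVlt => /predU1P[<-|?]; [left; rewrite mule0|right; rewrite gt0_mulye].
have Efin := fin_factor _ _ E00 I0 EI.
have Ifin : I \is a fin_num by apply: (fin_factor _ _ I0 E00); rewrite muleC.
move=> h0 GI EI' g0 gy.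
have gfin : g \is a fin_num by rewrite ge0_fin_numE// ltW.
have sd : 0 < Num.sqrt ((n - p)%:R * pi) :> R by rewrite sqrtr_gt0 mulr_gt0 ?pi_gt0.
have hfin : h \is a fin_num.
  move: h0 GI; rewrite -(fineK Ifin) -(fineK gfin) -EFinM.
  by case: h => [h| |]//; rewrite gt0_muley ?lte_fin.
move: GI EI' g0; rewrite -(fineK Ifin) -(fineK gfin) -(fineK Efin) -(fineK hfin).
rewrite -!EFinM /= => -[GI] [EI'] g0; congr EFin.
have i_neq0 : fine I != 0 by apply/eqP => i0; move: EI'; rewrite i0 mulr0 => /esym/eqP; rewrite oner_eq0.
rewrite -GI invfM mulrA divff ?gt_eqF// mul1r; congr (_ * _).
by apply: (mulIf i_neq0); rewrite mulVf.
Qed.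

(** An inequality suffices, so existence of the quantile need not be shown: without one, [tquantile]
    is the default 0 and the event has probability 0. *)
Lemma tquantile_coverage (alpha : R) (c : 'cV[R]_p) : 0 < alpha < 1 ->
  dotv (X *m c) (X *m c) = 1 ->
  (mu [set x : rvec R n |
     (`|dotv (X *m c) x| <= tquantile alpha m * resid_scale x)%R] <=
   (1 - alpha)%:E)%E.
Proof.
move=> /andP[alpha0 alpha1] u1.
have [/(xgetPex 0)|noq] := pselect (exists t, student_prob m `[- t, t] = (1 - alpha)%:E);
    last first.
  rewrite /tquantile xgetPN; last by move=> t tP; apply: noq; exists t.
  rewrite student_prob_event// oppr0 set_itv1 integral_set1 mule0 lee_fin.
  by rewrite subr_ge0 ltW.
rewrite -/(tquantile alpha m) /=; set t := tquantile alpha m => tP.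
(* A negative [t] would give an empty interval, forcing [alpha = 1]. *)
have t0 : 0 <= t.
  rewrite leNgt; apply/negP => t0; move: tP.
  rewrite /student_prob set_itv_ge ?integral_set0; last first.
    by rewrite bnd_simp -ltNge (lt_trans t0)// oppr_gt0.
  move=> /eqP; rewrite eqe eq_sym subr_eq0 => /eqP a1.
  by rewrite a1 ltxx in alpha1.
rewrite student_prob_event// -tP /student_prob -ge0_integralZl//=.
- by under [X in (_ <= X)%E]eq_integral do rewrite student_pdf_const.
- by apply: measurable_funTS; exact: measurable_student_kernel.
- by move=> x _; rewrite lee_fin powR_ge0.
- rewrite mule_ge0 ?lee_fin ?invr_ge0//; apply: integral_ge0 => x _.
  by rewrite lee_fin resid_scale_ge0.
Qed.

End StudentLaw.

(** * Joint law of the estimators and the residual scale *)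

Section PsiIntegral.
Context {R : realType}.
Notation leb := (@lebesgue_measure R).
Notation phi := (@normal_pdf R 0 1).

Lemma normal_pdf_affine (mu s z : R) : 0 < s ->
  s * normal_pdf mu s (s * z + mu) = phi z.
Proof.
move=> s0; rewrite normal_pdf01E normal_pdfE ?gt_eqF//= /normal_peak /normal_fun.
rewrite addrK -(mulrnAr (s ^+ 2)) sqrtrM ?sqr_ge0// sqrtr_sqr gtr0_norm//.
rewrite invfM !mulrA divff ?gt_eqF// mul1r; congr (_ * expR _).
by rewrite -[s ^+ 2 *+ 2]mulr_natr; field; rewrite gt_eqF.
Qed.

(** A single formula for both branches: at [v = 0] the variable mu + sqrt(v) z is the point mass. *)
Lemma PsiE (x y mu v : R) : 0 <= v ->
  ((Psi x y mu v)%:E = \int[leb]_z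
    ((x <= mu + Num.sqrt v * z <= y)%R%:R * phi z)%:E)%E.
Proof.
move=> v0; rewrite /Psi; have [->|vn0] := eqVneq v 0.
  transitivity (\int[leb]_z (((x <= mu <= y)%R%:R)%:E * (phi z)%:E))%E.
    rewrite ge0_integralZl//=.
    - by rewrite integral_normal_pdf mule1; case: (_ <= _ <= _).
    - exact: measurable_phiE.
    - by move=> z _; rewrite lee_fin normal_pdf_ge0.
  by apply: eq_integral => z _; rewrite sqrtr0 mul0r addr0 EFinM.
have s0 : 0 < Num.sqrt v by rewrite sqrtr_gt0 lt_neqAle eq_sym vn0.
set s := Num.sqrt v in s0 *.
rewrite fineK; last by apply: fin_num_measure; exact: measurable_itv.
pose f w := (\1_`[x, y] w * normal_pdf mu s w)%:E.
transitivity (\int[leb]_w f w)%E.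
  by rewrite -ge0_integral_indicM.
rewrite -(ge0_integral_affine mu s0).
- apply: eq_integral => z _; rewrite /f -EFinM mulrCA normal_pdf_affine//.
  congr (_ * _)%:E; rewrite indicE; congr (nat_of_bool _)%:R.
  by apply/idP/idP; rewrite inE /= in_itv /= addrC.
- apply/measurable_EFinP/measurable_funM; last exact: measurable_normal_pdf.
  exact: measurable_indic.
- by move=> w; rewrite lee_fin mulr_ge0// normal_pdf_ge0.
Qed.

Lemma Psi_ge0 (x y mu v : R) : 0 <= v -> 0 <= Psi x y mu v.
Proof.
move=> v0; rewrite -lee_fin PsiE//; apply: integral_ge0 => z _.
by rewrite lee_fin mulr_ge0// normal_pdf_ge0.
Qed.

Lemma Psi_le1 (x y mu v : R) : 0 <= v -> Psi x y mu v <= 1.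
Proof.
move=> v0; rewrite -lee_fin PsiE// -[leRHS](integral_normal_pdf (0:R) 1).
apply: ge0_le_integral => //.
- by move=> z _; rewrite lee_fin mulr_ge0// normal_pdf_ge0.
- apply/measurable_EFinP/measurable_funM; last exact: measurable_normal_pdf.
  apply: measurable_fun_natb; apply: measurable_and; apply: measurable_fun_ler => //.
    by apply: measurable_funD => //; exact: measurable_funM.
  by apply: measurable_funD => //; exact: measurable_funM.
- exact: measurable_phiE.
- move=> z _; rewrite lee_fin; case: (_ <= _ <= _).
    by rewrite mul1r.
  by rewrite mul0r normal_pdf_ge0.
Qed.

End PsiIntegral.

Section JointLaw.
Context {R : realType} {n p : nat}.
Variable X : 'M[R]_(n, p).
Hypotheses (rX : row_free X^T) (pn : (p < n)%N).
Variable mu : probability (rvec R n) R.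
Hypothesis gmu : std_gauss mu.
Notation leb := (@lebesgue_measure R).
Notation phi := (@normal_pdf R 0 1).
Notation m := (n - p)%N.
Notation W := (resid_scale X).
Variables (c1 c2 : 'cV[R]_p).
Notation z1 x := (dotv (X *m c1) x).
Notation z2 x := (dotv (X *m c2) x).
Hypotheses (u11 : dotv (X *m c1) (X *m c1) = 1)
  (u22 : dotv (X *m c2) (X *m c2) = 1).
Let rho : R := dotv (X *m c1) (X *m c2).

Lemma sqr_residual_direction :
  dotv (X *m (c1 - rho *: c2)) (X *m (c1 - rho *: c2)) = 1 - rho ^+ 2.
Proof.
rewrite mulmxBr -scalemxAr dotvDl !dotvDr !dotvNl !dotvNr !dotvZl !dotvZr u11 u22.
rewrite [dotv (X *m c2) (X *m c1)]dotvC -/rho; ring.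
Qed.

Lemma sqr_rho_le1 : 0 <= 1 - rho ^+ 2.
Proof. by rewrite -sqr_residual_direction dotv_ge0. Qed.

(** Regression of z1 on z2: the remainder runs along a unit vector orthogonal to [X *m c2] and still
    in the column space, so integrating it out disturbs neither z2 nor W. When rho^2 = 1 there is no
    remainder and z1 = rho z2. *)
Lemma integral_joint_z1 (f : R * (R * R) -> \bar R) :
  measurable_fun setT f -> (forall y, 0 <= f y)%E ->
  (\int[mu]_x f (z1 x, (z2 x, W x)) =
   \int[mu]_x \int[leb]_z
     (f ((rho * z2 x + Num.sqrt (1 - rho ^+ 2) * z)%R, (z2 x, W x)) *
      (phi z)%:E))%E.
Proof.
move=> mf f0; have mW := measurable_resid_scale rX.
have mz2 : measurable_fun [set: rvec R n] (fun x => z2 x) by exact: measurable_dotv.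
have [t0|t0] := eqVneq (1 - rho ^+ 2) 0.
  have := sqr_residual_direction; rewrite t0 => /dotv_eq0 /(design_inj rX) /eqP.
  rewrite subr_eq0 => /eqP c12.
  apply: eq_integral => x _; rewrite sqrtr0.
  transitivity (\int[leb]_z (f (rho * z2 x, (z2 x, W x))%R * (phi z)%:E))%E.
    rewrite ge0_integralZl//=.
    - by rewrite integral_normal_pdf mule1 {1}c12 -scalemxAr dotvZl.
    - exact: measurable_phiE.
    - by move=> z _; rewrite lee_fin normal_pdf_ge0.
  by apply: eq_integral => z _; rewrite mul0r addr0.
have tau2 : 0 < 1 - rho ^+ 2 by rewrite lt_neqAle eq_sym t0 sqr_rho_le1.
set tau := Num.sqrt (1 - rho ^+ 2).
have tau0 : 0 < tau by rewrite sqrtr_gt0.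
have tauE : tau ^+ 2 = 1 - rho ^+ 2 by rewrite sqr_sqrtr// ltW.
pose c := tau^-1 *: (c1 - rho *: c2).
have uu : dotv (X *m c) (X *m c) = 1.
  rewrite /c -scalemxAr dotvZl dotvZr sqr_residual_direction -tauE expr2.
  by field; rewrite gt_eqF.
have u2 : dotv (X *m c2) (X *m c) = 0.
  rewrite /c -scalemxAr dotvZr mulmxBr -scalemxAr dotvDr dotvNr dotvZr u22.
  by rewrite dotvC -/rho mulr1 subrr mulr0.
have uz x : z1 x = rho * z2 x + tau * dotv (X *m c) x.
  rewrite /c -scalemxAr dotvZl mulmxBr -scalemxAr dotvDl dotvNl dotvZl.
  by rewrite mulrA divff ?gt_eqF// mul1r addrC subrK.
pose Phi (zx : R * rvec R n) :=
  f ((rho * z2 zx.2 + tau * zx.1)%R, (z2 zx.2, W zx.2)).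
transitivity (\int[mu]_x Phi (dotv (X *m c) x, x))%E.
  by apply: eq_integral => x _; rewrite /Phi /= -uz.
rewrite (integral_gauss_split gmu uu (Phi := Phi)); first by [].
- apply: (measurableT_comp mf); apply: measurable_fun_pair.
    apply: measurable_funD; apply: measurable_funM => //.
    exact: (measurableT_comp mz2).
  apply: measurable_fun_pair; first exact: (measurableT_comp mz2).
  exact: (measurableT_comp mW).
- by move=> zx; exact: f0.
- move=> z x s; rewrite /Phi /=; rewrite dotvDr dotvZr u2 mulr0 addr0.
  by rewrite scalemxAr resid_scale_shift.
Qed.

Lemma integral_joint_z2 (g : R * R -> \bar R) :
  measurable_fun setT g -> (forall y, 0 <= g y)%E ->
  (\int[mu]_x g (z2 x, W x) =
   \int[mu]_x \int[leb]_z (g (z, W x) * (phi z)%:E))%E.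
Proof.
move=> mg g0; have mW := measurable_resid_scale rX.
pose Phi (zx : R * rvec R n) := g (zx.1, W zx.2).
transitivity (\int[mu]_x Phi (dotv (X *m c2) x, x))%E; first by [].
rewrite (integral_gauss_split gmu u22 (Phi := Phi)); first by [].
- apply: (measurableT_comp mg); apply: measurable_fun_pair => //.
  exact: (measurableT_comp mW).
- by move=> zx; exact: g0.
- by move=> z x s; rewrite /Phi /= scalemxAr resid_scale_shift.
Qed.

Variable fW : R -> R.
Hypotheses (mfW : measurable_fun setT fW) (fW0 : forall x, 0 <= fW x).
Hypothesis fWE : forall A : set R, measurable A ->
  (mu (W @^-1` A) = \int[leb]_(x in A) (fW x)%:E)%E.

Lemma integral_resid_scale_pdf (G : R -> \bar R) :
  measurable_fun setT G -> (forall w, 0 <= G w)%E ->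
  (\int[mu]_x G (W x) = \int[leb]_w (G w * (fW w)%:E))%E.
Proof.
move=> mG G0; have mW := measurable_resid_scale rX.
pose mm := pushforward_measure mu mW.
rewrite -(@ge0_integral_density R _ _ _ _ leb mm id fW)//.
  by rewrite ge0_integral_pushforward.
by move=> A mA; rewrite -ge0_integral_indicM//; exact: fWE.
Qed.

Variables (gamma d : R).
Hypothesis d0 : 0 <= d.
Variables (lo hi : R -> R -> R).
Hypotheses (mlo : measurable_fun setT (fun hw : R * R => lo hw.1 hw.2))
  (mhi : measurable_fun setT (fun hw : R * R => hi hw.1 hw.2)).
Let kap h w := Psi (lo h w) (hi h w) (rho * (h - gamma)) (1 - rho ^+ 2).
Notation hh x := (z2 x + gamma).

Lemma measurable_kap : measurable_fun setT (fun hw : R * R => kap hw.1 hw.2).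
Proof.
apply/measurable_EFinP.
pose H (yz : (R * R) * R) := ((lo yz.1.1 yz.1.2 <=
   rho * (yz.1.1 - gamma) + Num.sqrt (1 - rho ^+ 2) * yz.2 <=
   hi yz.1.1 yz.1.2)%R%:R * phi yz.2)%:E.
have H0 yz : (0 <= H yz)%E by rewrite lee_fin mulr_ge0// normal_pdf_ge0.
have mH : measurable_fun setT H.
  have mmid : measurable_fun setT (fun yz : (R * R) * R =>
      rho * (yz.1.1 - gamma) + Num.sqrt (1 - rho ^+ 2) * yz.2).
    apply: measurable_funD; apply: measurable_funM => //.
    by apply: measurable_funB => //; exact: (measurableT_comp measurable_fst).
  apply/measurable_EFinP/measurable_funM.
    apply: measurable_fun_natb; apply: measurable_and; apply: measurable_fun_ler => //.
      exact: (measurableT_comp mlo).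
    exact: (measurableT_comp mhi).
  by apply: measurableT_comp => //; exact: measurable_normal_pdf.
rewrite (_ : EFin \o _ = fubini_F leb H).
  exact: (measurable_fun_fubini_tonelli_F (m2 := leb) H mH H0).
by apply/funext => -[h w]; rewrite /= /kap PsiE ?sqr_rho_le1.
Qed.

(** Given h and W, the variable z1 is normal with mean rho (h - gamma) and variance 1 - rho^2, so
    the conditional probability is [kap]. The substitution h = w x fixes the range |x| <= d and
    produces the factor w. *)
Lemma prob_selected_interval :
  (mu [set x : rvec R n | (lo (hh x) (W x) <= z1 x <= hi (hh x) (W x))%R &&
                          (`|hh x| <= d * W x)%R] =
   \int[leb]_(w in `]0%R, +oo[) \int[leb]_(x in `[(- d)%R, d])
      (kap (w * x) w * normal_pdf 0 1 (w * x - gamma) * w * fW w)%:E)%E.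
Proof.
have mW := measurable_resid_scale rX.
have mphi : measurable_fun setT phi by exact: measurable_normal_pdf.
have mz2 : measurable_fun [set: rvec R n] (fun x => z2 x) by exact: measurable_dotv.
have mz1 : measurable_fun [set: rvec R n] (fun x => z1 x) by exact: measurable_dotv.
pose b (y : R * (R * R)) := (lo (y.2.1 + gamma) y.2.2 <= y.1 <=
  hi (y.2.1 + gamma) y.2.2) && (`|y.2.1 + gamma| <= d * y.2.2).
have mg : measurable_fun setT (fun y : R * (R * R) => (y.2.1 + gamma, y.2.2)).
  apply: measurable_fun_pair.
    apply: measurable_funD => //; exact: (measurableT_comp measurable_fst).
  exact: (measurableT_comp measurable_snd).
have mb : measurable_fun setT b.
  apply: measurable_and; last first.
    apply: measurable_fun_ler.
      apply: measurableT_comp => //.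
      exact: (measurableT_comp measurable_fst mg).
    apply: measurable_funM => //; exact: (measurableT_comp measurable_snd mg).
  apply: measurable_and; apply: measurable_fun_ler => //.
    exact: (measurableT_comp mlo mg).
  exact: (measurableT_comp mhi mg).
have mzz : measurable_fun [set: rvec R n] (fun x : rvec R n => (z1 x, (z2 x, W x))).
  by apply: measurable_fun_pair => //; exact: measurable_fun_pair.
rewrite (measure_set_bool _ (b := fun x : rvec R n => b (z1 x, (z2 x, W x)))); last first.
  exact: (measurableT_comp mb mzz).
pose f y := ((b y)%:R : R)%:E.
have f0 y : (0 <= f y)%E by rewrite lee_fin.
rewrite (integral_joint_z1 (f := f))//; last exact/measurable_EFinP/measurable_fun_natb.
pose g (hw : R * R) := ((`|hw.1 + gamma| <= d * hw.2)%R%:R *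
  kap (hw.1 + gamma) hw.2)%:E.
have g0 y : (0 <= g y)%E by rewrite lee_fin mulr_ge0// Psi_ge0// sqr_rho_le1.
have mgg : measurable_fun setT (fun y : R * R => (y.1 + gamma, y.2)).
  by apply: measurable_fun_pair => //; exact: measurable_funD.
have mG : measurable_fun setT g.
  apply/measurable_EFinP/measurable_funM; last first.
    exact: (measurableT_comp measurable_kap mgg).
  apply: measurable_fun_natb; apply: measurable_fun_ler; last exact: measurable_funM.
  by apply: measurableT_comp => //; exact: measurable_funD.
transitivity (\int[mu]_x g (z2 x, W x))%E.
  apply: eq_integral => x _; rewrite /g /f /b /=.
  rewrite EFinM PsiE ?sqr_rho_le1// -ge0_integralZl//=.
  - apply: eq_integral => z _; rewrite -!EFinM addrK mulrA; congr (_ * _)%:E.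
    by rewrite -natrM mulnb andbC.
  - apply/measurable_EFinP/measurable_funM => //; apply: measurable_fun_natb.
    by apply: measurable_and; apply: measurable_fun_ler => //;
      apply: measurable_funD => //; exact: measurable_funM.
  - by move=> z _; rewrite lee_fin mulr_ge0// normal_pdf_ge0.
rewrite (integral_joint_z2 (g := g))//.
pose G w := (\int[leb]_z (g (z, w) * (phi z)%:E))%E.
have mGphi : measurable_fun setT (fun wz : R * R => (g (wz.2, wz.1) * (phi wz.2)%:E)%E).
  apply: emeasurable_funM.
    by apply: (measurableT_comp mG); exact: measurable_fun_pair.
  by apply/measurable_EFinP; exact: measurableT_comp.
have gphi0 (wz : R * R) : (0 <= g (wz.2, wz.1) * (phi wz.2)%:E)%E.
  by rewrite mule_ge0// lee_fin normal_pdf_ge0.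
rewrite (integral_resid_scale_pdf (G := G)); last 2 first.
- exact: (measurable_fun_fubini_tonelli_F (m2 := leb) _ mGphi gphi0).
- move=> w; apply: integral_ge0 => z _; exact: (gphi0 (w, z)).
rewrite [RHS]integral_mkcond; apply: eq_integral => w _; rewrite patchE.
(* For w <= 0 the condition |z + gamma| <= d w leaves at most the point z = - gamma. *)
have [w0|w0] := ltP 0 w; last first.
  rewrite memNset; last by rewrite /= in_itv /= andbT; apply/negP; rewrite -leNgt.
  rewrite (_ : G w = 0%E) ?mul0e//.
  transitivity (\int[leb]_(z in [set (- gamma)%R]) (g (z, w) * (phi z)%:E))%E.
    rewrite [RHS]integral_mkcond; apply: eq_integral => z _; rewrite patchE.
    case: ifPn => //; rewrite notin_setE /= => zg.
    rewrite /g /= (_ : (_ <= _) = false) ?mul0r ?mul0e//.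
    apply/negP => H; apply: zg; apply/eqP; rewrite -addr_eq0 -normr_le0.
    by rewrite (le_trans H)// mulr_ge0_le0.
  by rewrite integral_set1.
rewrite mem_set; last by rewrite /= in_itv /= andbT.
have pos z : 0 <= w * phi (w * z - gamma) by rewrite mulr_ge0 ?normal_pdf_ge0// ltW.
transitivity (\int[leb]_(x in `[(- d)%R, d])
    ((kap (w * x) w * (w * phi (w * x - gamma)))%:E * (fW w)%:E))%E; last first.
  by apply: eq_integral => x _; rewrite -EFinM; congr EFin; ring.
have mwx : measurable_fun setT (fun x : R => (w * x, w)).
  by apply: measurable_fun_pair => //; exact: measurable_funM.
have mk : measurable_fun setT (fun x => (kap (w * x) w * (w * phi (w * x - gamma)))%:E).
  apply/measurable_EFinP/measurable_funM.
    exact: (measurableT_comp measurable_kap mwx).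
  apply: measurable_funM => //; apply: (measurableT_comp mphi).
  by apply: measurable_funB => //; exact: measurable_funM.
have k0 x : (0 <= (kap (w * x) w * (w * phi (w * x - gamma)))%:E)%E.
  by rewrite lee_fin mulr_ge0// Psi_ge0// sqr_rho_le1.
rewrite ge0_integralZr//; last 2 first.
- exact: measurable_funTS.
- by rewrite lee_fin.
congr (_ * _)%E.
(* The substitution z = w x - gamma. *)
rewrite /G -(ge0_integral_affine (- gamma) w0); last 2 first.
- exact: (measurable_fun_pair2 w mGphi).
- by move=> z; exact: (gphi0 (w, z)).
rewrite [RHS]integral_mkcond; apply: eq_integral => x _; rewrite patchE /g /= subrK.
rewrite -!EFinM normrM gtr0_norm// [d * w]mulrC ler_pM2l//.
case: ifPn => [|]; rewrite ?inE ?notin_setE /= in_itv /= -ler_norml.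
  by move=> ->; congr EFin; rewrite mul1r; ring.
by move=> /negP/negbTE ->; rewrite !mul0r mulr0.
Qed.

End JointLaw.

(** * Probability of the limiting coverage event *)

Section CoverageBound.
Context {R : realType}.
Notation leb := (@lebesgue_measure R).
Notation phi := (@normal_pdf R 0 1).

Section Difference.
Variables (k1 k2 : R -> R -> R) (fW : R -> R) (gamma d : R).
Hypotheses (mk1 : measurable_fun setT (fun hw : R * R => k1 hw.1 hw.2))
  (mk2 : measurable_fun setT (fun hw : R * R => k2 hw.1 hw.2)).
Hypotheses (k1_ge0 : forall h w, 0 <= k1 h w) (k1_le1 : forall h w, k1 h w <= 1).
Hypotheses (k2_ge0 : forall h w, 0 <= k2 h w) (k2_le1 : forall h w, k2 h w <= 1).
Hypotheses (mfW : measurable_fun setT fW) (fW0 : forall x, 0 <= fW x).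

Definition selected_density (k : R -> R -> R) (w x : R) : R :=
  k (w * x) w * phi (w * x - gamma) * w * fW w.

Lemma measurable_selected_density (k : R -> R -> R) :
  measurable_fun setT (fun hw : R * R => k hw.1 hw.2) ->
  measurable_fun setT (fun wx : R * R => selected_density k wx.1 wx.2).
Proof.
move=> mk; have mwx : measurable_fun setT (fun wx : R * R => wx.1 * wx.2).
  exact: measurable_funM.
have mwxw : measurable_fun setT (fun wx : R * R => (wx.1 * wx.2, wx.1)).
  exact: measurable_fun_pair.
apply: measurable_funM; last exact: (measurableT_comp mfW).
apply: measurable_funM => //; apply: measurable_funM.
  exact: (measurableT_comp mk mwxw).
apply: (measurableT_comp (measurable_normal_pdf 0 1)).
exact: measurable_funB.
Qed.

Lemma integrable_selected_density (k : R -> R -> R) (w : R) : 0 < w ->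
  measurable_fun setT (fun hw : R * R => k hw.1 hw.2) ->
  (forall h w, 0 <= k h w) -> (forall h w, k h w <= 1) ->
  leb.-integrable `[- d, d] (fun x => (selected_density k w x)%:E).
Proof.
move=> w0 mk k0 k1'; apply: measurable_bounded_integrable => //.
- rewrite [X in (X < _)%E]lebesgue_measure_itv /=; case: ifP => _; last by rewrite ltry.
  by rewrite -EFinB ltry.
- apply: measurable_funTS.
  exact: (measurable_fun_pair2 w (measurable_selected_density mk)).
- exists (normal_peak 1 * w * fW w); split; first exact: num_real.
  move=> M CM x _.
  apply: le_trans (ltW CM); rewrite ger0_norm; last first.
    by rewrite !mulr_ge0 ?normal_pdf_ge0 ?(ltW w0).
  rewrite !ler_wpM2r ?(ltW w0)// -[leRHS]mul1r.
  by rewrite ler_pM ?normal_pdf_ge0// normal_pdf_ub ?oner_eq0.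
Qed.

(** The integrand on the left changes sign. Finiteness of the two iterated integrals, which in the
    application are probabilities, permits splitting it. *)
Lemma integral_selected_difference :
  (\int[leb]_(w in `]0%R, +oo[) \int[leb]_(x in `[(- d)%R, d])
     (selected_density k1 w x)%:E < +oo)%E ->
  (\int[leb]_(w in `]0%R, +oo[) \int[leb]_(x in `[(- d)%R, d])
     (selected_density k2 w x)%:E < +oo)%E ->
  (\int[leb]_(w in `]0%R, +oo[) \int[leb]_(x in `[(- d)%R, d])
     ((k1 (w * x) w - k2 (w * x) w) * phi (w * x - gamma) * w * fW w)%:E =
   \int[leb]_(w in `]0%R, +oo[) \int[leb]_(x in `[(- d)%R, d])
     (selected_density k1 w x)%:E -
   \int[leb]_(w in `]0%R, +oo[) \int[leb]_(x in `[(- d)%R, d])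
     (selected_density k2 w x)%:E)%E.
Proof.
have F_ge0 (k : R -> R -> R) (w : R) : (forall h w, 0 <= k h w) -> `]0, +oo[%classic w ->
    (0 <= \int[leb]_(x in `[(- d)%R, d]) (selected_density k w x)%:E)%E.
  move=> k0 /=; rewrite in_itv /= andbT => w0.
  apply: integral_ge0 => x _; rewrite lee_fin.
  by rewrite !mulr_ge0 ?normal_pdf_ge0 ?(ltW w0).
have mF (k : R -> R -> R) : (forall h w, 0 <= k h w) ->
    measurable_fun setT (fun hw : R * R => k hw.1 hw.2) ->
    measurable_fun (`]0, +oo[%classic : set R)
    (fun w => \int[leb]_(x in `[(- d)%R, d]) (selected_density k w x)%:E)%E.
  move=> k0 mk.
  pose H (wx : R * R) := (\1_`]0, +oo[ wx.1 * (\1_`[- d, d] wx.2 *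
    selected_density k wx.1 wx.2))%:E.
  have mH : measurable_fun setT H.
    apply/measurable_EFinP; apply: measurable_funM.
      exact: measurable_indic_comp.
    apply: measurable_funM; first exact: measurable_indic_comp.
    exact: measurable_selected_density.
  have H0 wx : (0 <= H wx)%E.
    rewrite lee_fin /H /selected_density; case: (ltP 0 wx.1) => w0.
      by rewrite !mulr_ge0 ?normal_pdf_ge0 ?(ltW w0).
    rewrite indicE memNset ?mul0r// /= in_itv /= andbT; apply/negP.
    by rewrite -leNgt.
  have := measurable_fun_fubini_tonelli_F (m2 := leb) H mH H0.
  move=> /(measurable_funTS (D := `]0, +oo[%classic : set R)).
  apply: eq_measurable_fun => w; rewrite inE /= => w0.
  rewrite /fubini_F [RHS]ge0_integral_indicM//.
  by apply: eq_integral => x _; rewrite /H /= indicE mem_set// mul1r.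
move=> F1y F2y.
have iF (k : R -> R -> R) : (forall h w, 0 <= k h w) ->
    measurable_fun setT (fun hw : R * R => k hw.1 hw.2) ->
    (\int[leb]_(w in `]0%R, +oo[) \int[leb]_(x in `[(- d)%R, d])
     (selected_density k w x)%:E < +oo)%E ->
    leb.-integrable `]0, +oo[ (fun w => \int[leb]_(x in `[(- d)%R, d])
     (selected_density k w x)%:E)%E.
  move=> k0 mk Fy; apply/integrableP; split; first exact: mF.
  apply: le_lt_trans Fy; rewrite le_eqVlt; apply/orP; left; apply/eqP.
  apply: eq_integral => w.
  by rewrite inE => w0; rewrite gee0_abs// F_ge0.
rewrite -integralB//; [|exact: iF|exact: iF].
apply: eq_integral => w; rewrite inE /= in_itv /= andbT => w0.
have i1 := integrable_selected_density w0 mk1 k1_ge0 k1_le1.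
have i2 := integrable_selected_density w0 mk2 k2_ge0 k2_le1.
rewrite -integralB//.
by apply: eq_integral => x _; rewrite -EFinB /selected_density; congr EFin; ring.
Qed.

End Difference.

Context {n p : nat}.
Variable X : 'M[R]_(n, p).
Hypotheses (rX : row_free X^T) (pn : (p < n)%N).
Variable mu : probability (rvec R n) R.
Hypothesis gmu : std_gauss mu.
Notation m := (n - p)%N.
Notation W := (resid_scale X).
Variables (c1 c2 : 'cV[R]_p).
Notation z1 x := (dotv (X *m c1) x).
Notation z2 x := (dotv (X *m c2) x).
Hypotheses (u11 : dotv (X *m c1) (X *m c1) = 1)
  (u22 : dotv (X *m c2) (X *m c2) = 1).
Let rho : R := dotv (X *m c1) (X *m c2).
Variable fW : R -> R.
Hypotheses (mfW : measurable_fun setT fW) (fW0 : forall x, 0 <= fW x).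
Hypothesis fWE : forall A : set R, measurable A ->
  (mu (W @^-1` A) = \int[leb]_(x in A) (fW x)%:E)%E.
Variables (alpha gamma d : R).
Hypotheses (alpha01 : 0 < alpha < 1) (d0 : 0 <= d).
Notation hh x := (z2 x + gamma).

(** A law with a density has no atom at 0. *)
Lemma RSS_eq0_null : mu [set x | RSS X finset.set0 x = 0] = 0%E.
Proof.
have := fWE (measurable_set1 0); rewrite integral_set1 => <-.
congr (mu _); apply/seteqP; split => x /= /eqP.
  by rewrite -resid_scale_eq0// => /eqP.
by rewrite resid_scale_eq0// => /eqP.
Qed.

Definition ideal_coverage : set (rvec R n) :=
  [set x | if `|hh x| <= d * W x
           then ell2 alpha m (hh x) (W x) rho <= z1 x <= u2 alpha m (hh x) (W x) rho
           else `|z1 x| <= tquantile alpha m * W x].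

Lemma measurable_halfwidth2 :
  measurable_fun setT (fun hw : R * R => halfwidth2 alpha m hw.1 hw.2 rho).
Proof.
apply: measurable_funM => //; apply: measurable_funM => //.
apply: (measurableT_comp measurable_sqrt); apply: measurable_funM => //.
apply: measurable_funD; last exact: measurable_funX.
by apply: measurable_funM => //; exact: measurable_funX.
Qed.

Let mhh : measurable_fun [set: rvec R n] (fun x : rvec R n => (hh x, W x)).
Proof.
apply: measurable_fun_pair; last exact: measurable_resid_scale.
by apply: measurable_funD => //; exact: measurable_dotv.
Qed.

Let mlo2 : measurable_fun setT (fun hw : R * R => ell2 alpha m hw.1 hw.2 rho).
Proof.
by apply: measurable_funB; [exact: measurable_funM|exact: measurable_halfwidth2].
Qed.

Let mhi2 : measurable_fun setT (fun hw : R * R => u2 alpha m hw.1 hw.2 rho).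
Proof.
by apply: measurable_funD; [exact: measurable_funM|exact: measurable_halfwidth2].
Qed.

Let SB : set (rvec R n) := [set x | `|hh x| <= d * W x].
Let S0 : set (rvec R n) := [set x | `|z1 x| <= tquantile alpha m * W x].
Let S1 : set (rvec R n) := [set x |
  (ell2 alpha m (hh x) (W x) rho <= z1 x <= u2 alpha m (hh x) (W x) rho) &&
  (`|hh x| <= d * W x)].

Let mB : measurable_fun [set: rvec R n] (fun x : rvec R n => `|hh x| <= d * W x).
Proof.
apply: measurable_fun_ler; last exact: measurable_funM (measurable_resid_scale rX).
by apply: measurableT_comp => //; apply: measurable_funD => //; exact: measurable_dotv.
Qed.

Let mSB : measurable SB. Proof. exact: measurable_set_bool. Qed.

Let mS0 : measurable S0.
Proof.
apply: measurable_set_bool; apply: measurable_fun_ler.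
  by apply: measurableT_comp => //; exact: measurable_dotv.
exact: measurable_funM (measurable_resid_scale rX).
Qed.

Let mS1 : measurable S1.
Proof.
apply: measurable_set_bool; apply: measurable_and => //.
have mz1 : measurable_fun [set: rvec R n] (fun x : rvec R n => z1 x).
  exact: measurable_dotv.
apply: measurable_and; apply: measurable_fun_ler => //.
  exact: (measurableT_comp mlo2 mhh).
exact: (measurableT_comp mhi2 mhh).
Qed.

Let ideal_coverageE : ideal_coverage = S1 `|` (S0 `\` SB).
Proof.
apply/seteqP; split => x; rewrite /ideal_coverage /S1 /S0 /SB /=.
  by case: ifP => Bx; [left; apply/andP|right].
by case=> [/andP[-> ->]|[A0x /negP/negbTE ->]].
Qed.

Lemma measurable_ideal_coverage : measurable ideal_coverage.
Proof. by rewrite ideal_coverageE; apply: measurableU => //; exact: measurableD. Qed.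

(** The event is [S1] together with [S0] minus [SB], so its probability is at most P([S0]) +
    (P([S1]) - P([S0] and [SB])). Student's law bounds the first term, and the bracket is the
    integral of k - k^dagger. *)
Lemma ideal_coverage_le :
  (mu ideal_coverage <= coverage_bound alpha m fW d rho gamma)%E.
Proof.
have mhi1 : measurable_fun setT (fun hw : R * R => u1 alpha m hw.2).
  exact: measurable_funM.
have mlo1 : measurable_fun setT (fun hw : R * R => ell1 alpha m hw.2).
  exact: measurable_funN.
have P1 : (mu S1 = \int[leb]_(w in `]0%R, +oo[) \int[leb]_(x in `[(- d)%R, d])
    (selected_density fW gamma (fun h w => kfun alpha m h w gamma rho) w x)%:E)%E.
  exact: (prob_selected_interval rX gmu u11 u22 mfW fW0 fWE gamma d0
    (lo := fun h w => ell2 alpha m h w rho) (hi := fun h w => u2 alpha m h w rho)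
    mlo2 mhi2).
have P0 : (mu (S0 `&` SB) = \int[leb]_(w in `]0%R, +oo[) \int[leb]_(x in `[(- d)%R, d])
    (selected_density fW gamma (fun h w => kdagger alpha m h w gamma rho) w x)%:E)%E.
  rewrite -(prob_selected_interval rX gmu u11 u22 mfW fW0 fWE gamma d0
    (lo := fun h w => ell1 alpha m w) (hi := fun h w => u1 alpha m w) mlo1 mhi1).
  congr (mu _); apply/seteqP; split => x; rewrite /S0 /SB /ell1 /u1 /=.
    by rewrite -ler_norml => -[? ?]; apply/andP.
  by rewrite -ler_norml => /andP.
have mu_lty A : measurable A -> (mu A < +oo)%E.
  by move=> mA; rewrite (le_lt_trans (probability_le1 _ mA))// ltry.
have r2 := sqr_rho_le1 u11 u22.
have D : (\int[leb]_(w in `]0%R, +oo[) \int[leb]_(x in `[(- d)%R, d])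
    ((kfun alpha m (w * x) w gamma rho - kdagger alpha m (w * x) w gamma rho) *
     phi (w * x - gamma) * w * fW w)%:E = mu S1 - mu (S0 `&` SB))%E.
  rewrite P1 P0; apply: (@integral_selected_difference
    (fun h w => kfun alpha m h w gamma rho) (fun h w => kdagger alpha m h w gamma rho)
    fW gamma d).
  - exact: (measurable_kap u11 u22 gamma
      (lo := fun h w => ell2 alpha m h w rho) (hi := fun h w => u2 alpha m h w rho)
      mlo2 mhi2).
  - exact: (measurable_kap u11 u22 gamma
      (lo := fun h w => ell1 alpha m w) (hi := fun h w => u1 alpha m w) mlo1 mhi1).
  - by move=> h w; exact: Psi_ge0.
  - by move=> h w; exact: Psi_le1.
  - by move=> h w; exact: Psi_ge0.
  - by move=> h w; exact: Psi_le1.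
  - exact: mfW.
  - exact: fW0.
  - by rewrite -P1 mu_lty.
  - by rewrite -P0 mu_lty//; exact: measurableI.
rewrite /coverage_bound D ideal_coverageE.
rewrite (le_trans (measureU2 _ _ _))//; first exact: measurableD.
rewrite measureD//; last exact: mu_lty.
have mus : (mu S0 <= (1 - alpha)%:E)%E.
  by apply: (tquantile_coverage rX pn gmu RSS_eq0_null alpha01 u11).
by rewrite addeCA; apply: leeD.
Qed.

End CoverageBound.

(** * Moments of linear functionals of the errors *)

Section NormalMoments.
Context {R : realType}.
Notation leb := (@lebesgue_measure R).
Notation phi := (@normal_pdf R 0 1).

Lemma ge0_integral_opp (f : R -> \bar R) :
  measurable_fun setT f -> (forall x, 0 <= f x)%E ->
  (\int[leb]_x f (- x)%R = \int[leb]_x f x)%E.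
Proof.
move=> mf f0.
have mo : measurable_fun [set: measurableTypeR R] (-%R : _ -> measurableTypeR R).
  exact: oppr_measurable.
pose m := pushforward_measure leb mo.
have -> : (\int[leb]_x f x = \int[m]_x f x)%E.
  by apply: eq_measure_integral => A mA _; exact/esym/lebesgue_measureN.
by rewrite /m ge0_integral_pushforward.
Qed.

Lemma integral_normal_odd_parts :
  (\int[leb]_z ((Num.max z 0)%:E * (phi z)%:E) =
   \int[leb]_z ((Num.max (- z) 0)%:E * (phi z)%:E))%E.
Proof.
rewrite -[LHS]ge0_integral_opp.
- by apply: eq_integral => z _; rewrite normal_pdfN.
- apply: emeasurable_funM; last exact: measurable_phiE.
  by apply/measurable_EFinP; exact: measurable_maxr.
- by move=> z; rewrite mule_ge0// lee_fin ?normal_pdf_ge0// le_max lexx orbT.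
Qed.

Lemma measurable_sqr_phi :
  measurable_fun setT (fun z : R => (z ^+ 2)%:E * (phi z)%:E)%E.
Proof.
apply: emeasurable_funM; last exact: measurable_phiE.
by apply/measurable_EFinP; exact: measurable_funX.
Qed.

Let sqr_phi_ge0 z : (0 <= (z ^+ 2)%:E * (phi z)%:E)%E.
Proof. by rewrite mule_ge0// lee_fin ?sqr_ge0 ?normal_pdf_ge0. Qed.

Let measurable_exp_phi k :
  measurable_fun setT (fun z : R => (expR (k * z ^+ 2 / 2))%:E * (phi z)%:E)%E.
Proof.
apply: emeasurable_funM; last exact: measurable_phiE.
apply/measurable_EFinP; apply: measurableT_comp => //.
by apply: measurable_funM => //; apply: measurable_funM => //; exact: measurable_funX.
Qed.

Let M := (\int[leb]_z ((z ^+ 2)%:E * (phi z)%:E))%E.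

Let integral_phiDZ (f g : R -> \bar R) (c : R) :
  measurable_fun setT f -> measurable_fun setT g -> (forall z, 0 <= f z)%E ->
  (forall z, 0 <= g z)%E -> 0 <= c ->
  (\int[leb]_z (f z + c%:E * g z) = \int[leb]_z f z + c%:E * \int[leb]_z g z)%E.
Proof.
move=> mf mg f0 g0 c0; rewrite -(ge0_integralZl _ measurableT)//.
by rewrite ge0_integralD// => [z _|]; [rewrite mule_ge0|exact: emeasurable_funM].
Qed.

Let exp_phi_ge0 k z : (0 <= (expR (k * z ^+ 2 / 2))%:E * (phi z)%:E)%E.
Proof. by rewrite mule_ge0// lee_fin ?expR_ge0 ?normal_pdf_ge0. Qed.

(** With k = 1 - s^(-2), integrate z^2 + 2/k <= (2/k) exp(k z^2 / 2), an instance of 1 + u <= exp u.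
    This gives M <= 2 s^2 / (s + 1), and 2 s - 1 exceeds that by (s - 1)/(s + 1). *)
Let second_moment_ub (s : R) : 1 < s -> (M <= (2 * s - 1)%:E)%E.
Proof.
move=> s1; have s0 : 0 < s by rewrite (lt_trans ltr01).
pose k := 1 - s ^- 2.
have k0 : 0 < k.
  by rewrite subr_gt0 invf_lt1 ?exprn_gt0// exprn_egt1.
have k2 : 0 <= 2 / k by rewrite divr_ge0// ltW.
have : (M + (2 / k)%:E <= (2 / k)%:E * s%:E)%E.
  rewrite -(integral_gauss_factor s0) -[X in (M + X)%E]mule1.
  rewrite -(integral_normal_pdf (0 : R) 1) -integral_phiDZ//; last 3 first.
  - exact: measurable_sqr_phi.
  - exact: measurable_phiE.
  - by move=> z; rewrite lee_fin normal_pdf_ge0.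
  rewrite -(add0e (_ * _)%E) -(integral0 leb setT) -integral_phiDZ//.
  apply: ge0_le_integral => //.
  - by move=> z _; rewrite adde_ge0// mule_ge0// lee_fin normal_pdf_ge0.
  - apply: emeasurable_funD; first exact: measurable_sqr_phi.
    by apply: emeasurable_funM => //; exact: measurable_phiE.
  - by apply: emeasurable_funD => //; apply: emeasurable_funM => //;
      exact: measurable_exp_phi.
  move=> z _; rewrite add0e -!EFinM -EFinD lee_fin mulrA -mulrDl.
  rewrite ler_wpM2r ?normal_pdf_ge0//.
  have := expR_ge1Dx (- (s ^- 2 - 1) * z ^+ 2 / 2).
  rewrite opprB -/k => /(ler_wpM2l k2).
  apply: le_trans; rewrite le_eqVlt; apply/orP; left; apply/eqP.
  by field; rewrite gt_eqF.
have kE : 2 / k * s - 2 / k <= 2 * s - 1.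
  have -> : 2 / k * s - 2 / k = 2 * s ^+ 2 / (s + 1).
    rewrite /k; field; apply/and3P; split; rewrite gt_eqF//.
      by rewrite addr_gt0.
    by rewrite subr_gt0 exprn_egt1.
  rewrite ler_pdivrMr ?addr_gt0// -subr_ge0.
  have -> : (2 * s - 1) * (s + 1) - 2 * s ^+ 2 = s - 1 by ring.
  by rewrite subr_ge0 ltW.
rewrite -leeBrDr// -EFinM -EFinB => /le_trans; apply.
by rewrite lee_fin.
Qed.

(** The mirror image with k = s^(-2) - 1 and a negative exponent: M >= 2 s^2 / (s + 1) >= 2 s -
    1. *)
Let second_moment_lb (s : R) : 0 < s < 1 -> ((2 * s - 1)%:E <= M)%E.
Proof.
move=> /andP[s0 s1].
pose k := s ^- 2 - 1.
have k0 : 0 < k by rewrite subr_gt0 invf_gt1 ?exprn_gt0// exprn_ilt1// ltW.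
have k2 : 0 <= 2 / k by rewrite divr_ge0// ltW.
have : ((2 / k)%:E <= M + (2 / k)%:E * s%:E)%E.
  rewrite -(integral_gauss_factor s0) -[leLHS]mule1.
  rewrite -(integral_normal_pdf (0 : R) 1) -[leLHS]add0e -(integral0 leb setT).
  rewrite -integral_phiDZ//; last 2 first.
  - exact: measurable_phiE.
  - by move=> z; rewrite lee_fin normal_pdf_ge0.
  rewrite -integral_phiDZ//; last exact: measurable_sqr_phi.
  apply: ge0_le_integral => //.
  - by move=> z _; rewrite add0e mule_ge0// lee_fin normal_pdf_ge0.
  - by apply: emeasurable_funD => //; apply: emeasurable_funM => //;
      exact: measurable_phiE.
  - apply: emeasurable_funD; first exact: measurable_sqr_phi.
    by apply: emeasurable_funM => //; exact: measurable_exp_phi.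
  move=> z _; rewrite add0e -!EFinM -EFinD lee_fin mulrA -mulrDl.
  rewrite ler_wpM2r ?normal_pdf_ge0//.
  have := expR_ge1Dx (- k * z ^+ 2 / 2).
  move=> /(ler_wpM2l k2) /(lerD (lexx (z ^+ 2))).
  apply: le_trans; rewrite le_eqVlt; apply/orP; left; apply/eqP.
  by field; rewrite gt_eqF.
have kE : 2 * s - 1 <= 2 / k - 2 / k * s.
  have -> : 2 / k - 2 / k * s = 2 * s ^+ 2 / (s + 1).
    rewrite /k; field; apply/and3P; split; rewrite gt_eqF//.
      by rewrite addr_gt0.
    have : s ^+ 2 < 1 by rewrite exprn_ilt1// ltW.
    by lra.
  rewrite ler_pdivlMr ?addr_gt0// -subr_ge0.
  have -> : 2 * s ^+ 2 - (2 * s - 1) * (s + 1) = 1 - s by ring.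
  by rewrite subr_ge0 ltW.
rewrite -EFinM -leeBlDr// -EFinB; apply: le_trans.
by rewrite lee_fin.
Qed.

(* The two bounds, sandwiching [z ^+ 2] between the exponentials whose Gaussian
   integral is explicit, pinch as [s] tends to 1. *)
Lemma normal_second_moment : (\int[leb]_z ((z ^+ 2)%:E * (phi z)%:E) = 1)%E.
Proof.
rewrite -/M; have := second_moment_ub (s := 2); rewrite ltr1n => /(_ isT).
have M0 : (0 <= M)%E by exact: integral_ge0.
have [x Mx] : exists x, M = x%:E.
  have := second_moment_ub (s := 2); rewrite ltr1n => /(_ isT).
  by case: M M0 => [x| |]// _ _; exists x.
move=> _; move: second_moment_ub second_moment_lb; rewrite Mx => ub lb.
congr EFin; apply/eqP; rewrite eq_le; apply/andP; split.
  apply/ler_addgt0Pr => e e0.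
  have /ub : 1 < 1 + e / 2 by rewrite ltrDl divr_gt0.
  rewrite lee_fin => /le_trans; apply; rewrite le_eqVlt; apply/orP; left.
  by apply/eqP; field.
rewrite leNgt; apply/negP => x1.
have x0 : 0 <= x by rewrite -lee_fin -Mx.
(* At s = (3 + x)/4 the lower bound 2 s - 1 is (1 + x)/2, which exceeds x when x < 1. *)
have /lb : 0 < (3 + x) / 4 < 1.
  by rewrite divr_gt0 ?ltr_wpDr//= ltr_pdivrMr//; lra.
rewrite lee_fin; lra.
Qed.

End NormalMoments.

Section GaussianMoments.
Context {R : realType} {n : nat}.
Variable mu : probability (rvec R n) R.
Hypothesis gmu : std_gauss mu.
Notation leb := (@lebesgue_measure R).
Notation phi := (@normal_pdf R 0 1).

Lemma integral_gauss_dotv (u : 'cV[R]_n) (f : R -> \bar R) : dotv u u = 1 ->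
  measurable_fun setT f -> (forall z, 0 <= f z)%E ->
  (\int[mu]_x f (dotv u x) = \int[leb]_z (f z * (phi z)%:E))%E.
Proof.
move=> u1 mf f0.
pose Phi (zx : R * rvec R n) := f zx.1.
transitivity (\int[mu]_x Phi (dotv u x, x))%E; first by [].
rewrite (integral_gauss_split gmu u1 (Phi := Phi)).
- rewrite /Phi /= integral_cst//; transitivity (\int[leb]_z (f z * (phi z)%:E) * 1)%E.
    by congr (_ * _)%E; exact: probability_setT.
  by rewrite mule1.
- exact: (measurableT_comp mf).
- by move=> zx; exact: f0.
- by [].
Qed.

Lemma dotv_normalize (c : 'cV[R]_n) : c != 0 ->
  exists r u, [/\ 0 < r, dotv u u = 1 & c = r *: u].
Proof.
move=> c0; have r0 : 0 < dotv c c.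
  rewrite lt_neqAle dotv_ge0 andbT eq_sym.
  by apply: contra_neq c0; exact: dotv_eq0.
exists (Num.sqrt (dotv c c)), ((Num.sqrt (dotv c c))^-1 *: c); split.
- by rewrite sqrtr_gt0.
- rewrite dotvZl dotvZr mulrA -invfM -expr2 sqr_sqrtr ?ltW//.
  by rewrite mulVf// gt_eqF.
- by rewrite scalerA divff ?scale1r// gt_eqF// sqrtr_gt0.
Qed.

Lemma integral_sqr_dotv (c : 'cV[R]_n) :
  (\int[mu]_x (dotv c x ^+ 2)%:E = (dotv c c)%:E)%E.
Proof.
have [->|/dotv_normalize[r [u [r0 u1 ->]]]] := eqVneq c 0.
  rewrite dotv0r integral0_eq// => x _.
  by rewrite dotvC dotv0r expr0n.
have msq : measurable_fun setT (fun z : R => (z ^+ 2)%:E).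
  by apply/measurable_EFinP; exact: measurable_funX.
have msqd : measurable_fun [set: rvec R n] (fun x => (dotv u x ^+ 2)%:E).
  by apply/measurable_EFinP; apply: measurable_funX; exact: measurable_dotv.
transitivity (\int[mu]_x ((r ^+ 2)%:E * (dotv u x ^+ 2)%:E))%E.
  by apply: eq_integral => x _; rewrite dotvZl exprMn.
rewrite (ge0_integralZl _ measurableT)//=; last first.
- by rewrite lee_fin sqr_ge0.
- by move=> x _; rewrite lee_fin sqr_ge0.
rewrite (integral_gauss_dotv (f := fun z => (z ^+ 2)%:E) u1)//.
  by rewrite normal_second_moment mule1 dotvZl dotvZr u1 mulr1 expr2.
by move=> z; rewrite lee_fin sqr_ge0.
Qed.

Lemma integrable_sqr_dotv (c : 'cV[R]_n) :
  mu.-integrable [set: rvec R n] (fun x => (dotv c x ^+ 2)%:E).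
Proof.
apply/integrableP; split.
  by apply/measurable_EFinP; apply: measurable_funX; exact: measurable_dotv.
under eq_integral do rewrite gee0_abs ?lee_fin ?sqr_ge0//.
by rewrite integral_sqr_dotv ltry.
Qed.

Lemma integrable_dotv (c : 'cV[R]_n) :
  mu.-integrable [set: rvec R n] (fun x => (dotv c x)%:E).
Proof.
have i1 : mu.-integrable [set: rvec R n] (fun x => (cst 1 x)%:E).
  exact: finite_measure_integrable_cst.
apply: (le_integrable measurableT _ _ (integrableD measurableT i1 (integrable_sqr_dotv c))).
  by apply/measurable_EFinP; exact: measurable_dotv.
move=> x _; rewrite -EFinD !abse_EFin lee_fin.
rewrite [leRHS]ger0_norm ?addr_ge0 ?sqr_ge0//.
rewrite /cst -[dotv c x ^+ 2]real_normK ?num_real//.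
have := normr_ge0 (dotv c x); nra.
Qed.

Lemma integral_dotv (c : 'cV[R]_n) : (\int[mu]_x (dotv c x)%:E = 0)%E.
Proof.
have [->|/dotv_normalize[r [u [r0 u1 ->]]]] := eqVneq c 0.
  by rewrite integral0_eq// => x _; rewrite dotvC dotv0r.
transitivity (\int[mu]_x (r%:E * (dotv u x)%:E))%E.
  by apply: eq_integral => x _; rewrite dotvZl.
have iu := integrable_dotv u.
rewrite integralZl//= integralE.
have mp : measurable_fun setT (fun z : R => (Num.max z 0)%:E).
  by apply/measurable_EFinP; exact: measurable_maxr.
have p0 (z : R) : (0 <= (Num.max z 0)%:E)%E by rewrite lee_fin le_max lexx orbT.
have mn : measurable_fun setT (fun z : R => (Num.max (- z) 0)%:E).
  by apply/measurable_EFinP; exact: measurable_maxr.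
have n0 (z : R) : (0 <= (Num.max (- z) 0)%:E)%E by rewrite lee_fin le_max lexx orbT.
have posE : (\int[mu]_x (fun x => (dotv u x)%:E)^\+ x =
    \int[leb]_z ((Num.max z 0)%:E * (phi z)%:E))%E.
  rewrite -(integral_gauss_dotv u1 mp p0).
  by apply: eq_integral => x _; rewrite funeposE EFin_max.
have negE : (\int[mu]_x (fun x => (dotv u x)%:E)^\- x =
    \int[leb]_z ((Num.max (- z) 0)%:E * (phi z)%:E))%E.
  rewrite -(integral_gauss_dotv u1 mn n0).
  by apply: eq_integral => x _; rewrite funenegE EFin_max.
rewrite negE -integral_normal_odd_parts -posE subee ?mule0//.
apply: integrable_pos_fin_num => //.
Qed.

(** Polarization reduces the mixed moment to squares. *)
Lemma integral_dotvM (c1 c2 : 'cV[R]_n) :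
  (\int[mu]_x (dotv c1 x * dotv c2 x)%:E = (dotv c1 c2)%:E)%E.
Proof.
have i1 := integrable_sqr_dotv (c1 + c2).
have i2 := integrable_sqr_dotv (c1 - c2).
transitivity (\int[mu]_x ((4^-1)%:E * (dotv (c1 + c2) x ^+ 2)%:E -
    (4^-1)%:E * (dotv (c1 - c2) x ^+ 2)%:E))%E.
  apply: eq_integral => x _; rewrite -!EFinM -EFinB !dotvDl dotvNl.
  by congr EFin; field.
rewrite integralB//=; [|exact: integrableZl|exact: integrableZl].
rewrite !integralZl// !integral_sqr_dotv -!EFinM -EFinB; congr EFin.
rewrite !dotvDl !dotvDr !dotvNl !dotvNr (dotvC c2 c1).
by field.
Qed.

Lemma integrable_dotvM (c1 c2 : 'cV[R]_n) :
  mu.-integrable [set: rvec R n] (fun x => (dotv c1 x * dotv c2 x)%:E).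
Proof.
have i1 := integrable_sqr_dotv c1.
have i2 := integrable_sqr_dotv c2.
apply: (le_integrable measurableT _ _ (integrableD measurableT i1 i2)).
  by apply/measurable_EFinP; apply: measurable_funM; exact: measurable_dotv.
move=> x _; rewrite -EFinD !abse_EFin lee_fin [leRHS]ger0_norm ?addr_ge0 ?sqr_ge0//.
rewrite ler_norml; apply/andP; split; nra.
Qed.

End GaussianMoments.

(** * From the linear model to standardized errors *)

Section AffineCovariance.
Context {R : realType} {n : nat} d (Om : measurableType d).
Variables (P : probability Om R) (eps : Om -> rvec R n).
Hypothesis meps : measurable_fun setT eps.

Definition law : probability (rvec R n) R :=
  distribution P (HB.pack_for {mfun Om >-> rvec R n} eps
    (isMeasurableFun.Build _ _ _ _ eps meps)).

Lemma lawE A : law A = P (eps @^-1` A). Proof. by []. Qed.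

Hypothesis glaw : std_gauss law.

Lemma integrable_law (f : rvec R n -> \bar R) :
  law.-integrable setT f -> P.-integrable setT (f \o eps).
Proof.
move=> /integrableP[mf intf]; apply/integrableP; split.
  exact: (measurableT_comp mf meps).
move: intf; rewrite /law /distribution ge0_integral_pushforward//.
exact: measurableT_comp.
Qed.

Lemma integral_law (f : rvec R n -> \bar R) :
  law.-integrable setT f -> (\int[P]_w f (eps w) = \int[law]_x f x)%E.
Proof.
move=> intf; have /integrableP[mf _] := intf.
rewrite /law /distribution integral_pushforward//.
exact: integrable_law.
Qed.

(** Converts every variance and correlation in the theorem into a dot product, up to the factor
    s^2. *)
Lemma covariance_affine k1 k2 s (c1 c2 : 'cV[R]_n) :
  covariance P (fun w => k1 + s * dotv c1 (eps w))
               (fun w => k2 + s * dotv c2 (eps w)) = (s ^+ 2 * dotv c1 c2)%:E.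
Proof.
have E (k : R) (c : 'cV[R]_n) : ('E_P[(fun w => k + s * dotv c (eps w))%R] = k%:E)%E.
  have ic := integrable_dotv glaw c.
  rewrite unlock; pose f (x : rvec R n) := ((cst k x)%:E + s%:E * (dotv c x)%:E)%E.
  have i1 : law.-integrable setT (fun x => (cst k x)%:E).
    exact: finite_measure_integrable_cst.
  transitivity (\int[P]_w f (eps w))%E; first by [].
  rewrite integral_law; last by apply: integrableD => //; exact: integrableZl.
  rewrite /f integralD//=; last exact: integrableZl.
  rewrite integralZl// integral_dotv// mule0 adde0 integral_cst//.
  by rewrite -[RHS]mule1; congr (_ * _)%E; exact: probability_setT.
rewrite covariance.unlock !E /=.
have ic := integrable_dotvM glaw c1 c2.
transitivity ('E_P[(fun w => s ^+ 2 * (dotv c1 (eps w) * dotv c2 (eps w)))%R])%E.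
  congr ('E_P[_])%E; apply/funext => w /=.
  rewrite -[LHS]/((k1 + s * dotv c1 (eps w) - k1) * (k2 + s * dotv c2 (eps w) - k2)).
  by ring.
rewrite unlock.
pose f (x : rvec R n) := ((s ^+ 2)%:E * (dotv c1 x * dotv c2 x)%:E)%E.
transitivity (\int[P]_w f (eps w))%E; first by [].
rewrite integral_law; last exact: integrableZl.
by rewrite /f integralZl// integral_dotvM.
Qed.

End AffineCovariance.

Section StandardizedErrors.
Context {R : realType} {n p : nat} d (Om : measurableType d).
Notation leb := (@lebesgue_measure R).
Variables (P : probability Om R) (X : 'M[R]_(n, p)) (beta : 'cV[R]_p) (sigma : R).
Variable Y : Om -> 'cV[R]_n.
Hypotheses (model : normal_linear_model P X beta sigma Y) (sigma0 : 0 < sigma).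

Lemma normal_prob_std (A : set R) : measurable A ->
  normal_prob 0 sigma ((fun z => sigma^-1 * z) @^-1` A) = normal_prob 0 1 A.
Proof.
move=> mA.
have mpre : measurable ((fun z : R => sigma^-1 * z) @^-1` A).
  by rewrite -[X in measurable X]setTI; exact: measurable_funM.
rewrite normal_probE//.
rewrite {1}/normal_prob.
rewrite ge0_integral_indicM; last exact: mpre.
rewrite -[LHS](ge0_integral_affine 0 sigma0).
- apply: eq_integral => z _; rewrite -EFinM mulrCA normal_pdf_affine//.
  congr (_ * _)%:E; rewrite !indicE; congr (nat_of_bool _)%:R.
  by apply/idP/idP; rewrite !inE /= addr0 mulKf// gt_eqF.
- apply/measurable_EFinP/measurable_funM; last exact: measurable_normal_pdf.
  exact: measurable_indic.
- by move=> z; rewrite lee_fin mulr_ge0// normal_pdf_ge0.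
Qed.

Definition std_error (w : Om) : rvec R n := sigma^-1 *: (Y w - X *m beta).

Lemma measurable_std_error : measurable_fun setT std_error.
Proof.
case: model => mY _; apply: measurable_fun_rvec => i.
rewrite (_ : (fun w => _) = fun w => sigma^-1 * (Y w i 0 - (X *m beta) i 0)).
  by apply: measurable_funM => //; exact: measurable_funB.
by apply/funext => w; rewrite /std_error !mxE.
Qed.

Lemma std_errorK w : Y w = X *m beta + sigma *: std_error w.
Proof. by rewrite /std_error scalerA divff ?gt_eqF// scale1r addrC subrK. Qed.

Lemma std_gauss_std_error : std_gauss (law P measurable_std_error).
Proof.
move=> A mA; transitivity (P (std_error @^-1` box A)); first by [].
case: model => _ boxE.
have mpre i : measurable ((fun z : R => sigma^-1 * z) @^-1` A i).
  by rewrite -[X in measurable X]setTI; apply: measurable_funM.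
transitivity (P [set w | forall i, ((fun z => sigma^-1 * z) @^-1` A i)
    ((Y w - X *m beta) i 0)]).
  by congr (P _); apply/seteqP; split => w /= H i; have := H i; rewrite /= !mxE.
rewrite (boxE (fun i => (fun z => sigma^-1 * z) @^-1` A i) mpre).
by apply: eq_bigr => i _; exact: normal_prob_std.
Qed.

End StandardizedErrors.

(** Allows the measure [P beta sigma], which changes with the parameter, to be replaced by one
    reference law. *)
Lemma std_gauss_unique (R : realType) n (m1 m2 : probability (rvec R n) R) A :
  std_gauss m1 -> std_gauss m2 -> measurable A -> m1 A = m2 A.
Proof.
move=> g1 g2; apply: rvec_measure_unique; last first.
  by rewrite (le_lt_trans (probability_le1 _ measurableT))// ltry.
by move=> B mB; rewrite g1// g2.
Qed.

(** * Selection rules and coverage *)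

Section Selection.
Context {R : realType} {n p : nat}.
Variable X : 'M[R]_(n, p).
Hypotheses (rX : row_free X^T) (pn : (p < n)%N).
Variables (q : nat) (l : 'I_p) (Ktilde : 'cV[R]_n -> {set 'I_p}) (d : R).
Hypotheses (ql : (q <= l)%N).
Notation m := (n - p)%N.
Notation bhat j y := (lse X finset.set0 y j 0).
Notation rss y := (RSS X finset.set0 y).
Notation G := (gram_inv X).

(* The features of the four selection rules on which the bound depends. *)
Definition well_behaved_selection := 0 <= d /\
  exists C : R, forall y, 0 < rss y ->
  [/\ Ktilde y \subset droppable q,
      forall j, j \in Ktilde y -> bhat j y ^+ 2 <= C * rss y,
      Ktilde y = finset.set0 -> d ^+ 2 * (rss y / m%:R) <= bhat l y ^+ 2 / G l l
    & Ktilde y = [set l]%SET -> bhat l y ^+ 2 / G l l <= d ^+ 2 * (rss y / m%:R)].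

Let m0 : 0 < m%:R :> R. Proof. by rewrite ltr0n subn_gt0. Qed.

Let l_droppable : [set l]%SET \subset droppable q.
Proof. by rewrite finset.sub1set inE. Qed.

Let cards_natr (K : {set 'I_p}) : (p - #|K|)%:R = p%:R - #|K|%:R :> R.
Proof. by rewrite natrB// -[leqRHS]card_ord max_card. Qed.

Let card_le (K : {set 'I_p}) : #|K|%:R <= p%:R :> R.
Proof. by rewrite ler_nat -[leqRHS]card_ord max_card. Qed.

(** If [j] is dropped, monotonicity gives RSS_{j} <= RSS_K <= (1 + C) RSS, and RSS_{j} - RSS is
    betahat_j^2 / G_jj. Summing the diagonal of G makes the constant uniform in [j]. The last two
    conditions compare the empty set with {l}. *)
Lemma criterion_selection (C : R) : 0 <= d -> 0 <= C ->
  (forall y, 0 < rss y ->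
   [/\ Ktilde y \subset droppable q,
       RSS X (Ktilde y) y <= (1 + C) * rss y,
       Ktilde y = finset.set0 -> (1 + d ^+ 2 / m%:R) * rss y <= RSS X [set l]%SET y
     & Ktilde y = [set l]%SET -> RSS X [set l]%SET y <= (1 + d ^+ 2 / m%:R) * rss y]) ->
  well_behaved_selection.
Proof.
move=> d0 C0 H; split => //; exists (C * \sum_j G j j) => y ry.
have [Kd KC K0 Kl] := H y ry.
have dmE : d ^+ 2 / m%:R * rss y = d ^+ 2 * (rss y / m%:R).
  by rewrite mulrAC mulrA.
split => //.
- move=> j jK.
  have Gj : G j j <= \sum_j G j j.
    rewrite (bigD1 j)//= lerDl sumr_ge0// => k _; apply: ltW.
    exact: gram_inv_diag_gt0.
  have : RSS X [set j]%SET y <= RSS X (Ktilde y) y.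
    by apply: RSS_mono => //; rewrite finset.sub1set.
  rewrite (RSS_set1 rX) => /le_trans /(_ KC).
  rewrite mulrDl mul1r lerD2l ler_pdivrMr ?gram_inv_diag_gt0// => H1.
  apply: (le_trans H1); rewrite mulrAC ler_wpM2r ?(ltW ry)//.
  by rewrite ler_wpM2l.
- move=> /K0; rewrite (RSS_set1 rX) mulrDl mul1r lerD2l.
  by rewrite dmE.
- move=> /Kl; rewrite (RSS_set1 rX) mulrDl mul1r lerD2l.
  by rewrite dmE.
Qed.

(** The criterion takes equal values at the empty set and {l} when RSS_{l} / RSS = exp(2 f / n), and
    [d] makes this ratio 1 + d^2/(n - p). Comparing with the empty set bounds RSS_K / RSS by exp(2 p
    f / n). *)
Lemma case1_selection : case1 X q Ktilde d -> well_behaved_selection.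
Proof.
move=> [f [ff minK dE]].
have n0 : 0 < n%:R :> R by rewrite ltr0n (leq_ltn_trans _ pn).
have f0 : 0 <= f.
  case: ff => ->; first exact: ler01.
  by rewrite divr_ge0// ln_ge0// ler1n (leq_ltn_trans _ pn).
have e0 x : 0 <= x -> 0 <= expR (x / n%:R) - 1.
  by move=> x0; rewrite subr_ge0 -expR0 ler_expR divr_ge0// ltW.
have d2 : 1 + d ^+ 2 / m%:R = expR (2 * f / n%:R).
  rewrite dE sqr_sqrtr ?mulfK ?gt_eqF//; first by rewrite addrC subrK.
  by rewrite mulr_ge0 ?(ltW m0)// e0// mulr_ge0.
have key y (K1 K2 : {set 'I_p}) : 0 < RSS X K1 y -> 0 < RSS X K2 y ->
    AIC X f y K1 <= AIC X f y K2 ->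
    RSS X K1 y <= expR (2 * (#|K1|%:R - #|K2|%:R) * f / n%:R) * RSS X K2 y.
  move=> r1 r2; rewrite /AIC !cards_natr => H.
  rewrite -[leLHS]lnK ?posrE// -[X in _ * X]lnK ?posrE// -expRD ler_expR.
  rewrite -(ler_pM2l n0) mulrDr mulrCA mulfV ?gt_eqF// mulr1.
  by lra.
have rK y K : 0 < rss y -> 0 < RSS X K y.
  by move=> r; rewrite (lt_le_trans r)// RSS_mono// finset.sub0set.
apply: (@criterion_selection (expR (2 * p%:R * f / n%:R) - 1)).
- by rewrite dE sqrtr_ge0.
- by rewrite e0// !mulr_ge0.
move=> y ry; have [Kd Kmin] := minK y ry; split => //.
- have := key y _ _ (rK y _ ry) ry (Kmin finset.set0 (finset.sub0set _)).
  move=> /le_trans; apply; rewrite [1 + _]addrC subrK ler_wpM2r ?(ltW ry)//.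
  rewrite ler_expR ler_wpM2r ?invr_ge0 ?(ltW n0)// ler_wpM2r//.
  by rewrite ler_wpM2l// cards0 subr0.
- move=> K0; have := Kmin _ l_droppable; rewrite K0.
  move=> /(key y _ _ ry (rK y _ ry)).
  rewrite cards0 cards1 sub0r mulrN1 mulNr mulNr expRN.
  by rewrite ler_pdivlMl ?expR_gt0// d2.
- move=> Kl; have := Kmin _ (finset.sub0set _); rewrite Kl.
  move=> /(key y _ _ (rK y _ ry) ry).
  by rewrite cards0 cards1 subr0 mulr1 d2.
Qed.

(** C_K agrees on the empty set and {l} when RSS_{l} - RSS = 2 RSS/(n - p), hence d^2 = 2. *)
Lemma case2_selection : case2 X q Ktilde d -> well_behaved_selection.
Proof.
move=> [minK dE].
have key y (K1 K2 : {set 'I_p}) : 0 < rss y -> Cp X y K1 <= Cp X y K2 ->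
    RSS X K1 y <= RSS X K2 y + 2 * (#|K1|%:R - #|K2|%:R) * (rss y / m%:R).
  move=> ry; have s0 : 0 < rss y / m%:R by rewrite divr_gt0.
  rewrite /Cp !cards_natr => H.
  rewrite -[leLHS](divfK (lt0r_neq0 s0)) -[X in X + _](divfK (lt0r_neq0 s0)).
  by rewrite -mulrDl ler_wpM2r ?(ltW s0)//; lra.
have d2 : d ^+ 2 = 2 by rewrite dE sqr_sqrtr.
apply: (@criterion_selection (2 * p%:R / m%:R)).
- by rewrite dE sqrtr_ge0.
- by rewrite divr_ge0 ?mulr_ge0// ltW.
move=> y ry; have [Kd Kmin] := minK y ry.
have ryE : (1 + 2 / m%:R) * rss y = rss y + 2 * (rss y / m%:R).
  by field; rewrite gt_eqF.
split => //.
- have := key y _ _ ry (Kmin finset.set0 (finset.sub0set _)).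
  move=> /le_trans; apply; rewrite [leRHS]mulrDl mul1r lerD2l.
  rewrite [leRHS]mulrAC mulrA ler_wpM2r ?invr_ge0 ?(ltW m0)// ler_wpM2r ?(ltW ry)//.
  by rewrite ler_wpM2l// cards0 subr0.
- move=> K0; have := Kmin _ l_droppable; rewrite K0 => /(key y _ _ ry).
  rewrite cards0 cards1 sub0r mulrN1 d2 mulNr lerBrDr => /(le_trans _); apply.
  by rewrite ryE.
- move=> Kl; have := Kmin _ (finset.sub0set _); rewrite Kl => /(key y _ _ ry).
  rewrite cards0 cards1 subr0 mulr1 d2 => /le_trans; apply.
  by rewrite ryE.
Qed.

(** Equality of B_K on the empty set and {l} means RSS_{l} / RSS = (m + 1)/m = 1 + 1/m, hence d =
    1. *)
Lemma case3_selection : case3 X q Ktilde d -> well_behaved_selection.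
Proof.
move=> [minK dE].
have mK (K : {set 'I_p}) : 0 < (m + #|K|)%:R :> R by rewrite ltr0n addn_gt0 subn_gt0 pn.
have key y (K1 K2 : {set 'I_p}) : Bcrit X y K1 <= Bcrit X y K2 ->
    RSS X K1 y <= (m + #|K1|)%:R / (m + #|K2|)%:R * RSS X K2 y.
  by rewrite /Bcrit ler_pdivrMr// mulrAC [_ / _ * _]mulrAC [RSS X K2 y * _]mulrC.
apply: (@criterion_selection (p%:R / m%:R)).
- by rewrite dE.
- by rewrite divr_ge0// ltW.
move=> y ry; have [Kd Kmin] := minK y ry; split => //.
- have := key y _ _ (Kmin finset.set0 (finset.sub0set _)).
  move=> /le_trans; apply; rewrite cards0 addn0 ler_wpM2r ?(ltW ry)//.
  by rewrite natrD mulrDl divff ?gt_eqF// lerD2l ler_wpM2r ?invr_ge0 ?(ltW m0).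
- move=> K0; have := Kmin _ l_droppable; rewrite K0 => /key.
  rewrite cards0 cards1 addn0 dE expr1n.
  have -> : 1 + 1 / m%:R = (m + 1)%:R / m%:R :> R.
    by rewrite natrD mulrDl divff ?gt_eqF.
  by rewrite -[X in X * rss y]invf_div ler_pdivrMl// divr_gt0// ltr0n addn1.
- move=> Kl; have := Kmin _ (finset.sub0set _); rewrite Kl => /key.
  rewrite cards0 cards1 addn0 dE expr1n natrD mulrDl divff ?gt_eqF//.
Qed.

(** Acceptance of [j] reads betahat_j^2 / G_jj < c_j^2 RSS/(n - p); the sum over all indices gives
    one constant. *)
Lemma case4_selection : case4 X q l Ktilde d -> well_behaved_selection.
Proof.
move=> [c [c0 accK dE]].
have ld : l \in droppable q by rewrite inE.
split; first by rewrite dE ltW// c0.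
exists (\sum_j c j ^+ 2 * G j j / m%:R) => y ry.
have s0 : 0 < rss y / m%:R by rewrite divr_gt0.
have T2 j : tstat X j y ^+ 2 = bhat j y ^+ 2 / G j j / (rss y / m%:R).
  rewrite /tstat expr_div_n exprMn !sqr_sqrtr ?(ltW s0)//.
    by rewrite invfM mulrA mulrAC.
  exact: (ltW (gram_inv_diag_gt0 rX j)).
have Tlt j : j \in droppable q -> (`|tstat X j y| < c j) =
    (bhat j y ^+ 2 / G j j < c j ^+ 2 * (rss y / m%:R)).
  move=> jd; rewrite -ltr_pdivrMr// -T2 -[X in _ = (X < _)]real_normK ?num_real//.
  by rewrite ltr_pXn2r// ?nnegrE// ltW// c0.
rewrite (accK y ry); split.
- by apply/fintype.subsetP => j; rewrite inE => /andP[].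
- move=> j; rewrite inE => /andP[jd]; rewrite Tlt// => H.
  have {H} : bhat j y ^+ 2 <= c j ^+ 2 * G j j / m%:R * rss y.
    move: (ltW H); rewrite ler_pdivrMr ?gram_inv_diag_gt0// => /le_trans; apply.
    by rewrite le_eqVlt; apply/orP; left; apply/eqP; field; rewrite gt_eqF.
  move=> /le_trans; apply; rewrite ler_wpM2r ?(ltW ry)//.
  rewrite (bigD1 j)//= lerDl sumr_ge0// => k _.
  by rewrite divr_ge0 ?(ltW m0)// mulr_ge0 ?sqr_ge0// ltW// gram_inv_diag_gt0.
- move=> K0; have : l \notin [set j in droppable q | `|tstat X j y| < c j]%SET.
    by rewrite K0 inE.
  by rewrite inE ld /= Tlt// -leNgt dE.
- move=> Kl; have : l \in [set j in droppable q | `|tstat X j y| < c j]%SET.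
    by rewrite Kl inE.
  by rewrite inE ld /= Tlt// dE => /ltW.
Qed.

End Selection.

(** * The naive interval in standardized coordinates *)

Section NaiveInterval.
Context {R : realType} {n p : nat}.
Variable X : 'M[R]_(n, p).
Hypotheses (rX : row_free X^T) (pn : (p < n)%N).
Variables (a : 'cV[R]_p) (l : 'I_p) (alpha sigma gamma : R) (v : {set 'I_p} -> R).
Hypotheses (a_neq0 : a != 0) (sigma_gt0 : 0 < sigma).
Notation m := (n - p)%N.
Notation G := (gram_inv X).
Notation ell := (lse_coord_vec X).
Notation W := (resid_scale X).
Let v11 := dotv (ell a) (ell a).
Let v22 := dotv (ell (delta_mx l 0)) (ell (delta_mx l 0)).

(** Coefficients rather than the unit vector itself, so that membership in the column space, on
    which the invariance of W rests, is built in. *)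
Definition unit_coef (b : 'cV[R]_p) : 'cV[R]_p :=
  (Num.sqrt (dotv (ell b) (ell b)))^-1 *: (G *m b).

Lemma unit_coefE b : X *m unit_coef b = (Num.sqrt (dotv (ell b) (ell b)))^-1 *: ell b.
Proof. by rewrite /unit_coef -scalemxAr. Qed.

Let c1 := unit_coef a.
Let c2 := unit_coef (delta_mx l 0).
Let rho := dotv (X *m c1) (X *m c2).

Let v11_gt0 : 0 < v11. Proof. exact: lse_coord_vec_gt0. Qed.
Let v22_gt0 : 0 < v22. Proof. by rewrite /v22 -gram_inv_diag// gram_inv_diag_gt0. Qed.

Lemma dotv_unit_coef b : b != 0 -> dotv (X *m unit_coef b) (X *m unit_coef b) = 1.
Proof.
move=> b0; have l0 := lse_coord_vec_gt0 rX b0.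
rewrite unit_coefE dotvZl dotvZr mulrA -invfM -expr2 sqr_sqrtr ?ltW//.
by rewrite mulVf// gt_eqF.
Qed.

Let sv11 : 0 < Num.sqrt v11. Proof. by rewrite sqrtr_gt0. Qed.
Let sv22 : 0 < Num.sqrt v22. Proof. by rewrite sqrtr_gt0. Qed.

Let v22E : v22 = Num.sqrt v22 ^+ 2. Proof. by rewrite sqr_sqrtr// ltW. Qed.

Lemma dotv_ell_unit b x : b != 0 ->
  dotv (ell b) x = Num.sqrt (dotv (ell b) (ell b)) * dotv (X *m unit_coef b) x.
Proof.
move=> b0; rewrite unit_coefE dotvZl mulrA divff ?mul1r// gt_eqF//.
by rewrite sqrtr_gt0 lse_coord_vec_gt0.
Qed.

(* The coefficient vector of [a^T lse_{l}] as a linear functional of [Y]. *)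
Definition restricted_vec : 'cV[R]_n :=
  Num.sqrt v11 *: (X *m (c1 - rho *: c2)).

Lemma dotv_lse_set1 y : dotv a (lse X [set l]%SET y) = dotv restricted_vec y.
Proof.
have [_ ->] := lse_set1_spec rX y l.
rewrite dotvDr dotvNr dotvZr dotv_lse_set0// lse_set0_coord//.
have -> : dotv a (G *m delta_mx l 0) = Num.sqrt v11 * Num.sqrt v22 * rho.
  rewrite -dotv_lse_coord_vec// /rho !unit_coefE dotvZl dotvZr.
  by rewrite -/v11 -/v22; field; rewrite !gt_eqF.
rewrite gram_inv_diag// -/v22 (dotv_ell_unit _ a_neq0) -/v11 -/c1.
rewrite (dotv_ell_unit _ (delta_neq0 l)) -/v22 -/c2 [X in _ / X]v22E.
rewrite /restricted_vec dotvZl mulmxBr [X *m (rho *: c2)](_ : _ = rho *: (X *m c2)).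
  by rewrite dotvDl dotvNl dotvZl; field; rewrite gt_eqF.
by rewrite -scalemxAr.
Qed.

Lemma sqr_restricted_vec :
  dotv restricted_vec restricted_vec = v11 * (1 - rho ^+ 2).
Proof.
rewrite /restricted_vec dotvZl dotvZr sqr_residual_direction.
- by rewrite mulrA -expr2 sqr_sqrtr// ltW.
- exact: dotv_unit_coef.
- by apply: dotv_unit_coef; exact: delta_neq0.
Qed.

Hypotheses (v_set0 : v finset.set0 = v11) (v_set1 : v [set l]%SET = v11 * (1 - rho ^+ 2)).
Variable beta : 'cV[R]_p.
Hypothesis beta_l : beta l 0 = gamma * (sigma * Num.sqrt v22).
Notation z1 x := (dotv (X *m c1) x).
Notation z2 x := (dotv (X *m c2) x).
Notation hh x := (z2 x + gamma).

Lemma lse_set0_model b x : b != 0 ->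
  dotv b (lse X finset.set0 (X *m beta + sigma *: x)) =
  dotv b beta + sigma * (Num.sqrt (dotv (ell b) (ell b)) * dotv (X *m unit_coef b) x).
Proof.
move=> b0; rewrite lse_set0_affine// dotvDr dotvZr dotv_lse_set0//.
by rewrite dotv_ell_unit.
Qed.

Lemma bhat_model x :
  lse X finset.set0 (X *m beta + sigma *: x) l 0 = sigma * Num.sqrt v22 * hh x.
Proof.
rewrite -dotv_delta lse_set0_model ?delta_neq0// dotv_delta beta_l -/v22 -/c2.
by ring.
Qed.

Lemma Sres_set0_model x :
  Sres X finset.set0 (X *m beta + sigma *: x) = sigma * W x.
Proof.
rewrite /Sres cards0 addn0 RSS_set0_affine// -mulrA sqrtrM ?sqr_ge0//.
by rewrite sqrtr_sqr gtr0_norm.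
Qed.

Lemma Sres_set1_model x :
  Sres X [set l]%SET (X *m beta + sigma *: x) =
  sigma * Num.sqrt ((m%:R * W x ^+ 2 + hh x ^+ 2) / m.+1%:R).
Proof.
have d0 : 0 < m%:R :> R by exact: dof_gt0.
rewrite /Sres cards1 addn1 (RSS_set1 rX) bhat_model gram_inv_diag// -/v22.
rewrite RSS_set0_affine// -[in RHS](gtr0_norm sigma_gt0) -sqrtr_sqr -sqrtrM ?sqr_ge0//.
congr Num.sqrt; rewrite mulrA; congr (_ / _).
rewrite sqr_resid_scale// !exprMn sqr_sqrtr ?(ltW v22_gt0)//.
by field; rewrite !gt_eqF.
Qed.

(** Division by sigma sqrt(v11). For an upper bound on coverage this implication alone is needed. *)
Lemma naive_ci_set0 x :
  dotv a beta \in naive_ci X a alpha v finset.set0 (X *m beta + sigma *: x) ->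
  `|z1 x| <= tquantile alpha m * W x.
Proof.
rewrite /naive_ci cards0 addn0 Sres_set0_model v_set0 in_itv /=.
rewrite lse_set0_model// -/v11 -/c1 => /andP[H1 H2].
have s0 : 0 < sigma * Num.sqrt v11 by rewrite mulr_gt0.
by rewrite ler_norml; apply/andP; split; rewrite -(ler_pM2l s0); lra.
Qed.

(** The restricted estimator has error sigma sqrt(v11) (z1 - rho h), in which h carries the bias
    from wrongly setting beta_l to 0. Dropping [l] also raises RSS / sigma^2 from m W^2 to m W^2 +
    h^2. *)
Lemma naive_ci_set1 x :
  dotv a beta \in naive_ci X a alpha v [set l]%SET (X *m beta + sigma *: x) ->
  ell2 alpha m (hh x) (W x) rho <= z1 x <= u2 alpha m (hh x) (W x) rho.
Proof.
have r2 : 0 <= 1 - rho ^+ 2.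
  by apply: sqr_rho_le1; apply: dotv_unit_coef => //; exact: delta_neq0.
rewrite /naive_ci cards1 addn1 Sres_set1_model v_set1 in_itv /=.
have -> : dotv a (lse X [set l]%SET (X *m beta + sigma *: x)) =
    dotv a beta + sigma * Num.sqrt v11 * (z1 x - rho * hh x).
  have [_ ->] := lse_set1_spec rX (X *m beta + sigma *: x) l.
  rewrite dotvDr dotvNr dotvZr lse_set0_model// bhat_model gram_inv_diag// -/v22.
  have -> : dotv a (G *m delta_mx l 0) = Num.sqrt v11 * Num.sqrt v22 * rho.
    rewrite -dotv_lse_coord_vec// /rho !unit_coefE dotvZl dotvZr.
    by rewrite -/v11 -/v22; field; rewrite !gt_eqF.
  rewrite [X in _ / X]v22E -/v11 -/c1.
  by field; rewrite gt_eqF.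
rewrite [Num.sqrt (v11 * _)]sqrtrM ?(ltW v11_gt0)// => /andP[H1 H2].
have s0 : 0 < sigma * Num.sqrt v11 by rewrite mulr_gt0.
by rewrite /ell2 /u2 /halfwidth2; apply/andP; split; rewrite -(ler_pM2l s0); lra.
Qed.

End NaiveInterval.

Section NullAndTailEvents.
Context {R : realType} {n : nat}.
Variable mu : probability (rvec R n) R.
Notation leb := (@lebesgue_measure R).
Notation phi := (@normal_pdf R 0 1).

(** For W fixed, a tie leaves at most two values for the normal coordinate. *)
Lemma tie_null p (X : 'M[R]_(n, p)) (c : 'cV[R]_p) (gamma d : R) :
  row_free X^T -> std_gauss mu -> dotv (X *m c) (X *m c) = 1 ->
  mu [set x | `|dotv (X *m c) x + gamma| == d * resid_scale X x] = 0%E.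
Proof.
move=> rX gmu u22; have mW := measurable_resid_scale rX.
have mb2 : measurable_fun setT (fun zw : R * R => `|zw.1 + gamma| == d * zw.2).
  apply: measurable_fun_eqr; last exact: measurable_funM.
  by apply: measurableT_comp => //; exact: measurable_funD.
rewrite measure_set_bool; last first.
  apply: measurable_fun_eqr; last exact: measurable_funM.
  apply: measurableT_comp => //; apply: measurable_funD => //.
  exact: measurable_dotv.
pose g (zw : R * R) := ((`|zw.1 + gamma| == d * zw.2)%:R : R)%:E.
have mg : measurable_fun setT g.
  by apply/measurable_EFinP; exact: measurable_fun_natb.
have g0 zw : (0 <= g zw)%E by rewrite lee_fin.
transitivity (\int[mu]_x g (dotv (X *m c) x, resid_scale X x))%E; first by [].
rewrite (integral_joint_z2 rX gmu u22 mg g0).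
apply: integral0_eq => x _.
set w := resid_scale X x.
transitivity (\int[leb]_z cst 0%E z)%E; last by rewrite integral_cst// mul0e.
apply: ge0_ae_eq_integral => //.
- apply: emeasurable_funM; last exact: measurable_phiE.
  exact: (measurable_fun_pair1 w mg).
- by move=> z _; rewrite mule_ge0// lee_fin normal_pdf_ge0.
- exists [set d * w - gamma; - (d * w) - gamma]; split.
  + by apply: measurableU; exact: measurable_set1.
  + apply: countable_lebesgue_measure0; apply: finite_set_countable.
    exact: finite_set2.
  + move=> z /= nz; apply: contrapT => /not_orP[z1 z2]; apply: nz => _.
    rewrite /g /=; case: eqP => [zE|_]; last by rewrite mul0e.
    exfalso; move: zE; case: (ler0P (z + gamma)) => _ zE.
      by apply: z2; rewrite -zE opprK addrK.
    by apply: z1; rewrite -zE addrK.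
Qed.

Lemma tail_cvg0 (Q : rvec R n -> R) : measurable_fun setT Q ->
  (fun M => mu [set x | M%:R <= Q x]) @ \oo --> 0%E.
Proof.
move=> mQ; pose F M := [set x : rvec R n | M%:R <= Q x].
have mF M : measurable (F M) by apply: measurable_set_bool; exact: measurable_fun_ler.
have F0 : \bigcap_M F M = set0.
  apply/seteqP; split => x //= H.
  have := H (Num.truncn (Q x)).+1 I.
  by rewrite /F /= leNgt truncnS_gt.
rewrite -[X in _ --> X](measure0 mu) -F0; apply: nonincreasing_cvg_mu => //.
- by rewrite (le_lt_trans (probability_le1 _ (mF _)))// ltry.
- by rewrite F0.
- move=> M N MN; rewrite subsetEset => x /=; apply: le_trans.
  by rewrite ler_nat.
Qed.

End NullAndTailEvents.

(** * Least favourable parameters *)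

Section LeastFavourable.
Context {R : realType} {n p : nat}.
Variable X : 'M[R]_(n, p).
Hypotheses (rX : row_free X^T) (pn : (p < n)%N).
Variables (a : 'cV[R]_p) (l : 'I_p) (alpha sigma gamma d C : R).
Variables (v : {set 'I_p} -> R) (q : nat) (Ktilde : 'cV[R]_n -> {set 'I_p}).
Hypotheses (a_neq0 : a != 0) (sigma_gt0 : 0 < sigma).
Notation m := (n - p)%N.
Notation G := (gram_inv X).
Notation ell := (lse_coord_vec X).
Notation W := (resid_scale X).
Notation rss y := (RSS X finset.set0 y).
Notation bhat j y := (lse X finset.set0 y j 0).
Let v11 := dotv (ell a) (ell a).
Let v22 := dotv (ell (delta_mx l 0)) (ell (delta_mx l 0)).
Let c1 := unit_coef X a.
Let c2 := unit_coef X (delta_mx l 0).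
Let rho := dotv (X *m c1) (X *m c2).
Notation hh x := (dotv (X *m c2) x + gamma).
Hypotheses (v_set0 : v finset.set0 = v11)
  (v_set1 : v [set l]%SET = v11 * (1 - rho ^+ 2)).
Hypotheses (d_ge0 : 0 <= d)
  (selection : forall y, 0 < rss y ->
    [/\ Ktilde y \subset droppable q,
        forall j, j \in Ktilde y -> bhat j y ^+ 2 <= C * rss y,
        Ktilde y = finset.set0 -> d ^+ 2 * (rss y / m%:R) <= bhat l y ^+ 2 / G l l
      & Ktilde y = [set l]%SET -> bhat l y ^+ 2 / G l l <= d ^+ 2 * (rss y / m%:R)]).

(* With [M] large, every set chosen by the selection is either empty or
   [{l}]. *)
Definition lfc_beta (M : nat) : 'cV[R]_p :=
  \col_j (if j == l then gamma * (sigma * Num.sqrt v22) else M%:R).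

(** If some j other than l is dropped, then (M + sigma betahat_j(x))^2 <= C sigma^2 RSS(x), which
    forces M below this quantity. The sum serves all [j] at once, and the absolute value covers an
    unknown sign of [C]. *)
Definition excursion (x : rvec R n) : R :=
  sigma * (\sum_j `|bhat j x| + Num.sqrt (`|C| * rss x)).

Lemma measurable_excursion : measurable_fun setT excursion.
Proof.
apply: measurable_funM => //; apply: measurable_funD.
  apply: measurable_sum => j; apply: measurableT_comp => //.
  exact: measurable_lse.
apply: (measurableT_comp measurable_sqrt); apply: measurable_funM => //.
exact: measurable_RSS.
Qed.

(** Either the selected set lies within {l}, and the comparison of h with d W decides which interval
    is used, or another index is dropped and [M] is small. *)
Lemma covering_cases M x : 0 < rss x ->
  let y := X *m lfc_beta M + sigma *: x in
  dotv a (lfc_beta M) \in naive_ci X a alpha v (Ktilde y) y ->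
  [\/ ideal_coverage X c1 c2 alpha gamma d x, `|hh x| == d * W x
    | M%:R <= excursion x].
Proof.
move=> rx0 y; have ryE : rss y = sigma ^+ 2 * rss x by rewrite RSS_set0_affine.
have ry : 0 < rss y by rewrite ryE mulr_gt0// exprn_gt0.
have beta_l : lfc_beta M l 0 = gamma * (sigma * Num.sqrt v22) by rewrite mxE eqxx.
have v22_gt0 : 0 < v22 by rewrite /v22 -gram_inv_diag// gram_inv_diag_gt0.
have tE : bhat l y ^+ 2 / G l l = sigma ^+ 2 * hh x ^+ 2.
  rewrite (bhat_model rX beta_l) gram_inv_diag// !exprMn sqr_sqrtr ?(ltW v22_gt0)//.
  by field; rewrite gt_eqF.
have wE : d ^+ 2 * (rss y / m%:R) = sigma ^+ 2 * (d * W x) ^+ 2.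
  by rewrite exprMn sqr_resid_scale ryE; ring.
have dW0 : 0 <= d * W x by rewrite mulr_ge0// resid_scale_ge0.
have s2 : 0 < sigma ^+ 2 by rewrite exprn_gt0.
have [_ KC K0 K1] := selection ry.
have [sub|/subsetPn[j jK]] := boolP (Ktilde y \subset [set l]%SET).
  move: sub; rewrite finset.subset1 => /orP[]/eqP KE.
    have := K1 KE; rewrite tE wE ler_pM2l// -[hh x ^+ 2]real_normK ?num_real//.
    rewrite ler_pXn2r ?nnegrE// => hd; rewrite KE => cov.
    apply: Or31; rewrite /ideal_coverage /= hd.
    exact: (naive_ci_set1 rX pn a_neq0 sigma_gt0 v_set1 beta_l cov).
  have := K0 KE; rewrite tE wE ler_pM2l// -[hh x ^+ 2]real_normK ?num_real//.
  (* On the boundary |h| = d W the rule may keep [l] although [ideal_coverage] treats it as dropped;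
     this case goes to the tie alternative. *)
  rewrite ler_pXn2r ?nnegrE// le_eqVlt => /predU1P[->|hd].
    by move=> _; apply: Or32.
  rewrite KE => cov; apply: Or31; rewrite /ideal_coverage /= leNgt hd /=.
  exact: (naive_ci_set0 rX a_neq0 sigma_gt0 v_set0 cov).
rewrite finset.in_set1 => jl _; apply: Or33.
have := KC j jK; rewrite lse_set0_affine// !mxE (negbTE jl) ryE.
set b := bhat j x; set t := Num.sqrt (`|C| * rss x) => H.
have t0 : 0 <= t by exact: sqrtr_ge0.
have t2 : t ^+ 2 = `|C| * rss x by rewrite sqr_sqrtr// mulr_ge0// ltW.
have : `|M%:R + sigma * b| <= sigma * t.
  rewrite -(ler_pXn2r (n := 2))// ?nnegrE ?mulr_ge0// ?(ltW sigma_gt0)//.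
  rewrite real_normK ?num_real// (le_trans H)// exprMn t2 mulrCA.
  by rewrite ler_wpM2l ?(ltW s2)// ler_wpM2r ?ler_norm// ltW.
have bS : `|b| <= \sum_j `|bhat j x|.
  by rewrite (bigD1 j)//= lerDl sumr_ge0.
rewrite ler_norml => /andP[_ Mt].
have : - (sigma * b) <= sigma * `|b| by rewrite -mulrN ler_pM2l// lerNl lerNnormlW.
have : sigma * `|b| <= sigma * \sum_j `|bhat j x| by rewrite ler_pM2l.
rewrite /excursion mulrDr -/t; lra.
Qed.

End LeastFavourable.

Section NaiveIntervalMeasurable.
Context {R : realType} {n p : nat} d (Om : measurableType d).
Variable X : 'M[R]_(n, p).
Hypothesis rX : row_free X^T.
Variables (a : 'cV[R]_p) (alpha theta : R) (v : {set 'I_p} -> R).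
Variables (Y : Om -> 'cV[R]_n) (Ktilde : 'cV[R]_n -> {set 'I_p}).
Hypotheses (mY : forall i, measurable_fun [set: Om] (fun w => Y w i 0))
  (mK : forall K, measurable [set w | Ktilde (Y w) = K]).

Lemma measurable_naive_covering :
  measurable [set w | theta \in naive_ci X a alpha v (Ktilde (Y w)) (Y w)].
Proof.
have mYr : measurable_fun setT (Y : Om -> rvec R n) by exact: measurable_fun_rvec.
rewrite (_ : [set w | _] = \bigcup_(K in [set: {set 'I_p}])
    ([set w | Ktilde (Y w) = K] `&` [set w | theta \in naive_ci X a alpha v K (Y w)])).
  apply: fin_bigcup_measurable; first exact: finite_finset.
  move=> K _; apply: measurableI => //; apply: measurable_set_bool.
  pose dK y := tquantile alpha (n - p + #|K|) * Sres X K y * Num.sqrt (v K).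
  rewrite (_ : (fun w => _) = fun w => dotv a (lse X K (Y w)) - dK (Y w) <= theta
      <= dotv a (lse X K (Y w)) + dK (Y w)); last first.
    by apply/funext => w; rewrite /naive_ci in_itv.
  have mlse := measurableT_comp (measurable_dotv_lse rX K a) mYr.
  have mdK : measurable_fun setT (fun w => dK (Y w)).
    apply: measurable_funM => //; apply: measurable_funM => //.
    apply: (measurableT_comp measurable_sqrt); apply: measurable_funM => //.
    exact: (measurableT_comp (measurable_RSS rX K) mYr).
  apply: measurable_and; apply: measurable_fun_ler => //.
    exact: measurable_funB.
  exact: measurable_funD.
apply/seteqP; split => [w /= H|w [K _ [/= <-]]//].
by exists (Ktilde (Y w)).
Qed.

End NaiveIntervalMeasurable.

(* [P beta sigma] is the law on the sample space when the true values are
   [beta], [sigma]; Var(.)/sigma^2, Corr and the law of W do not depend on these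
   values, and are taken at an arbitrary [(beta0, sigma0)].
   [l] is the last index (p in 1-based numbering). *)
Theorem corollary1 (R : realType) (n p q : nat) (X : 'M[R]_(n, p))
  (a : 'cV[R]_p) (alpha : R)
  (disp : measure_display) (Om : measurableType disp)
  (P : 'cV[R]_p -> R -> probability Om R) (Y : Om -> 'cV[R]_n)
  (l : 'I_p) (beta0 : 'cV[R]_p) (sigma0 : R)
  (Ktilde : 'cV[R]_n -> {set 'I_p}) (d : R) (fW : R -> R)
  (Thetahat := fun w => dotv a (lse X finset.set0 (Y w)))
  (betahat := fun (j : 'I_p) w => lse X finset.set0 (Y w) j 0)
  (v := fun K : {set 'I_p} =>
     fine (variance (P beta0 sigma0) (fun w => dotv a (lse X K (Y w))))
       / sigma0 ^+ 2)
  (rho := corr (P beta0 sigma0) Thetahat (betahat l))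
  (W := fun w => Num.sqrt (RSS X finset.set0 (Y w) / ((n - p)%:R * sigma0 ^+ 2))) :
  (p < n)%N -> row_free X^T -> a != 0 -> 0 < alpha < 1 ->
  (1 <= q < p)%N -> l.+1 = p ->
  (forall beta sigma, 0 < sigma ->
     normal_linear_model (P beta sigma) X beta sigma Y) ->
  0 < sigma0 ->
  (forall j, j \in droppable q ->
     `|corr (P beta0 sigma0) Thetahat (betahat j)| <= `|rho|) ->
  is_pdf_of (P beta0 sigma0) W fW ->
  (forall K, measurable [set w | Ktilde (Y w) = K]) ->
  [\/ case1 X q Ktilde d, case2 X q Ktilde d, case3 X q Ktilde d
    | case4 X q l Ktilde d] ->
  (ereal_inf [set P beta sigma
                [set w | (dotv a beta \in
                          naive_ci X a alpha v (Ktilde (Y w)) (Y w))%R]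
             | beta in [set: 'cV[R]_p] & sigma in [set s : R | 0 < s]%R]
   <= ereal_inf [set coverage_bound alpha (n - p) fW d rho gamma
                | gamma in [set g : R | 0 <= g]%R])%E.
Proof.
move=> pn rX a0 alpha01 /andP[_ qp] lp model s0 _ [mfW fW0 fWE] mK cases.
have ql : (q <= l)%N by rewrite -ltnS lp.
have [d0 [C sel]] : well_behaved_selection X q l Ktilde d.
  case: cases; [exact: case1_selection|exact: case2_selection|
    exact: case3_selection|exact: case4_selection].
have model0 := model beta0 sigma0 s0.
pose mu := law (P beta0 sigma0) (measurable_std_error model0).
have gmu : std_gauss mu := std_gauss_std_error model0 s0.
(* All estimators involved are linear in [Y], so this one formula evaluates v at the two relevant
   sets as well as [rho]. *)
have covY (c c' : 'cV[R]_n) : covariance (P beta0 sigma0)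
    (fun w => dotv c (Y w)) (fun w => dotv c' (Y w)) = (sigma0 ^+ 2 * dotv c c')%:E.
  rewrite -(covariance_affine gmu (dotv c (X *m beta0)) (dotv c' (X *m beta0))).
  by congr covariance; apply/funext => w; rewrite {1}(std_errorK X beta0 Y s0 w) dotvDr dotvZr.
have s0_neq0 : sigma0 != 0 by rewrite gt_eqF.
have s2 : sigma0 ^+ 2 != 0 by rewrite expf_neq0.
pose c1 := unit_coef X a; pose c2 := unit_coef X (delta_mx l 0).
have u11 : dotv (X *m c1) (X *m c1) = 1 by exact: dotv_unit_coef.
have u22 : dotv (X *m c2) (X *m c2) = 1.
  by apply: dotv_unit_coef => //; exact: delta_neq0.
have v_set0 : v finset.set0 = dotv (lse_coord_vec X a) (lse_coord_vec X a).
  rewrite /v /variance (_ : (fun w => _) = fun w => dotv (lse_coord_vec X a) (Y w)).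
    by rewrite covY /= mulrAC divff// mul1r.
  by apply/funext => w; rewrite dotv_lse_set0.
have v_set1 : v [set l]%SET = dotv (lse_coord_vec X a) (lse_coord_vec X a) *
    (1 - dotv (X *m c1) (X *m c2) ^+ 2).
  rewrite -sqr_restricted_vec//.
  rewrite /v /variance (_ : (fun w => _) = fun w => dotv (restricted_vec X a l) (Y w)).
    by rewrite covY /= mulrAC divff// mul1r.
  by apply/funext => w; rewrite dotv_lse_set1.
have rhoE : rho = dotv (X *m c1) (X *m c2).
  rewrite /rho /corr /variance.
  rewrite (_ : Thetahat = fun w => dotv (lse_coord_vec X a) (Y w)); last first.
    by apply/funext => w; rewrite /Thetahat dotv_lse_set0.
  rewrite (_ : betahat l = fun w => dotv (lse_coord_vec X (delta_mx l 0)) (Y w)); last first.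
    by apply/funext => w; rewrite /betahat lse_set0_coord.
  rewrite !covY /= !unit_coefE dotvZl dotvZr.
  set x := dotv _ _; set y := dotv _ _; set z := dotv _ _.
  have y0 : 0 < y by exact: lse_coord_vec_gt0.
  have z0 : 0 < z by apply: lse_coord_vec_gt0 => //; exact: delta_neq0.
  have -> : sigma0 ^+ 2 * y * (sigma0 ^+ 2 * z) = (sigma0 ^+ 2) ^+ 2 * (y * z) by ring.
  rewrite sqrtrM ?sqr_ge0// sqrtr_sqr ger0_norm ?sqr_ge0// sqrtrM ?(ltW y0)//.
  by field; rewrite s0_neq0 !gt_eqF ?sqrtr_gt0.
have fWmu A : measurable A ->
    (mu (resid_scale X @^-1` A) = \int[lebesgue_measure]_(x in A) (fW x)%:E)%E.
  (* Under (beta0, sigma0) the statistic [W] is [resid_scale] of the standardized error, so [fW] is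
     also its density under [mu]. *)
  move=> mA; rewrite -fWE// lawE; congr (P _ _ _); apply/seteqP.
  suff WE w : resid_scale X (std_error X beta0 sigma0 Y w) = W w.
    by split => w /=; rewrite WE.
  rewrite /W {1}(std_errorK X beta0 Y s0 w) RSS_set0_affine// /resid_scale.
  by congr Num.sqrt; field; rewrite s0_neq0 pnatr_eq0 -lt0n subn_gt0.
apply: le_ereal_inf_tmp => _ [gamma /= _ <-]; rewrite rhoE.
pose tail M := mu [set x | M%:R <= excursion X sigma0 C x].
(* A bound for each [M] suffices: the left side is free of [M], and the tail tends to 0. *)
suff boundM M : (ereal_inf [set P beta sigma
      [set w | (dotv a beta \in naive_ci X a alpha v (Ktilde (Y w)) (Y w))%R]
      | beta in [set: 'cV[R]_p] & sigma in [set s : R | 0 < s]%R] <=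
    coverage_bound alpha (n - p) fW d (dotv (X *m c1) (X *m c2)) gamma + tail M)%E.
  have cvg_bound : (fun M => coverage_bound alpha (n - p) fW d
      (dotv (X *m c1) (X *m c2)) gamma + tail M)%E @ \oo -->
      (coverage_bound alpha (n - p) fW d (dotv (X *m c1) (X *m c2)) gamma + 0)%E.
    apply: cvgeD; first exact: fin_num_adde_defl.
      exact: cvg_cst.
    by apply: tail_cvg0; exact: measurable_excursion.
  by rewrite adde0 in cvg_bound; apply: cvge_ge cvg_bound; exact: nearW.
pose beta := lfc_beta X l sigma0 gamma M.
have modelM := model beta sigma0 s0.
pose eps := std_error X beta sigma0 Y.
apply: (@le_trans _ _ (P beta sigma0
    [set w | (dotv a beta \in naive_ci X a alpha v (Ktilde (Y w)) (Y w))%R])).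
  by apply: ereal_inf_lbound; exists beta => //; exists sigma0.
pose E1 := ideal_coverage X c1 c2 alpha gamma d.
pose E2 := [set x : rvec R n | `|dotv (X *m c2) x + gamma| == d * resid_scale X x].
pose E3 := [set x : rvec R n | RSS X finset.set0 x = 0].
pose E4 := [set x : rvec R n | M%:R <= excursion X sigma0 C x].
have mE1 : measurable E1 by exact: measurable_ideal_coverage.
have mE2 : measurable E2.
  apply: measurable_set_bool; apply: measurable_fun_eqr; last first.
    exact: measurable_funM (measurable_resid_scale rX).
  by apply: measurableT_comp => //; apply: measurable_funD => //; exact: measurable_dotv.
have mE3 : measurable E3 by exact: measurable_RSS_eq0.
have mE4 : measurable E4.
  by apply: measurable_set_bool; apply: measurable_fun_ler => //; exact: measurable_excursion.
(* The three outcomes of [covering_cases], together with RSS = 0, where nothing is required of the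
   selection. *)
pose E := E1 `|` E2 `|` E3 `|` E4.
have mE : measurable E by do 3 apply: measurableU => //.
apply: (@le_trans _ _ (P beta sigma0 (eps @^-1` E))).
  apply: le_measure; rewrite ?inE.
  - by apply: measurable_naive_covering => //; case: modelM.
  - by rewrite -[X in measurable X]setTI; exact: (measurable_std_error modelM measurableT mE).
  move=> w /=; rewrite {1 2}(std_errorK X beta Y s0 w) -/eps => cov.
  have [x0|x0] := eqVneq (RSS X finset.set0 (eps w)) 0; first by left; right.
  have rx0 : 0 < RSS X finset.set0 (eps w) by rewrite lt_neqAle eq_sym x0 RSS_ge0.
  have := covering_cases rX pn a0 s0 v_set0 v_set1 d0 sel rx0 cov.
  by case=> H; [do 3 left|do 2 left; right|right].
rewrite -(lawE _ (measurable_std_error modelM)).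
(* [beta] changes with [M], but the standardized error is standard Gaussian under both
   [P beta sigma0] and [P beta0 sigma0]. *)
rewrite (std_gauss_unique (std_gauss_std_error modelM s0) gmu mE).
rewrite (le_trans (measureU2 _ _ _))//; first by do 2 apply: measurableU => //.
rewrite leeD2r//.
have E2_0 : mu E2 = 0%E := tie_null gamma d rX gmu u22.
have E3_0 : mu E3 = 0%E := RSS_eq0_null pn fWmu.
rewrite (le_trans (measureU2 _ _ _))//; first exact: measurableU.
rewrite [X in (_ + X)%E](_ : _ = 0%E) ?adde0// (le_trans (measureU2 _ _ _))//.
rewrite [X in (_ + X)%E](_ : _ = 0%E) ?adde0//.
exact: (ideal_coverage_le rX pn gmu u11 u22 mfW fW0 fWmu gamma alpha01 d0).
Qed.
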